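(* There exists an absolute constant $C>0$ such that the following holds. Let $\{X_i: i\in\mathcal{V}\}$ be a field of real random variables indexed by the vertices of a finite dependency graph $\mathcal{G}=(\mathcal{V},\mathcal{E})$ with $\mathbb{E}X_i=0$ for all $i\in\mathcal{V}$. Let $n=|\mathcal{V}|$ and let $d\ge1$ be the maximal degree of $\mathcal{G}$. Let $S=\sum_{i\in\mathcal{V}}X_i$, $Y_i=\sum_{j\in A_i}X_j$, $V=\sqrt{\bigl(\sum_{i\in\mathcal{V}}(X_iY_i-\bar X\bar Y)\bigr)_+}$ and $W=S/V$. Let $\sigma^2=\sum_{i\in\mathcal{V}}\mathbb{E}\{X_iY_i\}$, assumed positive, and $\gamma=\sum_{i\in\mathcal{V}}\mathbb{E}|X_i/\sigma|^3$, assumed finite. Then $$\sup_{z\in\mathbb{R}}\bigl|\mathbb{P}(W\le z)-\Phi(z)\bigr|\le Cd^9\bigl(1+d^6n^{1/3}\gamma^{2/3}\bigr)\bigl(n^{-1/2}+\gamma\bigr),$$ where $\Phi$ is the standard normal distribution function.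
   Context: $\mathcal{G}=(\mathcal{V},\mathcal{E})$ is a dependency graph for $\{X_i:i\in\mathcal{V}\}$ if for any pair of disjoint sets $\Gamma_1,\Gamma_2\subset\mathcal{V}$ such that no edge of $\mathcal{G}$ has one endpoint in $\Gamma_1$ and the other in $\Gamma_2$, the families $\{X_i:i\in\Gamma_1\}$ and $\{X_j:j\in\Gamma_2\}$ are independent. For $i\in\mathcal{V}$, $A_i=\{i\}\cup\{j\in\mathcal{V}:\text{there is an edge connecting } i \text{ and } j\}$. Also $\bar X=\sum_{i\in\mathcal{V}}X_i/n$, $\bar Y=\sum_{i\in\mathcal{V}}Y_i/n$, $(x)_+=\max(x,0)$, and $W:=0$ on the event $\{V=0\}$. *)

(* Defs.v *)
From HB Require Import structures.
From mathcomp Require Import all_boot all_order all_algebra.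
From mathcomp Require Import all_classical all_reals all_analysis.

Set Implicit Arguments.
Unset Strict Implicit.
Unset Printing Implicit Defensive.

Import Order.TTheory GRing.Theory Num.Theory.
Import numFieldNormedType.Exports.

Local Open Scope classical_set_scope.
Local Open Scope ring_scope.

Definition simple_graph (I : finType) (e : rel I) : Prop :=
  symmetric e /\ irreflexive e.

Definition max_degree (I : finType) (e : rel I) : nat :=
  (\max_(i : I) #|[set j : I | e i j]%SET|)%N.

Definition closed_nbhd (I : finType) (e : rel I) (i : I) : {set I} :=
  (i |: [set j | e i j])%SET.

Section Independence.
Context (dsp : measure_display) (T : measurableType dsp) (R : realType).
Context (P : probability T R) (I : finType).
Implicit Types (X : I -> {RV P >-> R}) (G : {set I}) (e : rel I).

Definition sigma_family X G : set (set T) :=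
  <<s \bigcup_(i in [set` G]) preimage_set_system setT (X i) measurable >>.

Definition independent_families X G1 G2 : Prop :=
  forall A B : set T, sigma_family X G1 A -> sigma_family X G2 B ->
    P (A `&` B) = (P A * P B)%E.

Definition dependency_graph e X : Prop :=
  simple_graph e /\
  forall G1 G2 : {set I}, [disjoint G1 & G2]%B ->
    (forall i j, i \in G1 -> j \in G2 -> ~~ e i j) ->
    independent_families X G1 G2.

End Independence.

Section SelfNormalizedSum.
Context (dsp : measure_display) (T : measurableType dsp) (R : realType).
Context (P : probability T R) (I : finType).
Variables (e : rel I) (X : I -> {RV P >-> R}).

Definition total (w : T) : R := \sum_(i : I) X i w.

Definition localsum (i : I) (w : T) : R := \sum_(j in closed_nbhd e i) X j w.

Definition Xbar (w : T) : R := (\sum_(i : I) X i w) / #|I|%:R.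

Definition Ybar (w : T) : R := (\sum_(i : I) localsum i w) / #|I|%:R.

Definition normalizer (w : T) : R :=
  Num.sqrt
    (Num.max (\sum_(i : I) (X i w * localsum i w - Xbar w * Ybar w)) 0).

Definition selfnormalized (w : T) : R :=
  if normalizer w == 0 then 0 else total w / normalizer w.

Definition sigma2 : \bar R :=
  (\sum_(i : I) 'E_P[fun w => (X i w * localsum i w)%R])%E.

(* Meaningful only when sigma2 is finite, since fine sends infinities to 0. *)
Definition sigma : R := Num.sqrt (fine sigma2).

Definition gamma : \bar R :=
  (\sum_(i : I) 'E_P[fun w => (`|X i w / sigma| ^+ 3)%R])%E.

End SelfNormalizedSum.

Definition std_normal_cdf (R : realType) (z : R) : \bar R :=
  normal_prob 0 1 `]-oo, z].

(* Main.v *)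
(**
  Write [x_i = X_i / sigma] and [D = d + 1].  Truncating every [x_i] at level
  [D^-4] and rounding it to a fine lattice [h Z] gives variables [xi_i] on a
  finite probability space with the same dependency graph, at a cost
  controlled by [gamma] and [h]; all moments and conditional expectations are
  then finite sums.

  Let [S = sum xi_i], [eta_i] the sum of [xi] over the closed neighbourhood of
  [i], [Q = sum xi_i eta_i] and [U = Q^(-1/2)], clipped so that
  [1/2 <= U <= 2].  Expanding [S U f(S U)] around the statistics with the
  neighbourhood of [j] deleted produces [Q U^2 f'(S U)], and [Q U^2 = 1] off
  the clipping, so that self-normalisation costs only the variance of [Q].  For
  the Stein solution [f] at level [y], the jump of [f'] contributes
  [E |xi_j eta_j| 1(|S U - y| <= 2 |eta_j|)], which is bounded by a
  concentration inequality for [S U] weighted by a function of the variables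
  near [j].  That inequality comes from the same expansion with a trapezoidal
  ramp for [f]: its error terms reproduce half of the quantity to be bounded.

  The centring [n Xbar Ybar] is small off an event whose probability is bounded
  through [E (1 + S^2) |sum eta_i|].  Finally [sum E xi_i^2] is at most
  [b = n^(1/3) gamma^(2/3)], and [b] is at least of order [1/D] because [E Q]
  is close to [1]; this lower bound turns the powers of [D] that occur into
  [d^9 (1 + d^6 b)].
*)

Require Import Defs.
From HB Require Import structures.
From mathcomp Require Import all_boot all_order all_algebra.
From mathcomp Require Import all_classical all_reals all_analysis.
From mathcomp Require Import measurable_realfun ring lra.

Set Implicit Arguments.
Unset Strict Implicit.
Unset Printing Implicit Defensive.

Import Order.TTheory GRing.Theory Num.Theory.
Import numFieldNormedType.Exports.

Local Open Scope ring_scope.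

(** * Local dependence on a finite probability space *)

Section FiniteExpectation.
Context {R : realType} {O : finType} (p : O -> R).

(** The scale [U] involves every variable, so dividing by it destroys local dependence; deleting a
    neighbourhood from both the sum and the quadratic form restores exact independence of the
    variable at its centre. What is deleted must stay bounded: a ball of radius [r] has at most
    [D^r] points and absolute values are summed over radii up to 4, hence the level [D^-4].
    Truncation spoils the centring, so a bound [e] on the sum of the absolute means is carried
    along. Only third moments are available. The random increments met in the concentration
    inequality are therefore compared with their means by Cauchy-Schwarz over the shift, not by a
    moment of higher order; lattice values turn this into a finite sum in which the mesh cancels.
    Conditioning on the variables near a vertex is expressed by arbitrary nonnegative weights
    depending on them. The argument runs with [n^(-1/2) + gamma] in place of [gamma], which absorbs
    the mesh errors, and in the regime where [D^8] times this quantity is at most 1/8; elsewhere the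
    claimed bound exceeds 1. *)

Definition Ex (F : O -> R) : R := \sum_(w : O) p w * F w.

Lemma eq_Ex F G : F =1 G -> Ex F = Ex G.
Proof. by move=> h; apply: eq_bigr => w _; rewrite h. Qed.

Lemma ExD F G : Ex (fun w => F w + G w) = Ex F + Ex G.
Proof. by rewrite -big_split; apply: eq_bigr => w _; rewrite mulrDr. Qed.

Lemma ExN F : Ex (fun w => - F w) = - Ex F.
Proof. by rewrite /Ex -sumrN; apply: eq_bigr => w _; rewrite mulrN. Qed.

Lemma ExB F G : Ex (fun w => F w - G w) = Ex F - Ex G.
Proof. by rewrite ExD ExN. Qed.

Lemma ExZl c F : Ex (fun w => c * F w) = c * Ex F.
Proof. by rewrite /Ex mulr_sumr; apply: eq_bigr => w _; rewrite mulrCA. Qed.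

Lemma ExZr c F : Ex (fun w => F w * c) = Ex F * c.
Proof. by rewrite /Ex mulr_suml; apply: eq_bigr => w _; rewrite mulrA. Qed.

Lemma Ex_sum (J : finType) (P : pred J) (F : J -> O -> R) :
  Ex (fun w => \sum_(j | P j) F j w) = \sum_(j | P j) Ex (F j).
Proof.
rewrite /Ex exchange_big; apply: eq_bigr => w _; rewrite mulr_sumr //.
Qed.

Hypothesis p_ge0 : forall w, 0 <= p w.

Lemma Ex_ge0 F : (forall w, 0 <= F w) -> 0 <= Ex F.
Proof. by move=> h; apply: sumr_ge0 => w _; apply: mulr_ge0. Qed.

Lemma le_Ex F G : (forall w, F w <= G w) -> Ex F <= Ex G.
Proof. by move=> h; apply: ler_sum => w _; apply: ler_wpM2l. Qed.

Lemma norm_Ex F : `|Ex F| <= Ex (fun w => `|F w|).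
Proof.
apply: le_trans (ler_norm_sum _ _ _) _; apply: ler_sum => w _.
by rewrite normrM (ger0_norm (p_ge0 w)).
Qed.

Hypothesis p_sum1 : \sum_(w : O) p w = 1.

Lemma Ex_cst c : Ex (fun=> c) = c.
Proof. by rewrite /Ex -mulr_suml p_sum1 mul1r. Qed.

Lemma Ex_centered_sq F :
  Ex (fun w => (F w - Ex F) ^+ 2) = Ex (fun w => F w ^+ 2) - Ex F ^+ 2.
Proof.
transitivity (Ex (fun w => F w ^+ 2 + (- 2 * Ex F) * F w + Ex F ^+ 2)).
  by apply: eq_Ex => w; ring.
by rewrite !ExD ExZl Ex_cst; ring.
Qed.

Lemma Ex_le_cst F c : (forall w, F w <= c) -> Ex F <= c.
Proof. by move=> h; rewrite -[leRHS]Ex_cst; apply: le_Ex. Qed.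

End FiniteExpectation.

(** * Balls and separation in the dependency graph *)

Section Neighbourhoods.
Context {I : finType} (nb : I -> {set I}) (D : nat).
Hypothesis nb_refl : forall i, i \in nb i.
Hypothesis nb_sym : forall i j, (j \in nb i) = (i \in nb j).
Hypothesis nb_card : forall i, (#|nb i| <= D)%N.

Definition thicken (A : {set I}) : {set I} := \bigcup_(i in A) nb i.

Definition ball (r : nat) (i : I) : {set I} := iter r thicken [set i].

(** Because [i \in nb i], separation also makes [A] and [B] disjoint, so it combines both conditions
    under which a dependency graph yields independence. *)
Definition sep (A B : {set I}) : Prop :=
  forall i j, i \in A -> j \in B -> j \notin nb i.

Lemma thickenP (A : {set I}) j : reflect (exists2 i, i \in A & j \in nb i) (j \in thicken A).
Proof. exact: finset.bigcupP. Qed.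

Lemma sub_thicken (A : {set I}) : A \subset thicken A.
Proof. by apply/fintype.subsetP => i iA; apply/thickenP; exists i. Qed.

Lemma ballS r i : ball r.+1 i = thicken (ball r i).
Proof. by []. Qed.

Lemma ball0 i : ball 0 i = [set i].
Proof. by []. Qed.

Lemma ball1 i : ball 1 i = nb i.
Proof. by rewrite ballS /thicken ball0 big_set1. Qed.

Lemma ball_nb r i j k : j \in ball r i -> k \in nb j -> k \in ball r.+1 i.
Proof. by move=> ij jk; apply/thickenP; exists j. Qed.

Lemma ball_trans r s i j k :
  j \in ball r i -> k \in ball s j -> k \in ball (s + r) i.
Proof.
move=> ij; elim: s k => [|s IH] k; first by rewrite ball0 inE => /eqP ->.
by rewrite addSn => /thickenP[l /IH il lk]; apply: ball_nb il lk.
Qed.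

Lemma ball_sym r i j : (j \in ball r i) = (i \in ball r j).
Proof.
have H : forall s a c, c \in ball s a -> a \in ball s c.
  elim=> [a c|s IH a c]; first by rewrite !ball0 !inE eq_sym.
  move=> /thickenP[k ak kc]; have ka := IH _ _ ak.
  by rewrite -addn1; apply: ball_trans ka; rewrite ball1 -nb_sym.
by apply/idP/idP; apply: H.
Qed.

Lemma ball_le r s i : (r <= s)%N -> ball r i \subset ball s i.
Proof.
move=> /subnK <-; elim: (s - r)%N => // m IH.
by rewrite addSn ballS; apply: fintype.subset_trans IH (sub_thicken _).
Qed.

Lemma card_thicken (A : {set I}) : (#|thicken A| <= #|A| * D)%N.
Proof.
rewrite /thicken; apply: leq_trans (_ : \sum_(i in A) #|nb i| <= _)%N.
  elim/big_rec2: _ => [|i m B _ IH]; first by rewrite cards0.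
  by apply: leq_trans (leq_card_setU _ _) _; rewrite leq_add2l.
by rewrite -sum_nat_const; apply: leq_sum.
Qed.

Lemma card_ball r i : (#|ball r i| <= D ^ r)%N.
Proof.
elim: r => [|r IH]; first by rewrite ball0 cards1.
by rewrite ballS expnSr; apply: leq_trans (card_thicken _) _; rewrite leq_mul2r IH orbT.
Qed.

Lemma sepS (A A' B B' : {set I}) : A' \subset A -> B' \subset B -> sep A B -> sep A' B'.
Proof. by move=> /fintype.subsetP hA /fintype.subsetP hB h i j /hA iA /hB jB; apply: h. Qed.

Lemma sep_thickenC (A : {set I}) : sep A (~: thicken A).
Proof.
move=> i j iA; rewrite inE; apply: contra => ij.
by apply/thickenP; exists i.
Qed.

Lemma sep_balls r s i j : j \notin ball (r + s).+1 i -> sep (ball r i) (ball s j).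
Proof.
move=> ijN k l ik jl; apply: contra ijN => kl.
have il := ball_nb ik kl.
by rewrite ball_sym in jl; rewrite addnC -addnS; apply: ball_trans il jl.
Qed.

End Neighbourhoods.

(** * Deterministic inequalities for sums over neighbourhoods *)

Section NeighbourhoodSums.
Context {R : realType} {I : finType} (nb : I -> {set I}) (D : nat).
Hypothesis nb_refl : forall i, i \in nb i.
Hypothesis nb_sym : forall i j, (j \in nb i) = (i \in nb j).
Hypothesis nb_card : forall i, (#|nb i| <= D)%N.

Definition nsum (x : I -> R) (i : I) : R := \sum_(j in nb i) x j.

Definition nquad (x : I -> R) : R := \sum_i x i * nsum x i.

Definition zero_on (A : {set I}) (x : I -> R) (i : I) : R :=
  if i \in A then 0 else x i.

Definition nabs (x : I -> R) (i : I) : R := nsum (fun j => `|x j|) i.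

(** Double counting: after exchanging the sums, [f j] occurs once for each [i] with [j \in N i], and
    by symmetry there are at most [M] of those. *)
Lemma sum_nbhd_le (N : I -> {set I}) (M : nat) (J : {set I}) (f : I -> R) :
  (forall i j, (j \in N i) = (i \in N j)) -> (forall i, (#|N i| <= M)%N) ->
  (forall i, 0 <= f i) ->
  \sum_(i in J) \sum_(j in J | j \in N i) f j <= M%:R * \sum_(i in J) f i.
Proof.
move=> Nsym Ncard f0.
rewrite (exchange_big_dep (mem J)) /=; last by move=> i j _ /andP[].
rewrite mulr_sumr; apply: ler_sum => j jJ.
rewrite sumr_const -[leLHS]mulr_natl; apply: ler_wpM2r; rewrite ?f0 // ler_nat.
apply: leq_trans (Ncard j); apply: subset_leq_card; apply/fintype.subsetP => i.
by rewrite unfold_in => /and3P[_ _]; rewrite Nsym.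
Qed.

Lemma sum_nb_exchange (f : I -> I -> R) :
  \sum_i \sum_(j in nb i) f i j = \sum_i \sum_(j in nb i) f j i.
Proof.
rewrite (exchange_big_dep predT) //=; apply: eq_bigr => j _.
by apply: eq_bigl => i; rewrite nb_sym.
Qed.

Lemma sum_nb_le (f : I -> R) : (forall i, 0 <= f i) ->
  \sum_i \sum_(j in nb i) f j <= D%:R * \sum_i f i.
Proof.
move=> f0; have := @sum_nbhd_le nb D [set: I] f nb_sym nb_card f0.
have -> : \sum_(i in [set: I]) f i = \sum_i f i.
  by apply: eq_bigl => i; rewrite inE.
congr (_ <= _); rewrite (eq_bigl predT); last by move=> i; rewrite inE.
by apply: eq_bigr => i _; apply: eq_bigl => j; rewrite inE.
Qed.

Lemma sum_nb_cst_le (f : I -> R) : (forall i, 0 <= f i) ->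
  \sum_i \sum_(j in nb i) f i <= D%:R * \sum_i f i.
Proof. by move=> f0; rewrite (sum_nb_exchange (fun i _ => f i)) sum_nb_le. Qed.

Lemma norm_nsum_le x i : `|nsum x i| <= nabs x i.
Proof. exact: ler_norm_sum. Qed.

Lemma nabs_ge0 x i : 0 <= nabs x i.
Proof. by apply: sumr_ge0 => j _. Qed.

Lemma norm_le_nabs x i : `|x i| <= nabs x i.
Proof. by rewrite /nabs /nsum (bigD1 i) //= lerDl; apply: sumr_ge0. Qed.

Lemma nsum_sq_le (a : I -> R) i :
  nsum a i ^+ 2 <= D%:R * \sum_(j in nb i) a j ^+ 2.
Proof.
have -> : nsum a i ^+ 2 = \sum_(j in nb i) \sum_(k in nb i) a j * a k.
  by rewrite expr2 /nsum mulr_suml; apply: eq_bigr => j _; rewrite mulr_sumr.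
apply: le_trans (_ : \sum_(j in nb i) \sum_(k in nb i)
  (a j ^+ 2 / 2 + a k ^+ 2 / 2) <= _).
  apply: ler_sum => j _; apply: ler_sum => k _.
  by have := sqr_ge0 (a j - a k); lra.
under eq_bigr do rewrite big_split /= sumr_const.
rewrite big_split /= sumr_const sumrMnl -mulr_suml.
set s := \sum_(_ in _) _; rewrite -(mulr_natl (s / 2)) -mulrDr -splitr.
rewrite ler_wpM2r ?ler_nat //.
by apply: sumr_ge0 => j _; apply: sqr_ge0.
Qed.

Lemma sum_nabs_sq_le x :
  \sum_i `|x i| * nabs x i ^+ 2 <= D%:R ^+ 2 * \sum_i `|x i| ^+ 3.
Proof.
set a := fun i => `|x i|; have a0 i : 0 <= a i by exact: normr_ge0.
apply: le_trans (_ : \sum_i D%:R * \sum_(j in nb i)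
  (a i ^+ 3 / 3 + a j ^+ 3 * (2 / 3)) <= _).
  apply: ler_sum => i _.
  apply: le_trans (ler_wpM2l (a0 i) (nsum_sq_le a i)) _.
  rewrite mulrCA ler_wpM2l ?ler0n // mulr_sumr; apply: ler_sum => j _.
  have := a0 i; have := a0 j; move: (a i) (a j) => s t ht hs.
  rewrite -subr_ge0.
  (* The weighted AM-GM inequality [s t^2 <= s^3 / 3 + 2 t^3 / 3], in the form of an explicit
     nonnegative factorisation. *)
  rewrite (_ : _ - _ = (s - t) ^+ 2 * (s + 2 * t) / 3); last by field.
  apply: divr_ge0 => //; apply: mulr_ge0; first exact: sqr_ge0.
  by lra.
rewrite -mulr_sumr expr2 -mulrA ler_wpM2l ?ler0n //.
under eq_bigr do rewrite big_split.
rewrite big_split /=.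
have a30 i : 0 <= a i ^+ 3 by apply: exprn_ge0.
have h1 := @sum_nb_cst_le (fun i => a i ^+ 3 / 3) (fun i => divr_ge0 (a30 i) (ler0n _ 3)).
have h2 := @sum_nb_le (fun i => a i ^+ 3 * (2 / 3))
  (fun i => mulr_ge0 (a30 i) (divr_ge0 (ler0n _ 2) (ler0n _ 3))).
apply: le_trans (lerD h1 h2) _.
by rewrite -!mulr_suml -mulrDr; set s := \sum_i _; rewrite ler_wpM2l ?ler0n //; lra.
Qed.

Lemma sum_nb_nabsE x :
  \sum_i `|x i| * \sum_(k in nb i) `|x k| * nabs x k =
  \sum_i `|x i| * nabs x i ^+ 2.
Proof.
under eq_bigr do rewrite mulr_sumr.
rewrite sum_nb_exchange; apply: eq_bigr => i _.
by rewrite -mulr_suml expr2; exact: mulrCA.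
Qed.

Lemma sum_sq_nabs_le x :
  \sum_i x i ^+ 2 * nabs x i <= D%:R ^+ 2 * \sum_i `|x i| ^+ 3.
Proof.
apply: le_trans (sum_nabs_sq_le x); apply: ler_sum => i _.
rewrite -real_normK ?num_real // !expr2 -!mulrA ler_wpM2l //.
by rewrite ler_wpM2r ?nabs_ge0 // norm_le_nabs.
Qed.

Lemma sum_norm_nabs_le x :
  \sum_i `|x i| * nabs x i <= D%:R * \sum_i x i ^+ 2.
Proof.
apply: le_trans (_ : \sum_i \sum_(j in nb i) (x i ^+ 2 / 2 + x j ^+ 2 / 2) <= _).
  apply: ler_sum => i _; rewrite mulr_sumr; apply: ler_sum => j _.
  have := sqr_ge0 (`|x i| - `|x j|).
  by rewrite -(real_normK (num_real (x i))) -(real_normK (num_real (x j))); lra.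
under eq_bigr do rewrite big_split.
have h0 i : 0 <= x i ^+ 2 / 2 by rewrite divr_ge0 ?sqr_ge0.
rewrite big_split /=.
apply: le_trans (lerD (sum_nb_cst_le h0) (sum_nb_le h0)) _.
by rewrite -!mulr_suml -mulrDr -splitr.
Qed.

Lemma eq_nquad x y : x =1 y -> nquad x = nquad y.
Proof.
move=> h; apply: eq_bigr => i _; rewrite h; congr (_ * _).
by apply: eq_bigr => j _; rewrite h.
Qed.

(** Only products with an index in [A] are lost. Each is charged to an endpoint in [A], through
    [f i j] or [f j i]; symmetry of [nb] makes the two total charges equal, whence the factor 2. *)
Lemma nquad_zero_on_le A x :
  `|nquad x - nquad (zero_on A x)| <= 2 * \sum_(i in A) `|x i| * nabs x i.
Proof.
rewrite -sumrB.
apply: le_trans (ler_norm_sum _ _ _) _.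
set z := zero_on A x.
pose f i j := if i \in A then `|x i| * `|x j| else 0.
apply: le_trans (_ : \sum_i \sum_(j in nb i) (f i j + f j i) <= _).
  apply: ler_sum => i _; rewrite /nsum !mulr_sumr -sumrB.
  apply: le_trans (ler_norm_sum _ _ _) _; apply: ler_sum => j _.
  have h0 : 0 <= `|x i| * `|x j| by rewrite mulr_ge0.
  rewrite /f /z /zero_on; case: ifP => iA; case: ifP => jA;
    rewrite ?mul0r ?mulr0 ?subr0 ?addr0 ?add0r ?subrr ?normr0 ?normrM //.
    by rewrite (mulrC `|x j|) lerDl.
  by rewrite mulrC.
under eq_bigr do rewrite big_split.
rewrite big_split /= -(sum_nb_exchange f).
have -> : \sum_i \sum_(j in nb i) f i j = \sum_(i in A) `|x i| * nabs x i.
  rewrite [RHS]big_mkcond; apply: eq_bigr => i _; rewrite /f.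
  by case: ifP => _; [rewrite -mulr_sumr | rewrite big1].
by rewrite mulrDl mul1r.
Qed.

End NeighbourhoodSums.

(** * The clipped inverse square root *)

Section ClippedInverseRoot.
Context {R : realType}.

Definition clip (q : R) : R := Num.min (Num.max q 4^-1) 4.

Definition invroot (q : R) : R := (Num.sqrt (clip q))^-1.

Lemma clip_ge q : 4^-1 <= clip q.
Proof. by rewrite /clip le_min le_max lexx orbT /=; lra. Qed.

Lemma clip_le q : clip q <= 4.
Proof. by rewrite /clip ge_min lexx orbT. Qed.

Lemma clip_lip q q' : `|clip q - clip q'| <= `|q - q'|.
Proof.
have maxL (a b c : R) : `|Num.max a c - Num.max b c| <= `|a - b|.
  by rewrite !maxElt; case: ltP => ?; case: ltP => ?;
    case: (ler0P (a - b)) => ?; rewrite ?ler_norml; lra.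
have minL (a b c : R) : `|Num.min a c - Num.min b c| <= `|a - b|.
  by rewrite !minElt; case: ltP => ?; case: ltP => ?;
    case: (ler0P (a - b)) => ?; rewrite ?ler_norml; lra.
exact: le_trans (minL _ _ _) (maxL _ _ _).
Qed.

Lemma sqrt_clip_bounds q : 2^-1 <= Num.sqrt (clip q) <= 2.
Proof.
have E (a : R) : 0 <= a -> a = Num.sqrt (a ^+ 2) by move=> a0; rewrite sqrtr_sqr ger0_norm.
rewrite [X in X <= _ <= _]E ?invr_ge0 // [X in _ <= _ <= X]E //.
rewrite !ler_sqrt ?exprn_ge0 //; last by apply: le_trans (clip_ge q); rewrite invr_ge0.
by have := clip_ge q; have := clip_le q; lra.
Qed.

Lemma invroot_bounds q : 2^-1 <= invroot q <= 2.
Proof.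
have /andP[h1 h2] := sqrt_clip_bounds q.
have h0 : 0 < Num.sqrt (clip q) by lra.
rewrite /invroot -[X in _ <= _ <= X]invrK !lef_pV2 ?posrE ?invr_gt0 //.
by rewrite h1 h2.
Qed.

Lemma sqr_sqrt_clip q : Num.sqrt (clip q) ^+ 2 = clip q.
Proof. by rewrite sqr_sqrtr //; have := clip_ge q; lra. Qed.

(** For roots [s, t >= 1/2], [|1/s - 1/t| = |s^2 - t^2| / (s t (s + t))] and the denominator is at
    least 1/4. *)
Lemma invroot_lip q q' : `|invroot q - invroot q'| <= 4 * `|q - q'|.
Proof.
apply: le_trans (ler_wpM2l _ (clip_lip q q')) => //.
have /andP[h1 _] := sqrt_clip_bounds q; have /andP[h1' _] := sqrt_clip_bounds q'.
rewrite -(sqr_sqrt_clip q) -(sqr_sqrt_clip q') /invroot.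
move: (Num.sqrt (clip q)) (Num.sqrt (clip q')) h1 h1' => s t hs ht.
have s0 : 0 < s by lra.
have t0 : 0 < t by lra.
rewrite subr_sqr normrM (gtr0_norm (addr_gt0 s0 t0)).
have -> : s^-1 - t^-1 = (t - s) / (s * t) by field; rewrite !gt_eqF.
rewrite normrM normfV (gtr0_norm (mulr_gt0 s0 t0)) distrC mulrCA.
apply: ler_wpM2l => //; rewrite -div1r ler_pdivrMr ?mulr_gt0 //.
have : 4^-1 <= s * t by nra.
by nra.
Qed.

(** The left side vanishes on [[1/4, 4]]. Elsewhere [q] is at distance at least 3/4 from 1, so an
    error linear in [q - 1] is dominated by a quadratic one. The square is what makes the cost a
    variance of [Q] and not a standard deviation. *)
Lemma invroot_sqr_err q : `|q * invroot q ^+ 2 - 1| <= 4 * (q - 1) ^+ 2.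
Proof.
rewrite /invroot exprVn sqr_sqrt_clip /clip.
rewrite minElt maxElt; case: (ltP q 4^-1) => h1; last case: (ltP q 4) => h2.
- rewrite ifT; last by lra.
  rewrite invrK; have h0 : q * 4 - 1 < 0 by lra.
  by rewrite ltr0_norm //; have := sqr_ge0 (1 - q); nra.
- rewrite divff ?subrr ?normr0; last by rewrite gt_eqF //; lra.
  by rewrite mulr_ge0 ?sqr_ge0.
- have h0 : 0 <= q / 4 - 1 by lra.
  by rewrite ger0_norm //; nra.
Qed.

End ClippedInverseRoot.

(** * Locally dependent bounded variables: variance and decoupling *)

Section LocalField.
Context {R : realType} {O I : finType} (p : O -> R) (nb : I -> {set I}) (D : nat).
Variable xi : I -> O -> R.

(** Measurability with respect to the variables indexed by [A]: on a finite space this is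
    factorisation through their values. *)
Definition dep {T : Type} (A : {set I}) (F : O -> T) : Prop :=
  forall w w', (forall i, i \in A -> xi i w = xi i w') -> F w = F w'.

Record local_field : Prop := LocalField {
  lf_ge0 : forall w, 0 <= p w;
  lf_sum1 : \sum_(w : O) p w = 1;
  lf_refl : forall i, i \in nb i;
  lf_sym : forall i j, (j \in nb i) = (i \in nb j);
  lf_card : forall i, (#|nb i| <= D)%N;
  lf_deg : (2 <= D)%N;
  lf_ind : forall (A B : {set I}) (F G : O -> R), sep nb A B -> dep A F -> dep B G ->
    Ex p (fun w => F w * G w) = Ex p F * Ex p G;
  lf_bdd : forall i w, `|xi i w| <= (D ^ 4)%:R^-1 }.

Definition fsum (w : O) : R := \sum_i xi i w.
Definition feta (i : I) (w : O) : R := nsum nb (xi^~ w) i.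
Definition fabs (i : I) (w : O) : R := nabs nb (xi^~ w) i.
Definition fquad (w : O) : R := nquad nb (xi^~ w).

Section Dependence.
Context {T U V : Type}.

Lemma depS (A B : {set I}) (F : O -> T) : A \subset B -> dep A F -> dep B F.
Proof. by move=> /fintype.subsetP AB dF w w' h; apply: dF => i /AB; apply: h. Qed.

Lemma dep_comp A (g : T -> U) (F : O -> T) : dep A F -> dep A (fun w => g (F w)).
Proof. by move=> dF w w' h; rewrite (dF _ _ h). Qed.

Lemma dep_comp2 A (g : T -> U -> V) (F : O -> T) (G : O -> U) :
  dep A F -> dep A G -> dep A (fun w => g (F w) (G w)).
Proof. by move=> dF dG w w' h; rewrite (dF _ _ h) (dG _ _ h). Qed.

Lemma dep_cst A (c : T) : dep A (fun=> c).
Proof. by []. Qed.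

End Dependence.

Lemma dep_xi i (A : {set I}) : i \in A -> dep A (xi i).
Proof. by move=> iA w w' h; apply: h. Qed.

Lemma dep_sum (J : finType) (P : pred J) A (F : J -> O -> R) :
  (forall j, P j -> dep A (F j)) -> dep A (fun w => \sum_(j | P j) F j w).
Proof. by move=> dF w w' h; apply: eq_bigr => j Pj; apply: dF. Qed.

Lemma dep_zero_sum (A : {set I}) : dep (~: A) (fun w => \sum_i zero_on A (xi^~ w) i).
Proof.
move=> w w' h; apply: eq_bigr => i _; rewrite /zero_on; case: ifP => // iA.
by apply: h; rewrite inE iA.
Qed.

Lemma dep_zero_quad (A : {set I}) : dep (~: A) (fun w => nquad nb (zero_on A (xi^~ w))).
Proof.
move=> w w' h; apply: eq_nquad => i; rewrite /zero_on; case: ifP => // iA.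
by apply: h; rewrite inE iA.
Qed.

Lemma dep_feta i (A : {set I}) : nb i \subset A -> dep A (feta i).
Proof.
by move=> /fintype.subsetP iA; apply: dep_sum => j ji; apply: dep_xi; apply: iA.
Qed.

Lemma dep_fabs i (A : {set I}) : nb i \subset A -> dep A (fabs i).
Proof.
move=> /fintype.subsetP iA; apply: dep_sum => j ji.
by apply: (dep_comp Num.norm); apply: dep_xi; apply: iA.
Qed.

Hypothesis lf : local_field.
Let p_ge0 := lf_ge0 lf.
Let p_sum1 := lf_sum1 lf.
Let nb_refl := lf_refl lf.
Let nb_sym := lf_sym lf.
Let nb_card := lf_card lf.
Local Notation E := (Ex p).

Lemma D_gt0 : 0 < D%:R :> R.
Proof. by rewrite ltr0n (leq_trans _ (lf_deg lf)). Qed.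

Lemma D_ge2 : 2 <= D%:R :> R.
Proof. by rewrite ler_nat lf_deg. Qed.

Lemma sum_ball_le1 r i w : (r <= 4)%N -> \sum_(j in ball nb r i) `|xi j w| <= 1.
Proof.
move=> r4; apply: le_trans (_ : \sum_(j in ball nb r i) (D ^ 4)%:R^-1 <= _).
  by apply: ler_sum => j _; apply: lf_bdd.
rewrite sumr_const -[leLHS]mulr_natr mulrC ler_pdivrMr ?mul1r ?ler_nat; last first.
  by rewrite natrX exprn_gt0 // D_gt0.
apply: leq_trans (card_ball nb_card r i) _.
by rewrite leq_pexp2l // (leq_trans _ (lf_deg lf)).
Qed.

Lemma fabs_le1 i w : fabs i w <= 1.
Proof.
have := @sum_ball_le1 1 i w isT; rewrite ball1; exact.
Qed.

Lemma norm_feta_le1 i w : `|feta i w| <= 1.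
Proof. exact: le_trans (norm_nsum_le _ _ _) (fabs_le1 i w). Qed.

(* Covariances vanish beyond graph distance [2 r + 1]. *)
Lemma variance_local r (Z : I -> O -> R) (J : {set I}) :
  (forall i, i \in J -> dep (ball nb r i) (Z i)) ->
  E (fun w => (\sum_(i in J) Z i w - \sum_(i in J) E (Z i)) ^+ 2)
  <= (D ^ (r + r).+1)%:R * \sum_(i in J) E (fun w => Z i w ^+ 2).
Proof.
move=> dZ; pose Y i w := Z i w - E (Z i).
have dY i : i \in J -> dep (ball nb r i) (Y i).
  by move=> /dZ dZi; apply: (dep_comp (fun x => x - E (Z i))).
have EY i : E (Y i) = 0 by rewrite ExB Ex_cst // subrr.
have EY2 i : E (fun w => Y i w ^+ 2) <= E (fun w => Z i w ^+ 2).
  by rewrite Ex_centered_sq // lerBlDr lerDl sqr_ge0.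
have EY20 i : 0 <= E (fun w => Y i w ^+ 2) by apply: Ex_ge0 => // w; apply: sqr_ge0.
have -> : E (fun w => (\sum_(i in J) Z i w - \sum_(i in J) E (Z i)) ^+ 2) =
    \sum_(i in J) \sum_(j in J) E (fun w => Y i w * Y j w).
  under [RHS]eq_bigr do rewrite -Ex_sum.
  rewrite -[RHS]Ex_sum; apply: eq_Ex => w; rewrite -sumrB expr2 mulr_suml.
  by apply: eq_bigr => i _; rewrite mulr_sumr.
apply: le_trans (_ : \sum_(i in J) \sum_(j in J | j \in ball nb (r + r).+1 i)
   (E (fun w => Y i w ^+ 2) / 2 + E (fun w => Y j w ^+ 2) / 2) <= _).
  apply: ler_sum => i iJ; rewrite [leRHS]big_mkcondr.
  apply: ler_sum => j jJ; case: ifPn => ij.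
    rewrite -mulrDl -ExD -ExZr; apply: le_Ex => // w.
    by have := sqr_ge0 (Y i w - Y j w); lra.
  by rewrite (lf_ind lf (sep_balls nb_sym ij) (dY i iJ) (dY j jJ)) EY mul0r.
under eq_bigr do rewrite big_split.
have bsym i j := ball_sym nb_sym (r + r).+1 i j.
have bcard i := card_ball nb_card (r + r).+1 i.
pose f i := E (fun w => Y i w ^+ 2) / 2.
have f0 i : 0 <= f i by rewrite divr_ge0.
rewrite big_split /= -/f.
have h := sum_nbhd_le J bsym bcard f0.
have h' : \sum_(i in J) \sum_(j in J | j \in ball nb (r + r).+1 i) f i
   <= (D ^ (r + r).+1)%:R * \sum_(i in J) f i.
  apply: le_trans h; rewrite le_eqVlt; apply/orP; left; apply/eqP.
  rewrite (exchange_big_dep (mem J)) /=; last by move=> i j _ /andP[].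
  by apply: eq_bigr => i iJ; apply: eq_bigl => j; rewrite iJ andTb bsym.
apply: le_trans (lerD h' h) _.
rewrite -mulrDr ler_wpM2l ?ler0n // -big_split; apply: ler_sum => i _.
by rewrite /f /= -splitr.
Qed.

Definition wsum (c : I -> R) (w : O) : R := \sum_i c i * xi i w.

(** The part of [wsum c] outside [thicken nb A] is independent of [F], and the part inside is at
    most [2 M]. It is dropped before factorising and restored afterwards, which costs [2 M]
    twice. *)
Lemma decouple (c : I -> R) (M : R) (A : {set I}) (F : O -> R) :
  0 <= M -> (forall i, `|c i| <= M) -> (forall w, 0 <= F w) -> dep A F ->
  (forall w, \sum_(k in thicken nb A) `|xi k w| <= 2) ->
  E (fun w => F w * `|wsum c w|) <= E F * (E (fun w => `|wsum c w|) + 4 * M).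
Proof.
move=> M0 cM F0 dF A2.
pose G w := \sum_(i in ~: thicken nb A) c i * xi i w.
have wG w : `|wsum c w - G w| <= 2 * M.
  rewrite /wsum /G (bigID (mem (thicken nb A))) /= -addrA.
  have -> : \sum_(i in ~: thicken nb A) c i * xi i w =
      \sum_(i | i \notin thicken nb A) c i * xi i w.
    by apply: eq_bigl => i; rewrite inE.
  rewrite subrr addr0; apply: le_trans (ler_norm_sum _ _ _) _.
  apply: le_trans (_ : M * \sum_(k in thicken nb A) `|xi k w| <= _).
    by rewrite mulr_sumr; apply: ler_sum => k _; rewrite normrM ler_wpM2r.
  by rewrite mulrC ler_wpM2r.
have dG : dep (~: thicken nb A) (fun w => `|G w|).
  apply: (dep_comp Num.norm); apply: dep_sum => i iA.
  by apply: (dep_comp ( *%R (c i))); apply: dep_xi.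
apply: le_trans (_ : E (fun w => F w * `|G w| + F w * (2 * M)) <= _).
  apply: le_Ex => // w; rewrite -mulrDr ler_wpM2l //.
  have := wG w; rewrite -[X in `|X| <= _ + _](subrK (G w)) => h.
  by apply: le_trans (ler_normD _ _) _; rewrite addrC lerD2l.
rewrite ExD ExZr (lf_ind lf (@sep_thickenC _ _ A) dF dG) -mulrDr.
apply: ler_wpM2l; first exact: Ex_ge0.
have -> : 4 * M = 2 * M + 2 * M by lra.
rewrite addrA lerD2r -[X in _ + X](Ex_cst p_sum1) -ExD.
apply: le_Ex => // w; have := wG w; rewrite distrC => h.
rewrite -[X in `|X| <= _](subrK (wsum c w)).
by apply: le_trans (ler_normD _ _) _; rewrite addrC lerD2l.
Qed.

Variables g b e : R.

(* To be used with [g] close to [gamma] and [b = n^(1/3) gamma^(2/3)]. *)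
Record moment_bounds : Prop := MomentBounds {
  mb_third : \sum_i E (fun w => `|xi i w| ^+ 3) <= g;
  mb_second : \sum_i E (fun w => xi i w ^+ 2) <= b;
  mb_first : \sum_i `|E (xi i)| <= e;
  mb_small : e <= 2^-1;
  mb_quad : `|E fquad - 1| <= 4^-1 }.

Hypothesis mb : moment_bounds.

Lemma E_abs_fabs_sq : \sum_i E (fun w => `|xi i w| * fabs i w ^+ 2) <= D%:R ^+ 2 * g.
Proof.
rewrite -Ex_sum; apply: le_trans (ler_wpM2l _ (mb_third mb)); last first.
  by rewrite exprn_ge0 ?ler0n.
rewrite -Ex_sum -ExZl; apply: le_Ex => // w.
exact: (sum_nabs_sq_le nb_sym nb_card (xi^~ w)).
Qed.

(** Half of the bound that [nquad_zero_on_le] gives for the change of the quadratic form when the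
    neighbourhood of [i] is deleted. *)
Definition fnear (i : I) (w : O) : R := \sum_(k in nb i) `|xi k w| * fabs k w.

Lemma E_abs_fnear : \sum_i E (fun w => `|xi i w| * fnear i w) <= D%:R ^+ 2 * g.
Proof.
rewrite -Ex_sum; apply: le_trans E_abs_fabs_sq; rewrite -Ex_sum; apply: le_Ex => // w.
by rewrite (sum_nb_nabsE nb_sym (xi^~ w)).
Qed.

Lemma E_sq_fabs : \sum_i E (fun w => xi i w ^+ 2 * fabs i w) <= D%:R ^+ 2 * g.
Proof.
rewrite -Ex_sum; apply: le_trans (ler_wpM2l _ (mb_third mb)); last first.
  by rewrite exprn_ge0 ?ler0n.
rewrite -Ex_sum -ExZl; apply: le_Ex => // w.
exact: (sum_sq_nabs_le nb_refl nb_sym nb_card (xi^~ w)).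
Qed.

Lemma E_abs_fabs : \sum_i E (fun w => `|xi i w| * fabs i w) <= D%:R * b.
Proof.
rewrite -Ex_sum; apply: le_trans (ler_wpM2l _ (mb_second mb)); last first.
  by rewrite ler0n.
rewrite -Ex_sum -ExZl; apply: le_Ex => // w.
exact: (sum_norm_nabs_le nb_sym nb_card (xi^~ w)).
Qed.

Lemma first_moment_sub (P : pred I) : `|\sum_(i | P i) E (xi i)| <= e.
Proof.
apply: le_trans (mb_first mb); apply: le_trans (ler_norm_sum _ _ _) _.
by rewrite [leLHS]big_mkcond; apply: ler_sum => i _; case: ifP.
Qed.

Lemma e_ge0 : 0 <= e.
Proof. by apply: le_trans (mb_first mb); apply: sumr_ge0. Qed.

(** Non-adjacent pairs factorise and their products of means add up to at most [e^2], so [E S^2]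
    exceeds [E Q] by at most [e^2]. *)
Lemma E_fsum_sq : E (fun w => fsum w ^+ 2) <= 2.
Proof.
have -> : E (fun w => fsum w ^+ 2) =
    E fquad + \sum_i E (xi i) * \sum_(j | j \notin nb i) E (xi j).
  rewrite /fquad /nquad Ex_sum -big_split -[LHS](eq_Ex _ (F := fun w =>
    \sum_i xi i w * fsum w)); last by move=> w; rewrite -mulr_suml expr2.
  rewrite Ex_sum; apply: eq_bigr => i _.
  rewrite -Ex_sum -(lf_ind lf (A := [set i]) (B := ~: nb i)); first 1 last.
  - by move=> _ j /finset.set1P -> ; rewrite inE.
  - by apply: dep_xi; rewrite inE.
  - by apply: dep_sum => j ji; apply: dep_xi; rewrite inE.
  rewrite -[RHS]ExD; apply: eq_Ex => w; rewrite -mulrDr; congr (_ * _).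
  by rewrite /fsum (bigID (mem (nb i))).
have h1 : E fquad <= 1 + 4^-1.
  by have := mb_quad mb; rewrite ler_norml; lra.
have h2 : \sum_i E (xi i) * \sum_(j | j \notin nb i) E (xi j) <= e * e.
  apply: le_trans (_ : \sum_i `|E (xi i)| * e <= _).
    apply: ler_sum => i _; apply: le_trans (ler_norm _) _.
    by rewrite normrM ler_wpM2l // first_moment_sub.
  by rewrite -mulr_suml ler_wpM2r ?e_ge0 // mb_first.
by have := mb_small mb; have := e_ge0; nra.
Qed.

Lemma E_abs_fsum : E (fun w => `|fsum w|) <= 2.
Proof.
apply: le_trans (_ : E (fun w => fsum w ^+ 2 * 2^-1 + 1) <= _).
  apply: le_Ex => // w; have := sqr_ge0 (`|fsum w| - 1).
  by rewrite -(real_normK (num_real (fsum w))); lra.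
by rewrite ExD ExZr Ex_cst //; have := E_fsum_sq; lra.
Qed.

Lemma decouple_fsum (A : {set I}) (F : O -> R) :
  (forall w, 0 <= F w) -> dep A F ->
  (forall w, \sum_(k in thicken nb A) `|xi k w| <= 2) ->
  E (fun w => F w * `|fsum w|) <= 6 * E F.
Proof.
move=> F0 dF A2.
have wE : wsum (fun=> 1) =1 fsum by move=> w; apply: eq_bigr => i _; rewrite mul1r.
have := @decouple (fun=> 1) 1 A F ler01 _ F0 dF A2.
rewrite normr1 => /(_ (fun=> lexx _)).
rewrite (eq_Ex _ (G := fun w => F w * `|fsum w|)); last by move=> w; rewrite wE.
rewrite (eq_Ex _ (F := fun w => `|wsum _ w|) (G := fun w => `|fsum w|)); last by move=> w; rewrite wE.
move=> h; apply: le_trans h _; rewrite mulrC ler_wpM2r //; first exact: Ex_ge0.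
by have := E_abs_fsum; lra.
Qed.

(** The summand [xi i * feta i] lives on a ball of radius 1, so covariances reach distance 3, hence
    [D^3]. In its square one factor [feta i] is bounded by 1, which leaves third moments only. *)
Lemma E_fquad_var :
  E (fun w => (fquad w - E fquad) ^+ 2) <= (D ^ 3)%:R * (D%:R ^+ 2 * g).
Proof.
rewrite {2}/fquad /nquad Ex_sum.
have := @variance_local 1 (fun i w => xi i w * feta i w) finset.setT.
have tE (F : I -> R) : \sum_(i in [set: I]) F i = \sum_i F i.
  by apply: eq_bigl => i; rewrite inE.
rewrite tE => h; apply: le_trans _ (ler_wpM2l (ler0n _ _) E_sq_fabs).
apply: le_trans (_ : _ <= (D ^ 3)%:R * \sum_i E (fun w => (xi i w * feta i w) ^+ 2)) _; last first.
  apply: ler_wpM2l; rewrite ?ler0n //; apply: ler_sum => i _; apply: le_Ex => // w.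
  rewrite exprMn ler_wpM2l ?sqr_ge0 // -real_normK ?num_real // expr2.
  apply: le_trans (_ : `|feta i w| * 1 <= _).
    by rewrite ler_wpM2l // norm_feta_le1.
  by rewrite mulr1 norm_nsum_le.
rewrite tE in h; apply: le_trans _ (h _); first by apply: le_Ex => // w; rewrite tE.
move=> i _; rewrite ball1; apply: (dep_comp2 *%R); last exact: dep_feta.
exact: dep_xi.
Qed.

End LocalField.

(** * Concentration *)

Section TrapezoidalRamp.
Context {R : realType}.

Let pp (u : R) : R := Num.max u 0.

(** The antiderivative of the trapezoid that rises on [[-1, 0]], equals 1 on [[0, 1]] and falls on
    [[1, 2]]. Squared positive parts give a single formula with uniform Taylor remainders;
    subtracting 1 centres the range at 0. *)
Let unit_ramp (u : R) : R :=
  (pp (u + 1) ^+ 2 - pp u ^+ 2 - pp (u - 1) ^+ 2 + pp (u - 2) ^+ 2) / 2 - 1.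

Let unit_slope (u : R) : R := pp (u + 1) - pp u - pp (u - 1) + pp (u - 2).

Let ppP u : (pp u = 0 /\ u <= 0) \/ (pp u = u /\ 0 <= u).
Proof. by rewrite /pp; case: (lerP u 0) => h; [left | right; split=> //; exact: ltW]. Qed.

Let pp_taylor u v : 0 <= pp v ^+ 2 - pp u ^+ 2 - 2 * (v - u) * pp u <= (v - u) ^+ 2.
Proof.
have := sqr_ge0 (v - u); have := sqr_ge0 v.
by case: (ppP u) => -[-> hu]; case: (ppP v) => -[-> hv] ? ?; apply/andP; split; nra.
Qed.

Let unit_rampE u :
  [\/ u <= -1 /\ unit_ramp u = -1 /\ unit_slope u = 0,
      -1 <= u <= 0 /\ unit_ramp u = (u + 1) ^+ 2 / 2 - 1 /\ unit_slope u = u + 1,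
      0 <= u <= 1 /\ unit_ramp u = u - 2^-1 /\ unit_slope u = 1
   | 1 <= u /\ ((u <= 2 /\ unit_ramp u = 1 - (2 - u) ^+ 2 / 2 /\ unit_slope u = 2 - u)
       \/ (2 <= u /\ unit_ramp u = 1 /\ unit_slope u = 0))].
Proof.
rewrite /unit_ramp /unit_slope.
case: (ppP (u + 1)) => -[-> h1]; case: (ppP u) => -[-> h2];
  case: (ppP (u - 1)) => -[-> h3]; case: (ppP (u - 2)) => -[-> h4]; try lra.
- by apply: Or41; split; last split; lra.
- by apply: Or42; split; last split; lra.
- by apply: Or43; split; last split; lra.
- apply: Or44; split; first lra.
  by left; split; last split; lra.
- apply: Or44; split; first lra.
  by right; split; last split; lra.
Qed.

Let unit_ramp_bound u : -1 <= unit_ramp u <= 1.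
Proof.
case: (unit_rampE u) => [[h [-> _]]|[h [-> _]]|[h [-> _]]|[h [[h' [-> _]]|[h' [-> _]]]]];
  apply/andP; split; nra.
Qed.

Let unit_slope_bound u : 0 <= unit_slope u <= 1.
Proof.
case: (unit_rampE u) => [[h [_ ->]]|[h [_ ->]]|[h [_ ->]]|[h [[h' [_ ->]]|[h' [_ ->]]]]];
  lra.
Qed.

Let unit_ramp_incr u v : u <= v -> 0 <= unit_ramp v - unit_ramp u <= v - u.
Proof.
case: (unit_rampE u) => [[h [-> _]]|[h [-> _]]|[h [-> _]]|[h [[h' [-> _]]|[h' [-> _]]]]];
case: (unit_rampE v) => [[k [-> _]]|[k [-> _]]|[k [-> _]]|[k [[k' [-> _]]|[k' [-> _]]]]] uv;
  apply/andP; split; nra.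
Qed.

(** Here [t] is the derivative of [f]. It is Lipschitz with constant [1 / a], so the expansion error
    is quadratic, unlike that of a piecewise linear ramp; the bound [r] of the minimum takes over
    when [r] exceeds [a]. The indicator is possible because [f] is constant on either side of
    [[x - a, x + 2 a]]. *)
Lemma ramp_exists (x a : R) : 0 < a -> exists f t : R -> R,
  [/\ forall w, `|f w| <= a,
      forall v w : R, v <= w -> 0 <= f w - f v <= w - v,
      forall w, 0 <= t w,
      forall w, x <= w <= x + a -> t w = 1 &
      forall w s r : R, `|s| <= r ->
        `|f w - f (w - s) - s * t w| <=
        Num.min r (r ^+ 2 / a) * (x - a - r <= w <= x + 2 * a + r)%R%:R].
Proof.
move=> a0; exists (fun w => a * unit_ramp ((w - x) / a)), (fun w => unit_slope ((w - x) / a)).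
have resc v w : (v <= w) = ((v - x) / a <= (w - x) / a).
  by rewrite ler_pM2r ?invr_gt0 // lerD2r.
have incr v w : v <= w ->
    0 <= a * unit_ramp ((w - x) / a) - a * unit_ramp ((v - x) / a) <= w - v.
  rewrite resc => /unit_ramp_incr /andP[h1 h2]; rewrite -mulrBr mulr_ge0 ?(ltW a0) //=.
  rewrite -(ler_pM2l a0) in h2; apply: le_trans h2 _.
  by rewrite -mulrBl mulrCA divff ?gt_eqF // mulr1; lra.
split=> // [w|w|w hw|w s r sr].
- rewrite normrM (gtr0_norm a0) -[leRHS]mulr1 ler_pM2l // ler_norml.
  exact: unit_ramp_bound.
- by case/andP: (unit_slope_bound ((w - x) / a)).
- have : 0 <= (w - x) / a <= 1.
    by rewrite ler_pdivrMr // ler_pdivlMr // mul0r mul1r; lra.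
  case: (unit_rampE ((w - x) / a)) => [[h [_ ->]]|[h [_ ->]]|[h [_ ->]]|[h [[h' [_ ->]]|[h' [_ ->]]]]]; lra.
set u := (w - x) / a; set v := (w - s - x) / a.
have vE : v = u - s / a by rewrite /v /u -mulrBl; congr (_ / _); ring.
have vA : a * v = a * u - s.
  by rewrite vE mulrBr; congr (_ - _); rewrite mulrC divfK // gt_eqF.
have r0 : 0 <= r by apply: le_trans sr.
have sE : s = a * (u - v) by rewrite vE opprB addrC subrK mulrC divfK ?gt_eqF.
have [/= _|] := boolP (x - a - r <= w <= x + 2 * a + r); last first.
  have wE : w = x + a * u by rewrite /u mulrC divfK ?gt_eqF //; ring.
  move=> hw; rewrite mulr0.
  have hv : (u <= -1 /\ v <= -1) \/ (2 <= u /\ 2 <= v).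
    move: hw; rewrite negb_and -!ltNge => /orP[] hw; [left|right];
      move: sr; rewrite ler_norml => /andP[sr1 sr2].
      have : a * u <= - a by lra.
      have : a * v <= - a by rewrite vA; lra.
      by move=> ? ?; split; rewrite -(ler_pM2l a0); lra.
    have : a * 2 <= a * u by lra.
    have : a * 2 <= a * v by rewrite vA; lra.
    by move=> ? ?; split; rewrite -(ler_pM2l a0); lra.
  have rampL z : z <= -1 -> unit_ramp z = -1 /\ unit_slope z = 0.
    by case: (unit_rampE z) => [[h [-> ->]]|[h [-> ->]]|[h [-> ->]]|[h [[h' [-> ->]]|[h' [-> ->]]]]] hz;
      split; nra.
  have rampR z : 2 <= z -> unit_ramp z = 1 /\ unit_slope z = 0.
    by case: (unit_rampE z) => [[h [-> ->]]|[h [-> ->]]|[h [-> ->]]|[h [[h' [-> ->]]|[h' [-> ->]]]]] hz;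
      split; nra.
  by case: hv => -[]; [move=> /rampL[-> ->] /rampL[-> _] | move=> /rampR[-> ->] /rampR[-> _]];
    rewrite mulr0 subr0 subrr normr0.
rewrite mulr1 le_min; apply/andP; split.
  apply: le_trans sr.
  have /andP[t0 t1] := unit_slope_bound u.
  have [s0|s0] := leP 0 s.
    have /andP[] := incr (w - s) w ltac:(lra); rewrite -/u -/v => h1 h2.
    by rewrite (ger0_norm s0) ler_norml; nra.
  have /andP[] := incr w (w - s) ltac:(lra); rewrite -/u -/v => h1 h2.
  by rewrite (ltr0_norm s0) ler_norml; nra.
apply: le_trans (_ : s ^+ 2 / a <= _); last first.
  rewrite ler_pM2r ?invr_gt0 // -real_normK ?num_real //.
  by rewrite lerXn2r ?nnegrE.
have -> : s ^+ 2 / a = a * (u - v) ^+ 2.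
  by rewrite sE; move: (u - v) => d; field; rewrite gt_eqF.
rewrite sE -mulrA -!mulrBr normrM (gtr0_norm a0) ler_pM2l //.
(* [unit_ramp] is half of a combination of four squared positive parts with signs +, -, -, +. Each
   has its remainder in [[0, (v - u)^2]], so the combined remainder is at most [(v - u)^2] in
   absolute value. *)
have /andP[p1 p1'] := pp_taylor (u + 1) (v + 1); have /andP[p2 p2'] := pp_taylor u v.
have /andP[p3 p3'] := pp_taylor (u - 1) (v - 1); have /andP[p4 p4'] := pp_taylor (u - 2) (v - 2).
rewrite /unit_ramp /unit_slope ler_norml; apply/andP; split; lra.
Qed.

End TrapezoidalRamp.

(** * Increments of a function along lattice shifts *)

Section LatticeIncrements.
Context {R : realType} (h : R).
Hypothesis h_gt0 : 0 < h.

Definition stepsign (b : bool) : R := if b then 1 else -1.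

(** A pair (side, [k]) stands for the lattice interval between [k h] and [(k + 1) h] on one side of
    0. [increment] depends on the point [s] alone and [reached] on the shift [y] alone, so
    [g s - g (s - y)] becomes a sum of products with separated variables: a discrete form of
    integrating [g' (s - t)] over the [t] between 0 and [y]. *)
Definition increment (g : R -> R) (s : R) (c : bool * nat) : R :=
  g (s - stepsign c.1 * (c.2%:R * h)) - g (s - stepsign c.1 * (c.2.+1%:R * h)).

Definition reached (y : R) (c : bool * nat) : R := (c.2%:R * h < stepsign c.1 * y)%R%:R.

Lemma sum_lattice (L : nat) (F : bool * nat -> R) :
  \sum_(c : bool * 'I_L) F (c.1, nat_of_ord c.2) =
  \sum_(k < L) F (true, nat_of_ord k) + \sum_(k < L) F (false, nat_of_ord k).
Proof.
by rewrite -(pair_bigA _ (fun b (k : 'I_L) => F (b, nat_of_ord k))) /= big_bool.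
Qed.

Lemma sum_below (L m : nat) (F : nat -> R) : (m <= L)%N ->
  \sum_(k < L) F k * (k%:R * h < m%:R * h)%R%:R = \sum_(k < m) F k.
Proof.
move=> mL; rewrite (big_ord_widen L F mL) [RHS]big_mkcond; apply: eq_bigr => k _.
by rewrite ltr_pM2r // ltr_nat; case: ifP; rewrite ?mulr1 ?mulr0.
Qed.

Lemma sum_below0 (L m : nat) (F : nat -> R) :
  \sum_(k < L) F k * (k%:R * h < - (m%:R * h))%R%:R = 0.
Proof.
apply: big1 => k _; rewrite (_ : (_ < _) = false) ?mulr0 //.
apply/negbTE; rewrite -leNgt; apply: le_trans (_ : 0 <= _).
  by rewrite oppr_le0 mulr_ge0 ?ler0n ?ltW.
by rewrite mulr_ge0 ?ler0n ?ltW.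
Qed.

Lemma lattice_reached (F : bool * nat -> R) (L : nat) (m : int) :
  (absz m <= L)%N ->
  \sum_(c : bool * 'I_L) F (c.1, nat_of_ord c.2) * reached (m%:~R * h) (c.1, nat_of_ord c.2)
  = \sum_(k < absz m) F (0 <= m, nat_of_ord k).
Proof.
move=> mL; rewrite (sum_lattice L (fun c => F c * reached (m%:~R * h) c)) /reached /=.
case: m mL => m mL.
  rewrite mul1r mulN1r (@sum_below L m (fun k => F (true, k))) //.
  by rewrite (@sum_below0 L m (fun k => F (false, k))) addr0.
rewrite mul1r mulN1r NegzE mulrNz mulNr opprK.
rewrite (@sum_below0 L m.+1 (fun k => F (true, k))) add0r.
by rewrite (@sum_below L m.+1 (fun k => F (false, k))) //.
Qed.

Lemma lattice_increment (g : R -> R) (s : R) (L : nat) (m : int) :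
  (absz m <= L)%N ->
  \sum_(c : bool * 'I_L) increment g s (c.1, nat_of_ord c.2)
      * reached (m%:~R * h) (c.1, nat_of_ord c.2)
  = g s - g (s - m%:~R * h).
Proof.
move=> mL; rewrite (lattice_reached (increment g s)) // /increment /=.
pose G k := g (s - stepsign (0 <= m) * (k%:R * h)).
rewrite -(big_mkord xpredT (fun k => G k - G k.+1)).
under eq_bigr do rewrite -opprB.
rewrite sumrN telescope_sumr // opprB /G mul0r mulr0 subr0; congr (_ - g (_ - _)).
case: m {mL G} => m; first by rewrite /stepsign mul1r.
by rewrite /stepsign (_ : (0 <= Negz m) = false) // mulN1r NegzE mulrNz mulNr.
Qed.

Lemma lattice_length (L : nat) (m : int) : (absz m <= L)%N ->
  h * \sum_(c : bool * 'I_L) reached (m%:~R * h) (c.1, nat_of_ord c.2) = `|m%:~R * h|.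
Proof.
move=> mL.
have := @lattice_reached (fun=> 1) L m mL; under eq_bigr do rewrite mul1r.
move=> ->; rewrite sumr_const card_ord normrM (gtr0_norm h_gt0) mulrC.
by congr (_ * _); rewrite -intr_norm -abszE.
Qed.

(** Each increment is at most [l h] in absolute value, and by monotonicity the increments on each
    side telescope to at most the oscillation [2 a] in total. Hence the sum of squares has order
    [h]. *)
Lemma sum_increment_sq (g : R -> R) (s a l : R) (L : nat) :
  (forall v w, v <= w -> 0 <= g w - g v <= l * (w - v)) ->
  (forall w, `|g w| <= a) ->
  \sum_(c : bool * 'I_L) increment g s (c.1, nat_of_ord c.2) ^+ 2 <= l * h * (2 * a).
Proof.
move=> gl ga.
have step (x y : R) : y = x + h -> (g y - g x) ^+ 2 <= l * h * (g y - g x).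
  move=> yE; have /gl/andP[h1 h2] : x <= y by rewrite yE lerDl ltW.
  by rewrite expr2 ler_wpM2r // (le_trans h2) // yE addrAC subrr add0r.
rewrite (sum_lattice L (fun c => increment g s c ^+ 2)) /increment /=.
pose G (z : R) (k : nat) := g (s - z * (k%:R * h)).
have S1 : \sum_(k < L) (G 1 k - G 1 k.+1) ^+ 2 <= l * h * (G 1 0 - G 1 L).
  rewrite -opprB -(telescope_sumr (G 1) (leq0n L)) big_mkord -sumrN mulr_sumr.
  apply: ler_sum => k _; rewrite opprB; apply: step.
  by rewrite !mul1r -natr1; ring.
have S2 : \sum_(k < L) (G (-1) k - G (-1) k.+1) ^+ 2 <= l * h * (G (-1) L - G (-1) 0).
  rewrite -(telescope_sumr (G (-1)) (leq0n L)) big_mkord mulr_sumr.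
  apply: ler_sum => k _; rewrite -sqrrN opprB; apply: step.
  by rewrite -natr1; ring.
apply: le_trans (lerD S1 S2) _.
have l0 : 0 <= l * h.
  have /andP[h1 h2] := gl s (s + h) ltac:(by rewrite lerDl ltW).
  by apply: le_trans h1 _; apply: le_trans h2 _; rewrite addrAC subrr add0r.
rewrite -mulrDr ler_wpM2l // /G !mul0r !mulr0 !subr0.
have := ga (s - 1 * (L%:R * h)); have := ga (s - -1 * (L%:R * h)).
by rewrite !ler_norml; lra.
Qed.

End LatticeIncrements.

(** * Leave-one-neighbourhood-out expansion of the self-normalised sum *)

Section WeightedSteinIdentity.
Context {R : realType} {O I : finType} (p : O -> R) (nb : I -> {set I}) (D : nat).
Variables (xi : I -> O -> R) (g b e : R).
Hypothesis lf : local_field p nb D xi.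
Hypothesis mb : moment_bounds p nb xi g b e.
Let p_ge0 := lf_ge0 lf.
Let nb_refl := lf_refl lf.
Let nb_sym := lf_sym lf.
Local Notation E := (Ex p).
Local Notation S := (fsum xi).
Local Notation eta := (feta nb xi).
Local Notation near := (fnear nb xi).

Definition scale (w : O) : R := invroot (fquad nb xi w).
Definition ratio (w : O) : R := S w * scale w.
Definition sum_off (j : I) (w : O) : R := \sum_i zero_on (nb j) (xi^~ w) i.
Definition scale_off (j : I) (w : O) : R := invroot (nquad nb (zero_on (nb j) (xi^~ w))).

Lemma scale_bounds w : 2^-1 <= scale w <= 2. Proof. exact: invroot_bounds. Qed.

Lemma scale_ge0 w : 0 <= scale w.
Proof. by case/andP: (scale_bounds w) => h _; apply: le_trans h; rewrite invr_ge0. Qed.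

Lemma scale_off_bounds j w : 2^-1 <= scale_off j w <= 2.
Proof. exact: invroot_bounds. Qed.

Lemma sum_offE j w : sum_off j w = S w - eta j w.
Proof.
rewrite /sum_off /fsum /feta /nsum (bigID (mem (nb j))) /= [in RHS](bigID (mem (nb j))) /=.
rewrite big1; last by move=> i ij; rewrite /zero_on ij.
rewrite add0r addrAC subrr add0r; apply: eq_bigr => i ij.
by rewrite /zero_on (negbTE ij).
Qed.

Lemma norm_sum_off_le j w : `|sum_off j w| <= `|S w| + 1.
Proof.
rewrite sum_offE; apply: le_trans (ler_normB _ _) _; rewrite lerD2l.
exact: (norm_feta_le1 lf).
Qed.

Lemma near_ge0 j w : 0 <= near j w.
Proof. by apply: sumr_ge0 => k _; rewrite mulr_ge0 ?nabs_ge0. Qed.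

Lemma scale_diff j w : `|scale w - scale_off j w| <= 8 * near j w.
Proof.
apply: le_trans (invroot_lip _ _) _.
have := nquad_zero_on_le nb_sym (nb j) (xi^~ w); rewrite -/(fquad nb xi w).
rewrite -[X in _ <= 2 * X]/(near j w); lra.
Qed.

Lemma dep_near j (A : {set I}) : ball nb 2 j \subset A -> dep xi A (near j).
Proof.
move=> /fintype.subsetP jA; apply: dep_sum => k jk; apply: (dep_comp2 *%R).
  apply: (dep_comp Num.norm); apply: dep_xi; apply: jA.
  by have /fintype.subsetP := sub_thicken nb_refl (ball nb 1 j); apply; rewrite ball1.
apply: dep_fabs; apply/fintype.subsetP => l kl; apply: jA.
by apply: (ball_nb _ kl); rewrite ball1.
Qed.

Lemma dep_sum_off j : dep xi (~: nb j) (sum_off j).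
Proof. exact: dep_zero_sum. Qed.

Lemma dep_scale_off j : dep xi (~: nb j) (scale_off j).
Proof. by apply: (dep_comp invroot); apply: dep_zero_quad. Qed.

Lemma thickenU (A B : {set I}) : thicken nb (A :|: B) = thicken nb A :|: thicken nb B.
Proof.
apply/finset.setP => k; rewrite finset.in_setU; apply/thickenP/orP.
  by move=> [i /finset.setUP[iA|iB] ik]; [left|right]; apply/thickenP; exists i.
by move=> [] /thickenP[i iA ik]; exists i => //; rewrite finset.in_setU iA ?orbT.
Qed.

(* [f (ratio w) * scale w] is compared with the same function of [sum_off j] and
   [scale_off j], which are independent of [xi j]: only [E (xi j)] survives. *)
Lemma weighted_stein (A J : {set I}) (z : O -> R) (f : R -> R) (M l : R) :
  (forall w, 0 <= z w) -> dep xi A z -> (forall j, j \in J -> sep nb A (ball nb 2 j)) ->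
  (forall w, \sum_(k in thicken nb A) `|xi k w| <= 1) ->
  (forall x, `|f x| <= M) -> (forall x y, `|f x - f y| <= l * `|x - y|) ->
  `|E (fun w => z w * (\sum_(j in J) xi j w) * f (ratio w) * scale w)
    - E (fun w => z w * scale w *
         \sum_(j in J) xi j w * (f (ratio w) - f (ratio w - eta j w * scale w)))|
  <= ((112 * l + 8 * M) * (D%:R ^+ 2 * g) + 2 * M * e) * E z.
Proof.
move=> z0 dz AJ A1 fM fl.
have M0 : 0 <= M by apply: le_trans (fM 0).
have l0 : 0 <= l by have := fl 1 0; rewrite subr0 normr1 mulr1; apply: le_trans.
have Ez0 : 0 <= E z by apply: Ex_ge0.
(* Subtracting [eta j * scale] from [ratio] deletes the neighbourhood from the sum but not from the
   scale. With that increment kept as main term, [rest j] contains nothing but the change of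
   scale. *)
pose rest j w := f (ratio w) * scale w
  - scale w * (f (ratio w) - f (ratio w - eta j w * scale w))
  - f (sum_off j w * scale_off j w) * scale_off j w.
have rest_le j w : `|rest j w| <= (16 * l * (`|S w| + 1) + 8 * M) * near j w.
  have -> : rest j w = scale w * (f (sum_off j w * scale w) - f (sum_off j w * scale_off j w))
      + f (sum_off j w * scale_off j w) * (scale w - scale_off j w).
    have -> : sum_off j w * scale w = ratio w - eta j w * scale w.
      by rewrite sum_offE mulrBl.
    by rewrite /rest; ring.
  apply: le_trans (ler_normD _ _) _; rewrite mulrDl; apply: lerD; last first.
    rewrite normrM [8 * M]mulrC -mulrA; apply: ler_pM => //; exact: scale_diff.
  rewrite normrM (ger0_norm (scale_ge0 w)).
  apply: le_trans (_ : 2 * (l * (`|sum_off j w| * (8 * near j w))) <= _).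
    apply: ler_pM => //; first exact: scale_ge0.
      by case/andP: (scale_bounds w).
    apply: le_trans (fl _ _) _; rewrite ler_wpM2l // -mulrBr normrM ler_wpM2l //.
    exact: scale_diff.
  have := norm_sum_off_le j w; have := near_ge0 j w => n0 s1.
  have := ler_wpM2r (mulr_ge0 l0 n0) s1; lra.
pose F j w := z w * (`|xi j w| * near j w).
have F0 j w : 0 <= F j w by rewrite !mulr_ge0 ?near_ge0.
have dF2 j : dep xi (ball nb 2 j) (fun w => `|xi j w| * near j w).
  apply: (dep_comp2 *%R); last exact: dep_near.
  apply: (dep_comp Num.norm); apply: dep_xi.
  by apply: (fintype.subsetP (ball_le nb_refl j (isT : (0 <= 2)%N))); rewrite ball0 inE.
have EF j : j \in J -> E (F j) = E z * E (fun w => `|xi j w| * near j w).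
  by move=> jJ; apply: (lf_ind lf (AJ _ jJ)).
(* The weight [F j] lives on [A :|: ball nb 2 j], whose thickening carries absolute mass at most
   [1 + 1], the amount that [decouple_fsum] allows. *)
have FS j : E (fun w => F j w * `|S w|) <= 6 * E (F j).
  apply: (decouple_fsum lf mb (A := A :|: ball nb 2 j)) => //.
    apply: (dep_comp2 *%R); first exact: depS (finset.subsetUl _ _) dz.
    exact: depS (finset.subsetUr _ _) (dF2 j).
  move=> w; rewrite thickenU -ballS.
  apply: le_trans (_ : \sum_(k in thicken nb A) `|xi k w| + \sum_(k in ball nb 3 j) `|xi k w| <= _).
    rewrite [leLHS]big_mkcond [X in _ <= X + _]big_mkcond [X in _ <= _ + X]big_mkcond -big_split.
    apply: ler_sum => k _; rewrite finset.in_setU /=.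
    by case: (k \in thicken nb A); case: (k \in ball nb 3 j); rewrite ?addr0 ?add0r // lerDl.
  have h1 := sum_ball_le1 lf j w (isT : (3 <= 4)%N); have := A1 w; lra.
rewrite -ExB.
have -> : E (fun w => z w * (\sum_(j in J) xi j w) * f (ratio w) * scale w - z w * scale w *
     (\sum_(j in J) xi j w * (f (ratio w) - f (ratio w - eta j w * scale w)))) =
   \sum_(j in J) (E (fun w => z w * xi j w * rest j w)
     + E (xi j) * E (fun w => z w * (f (sum_off j w * scale_off j w) * scale_off j w))).
  transitivity (\sum_(j in J) E (fun w => z w * xi j w * rest j w +
     xi j w * (z w * (f (sum_off j w * scale_off j w) * scale_off j w)))).
    rewrite -Ex_sum; apply: eq_Ex => w; rewrite mulr_sumr -2!mulrA mulr_suml mulr_sumr -sumrB.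
    by apply: eq_bigr => j _; rewrite /rest; ring.
  apply: eq_bigr => j jJ; rewrite ExD; congr (_ + _).
  apply: (lf_ind lf (A := [set j]) (B := ~: nb j)); first by move=> _ k /finset.set1P ->; rewrite inE.
    by apply: dep_xi; rewrite inE.
  apply: (dep_comp2 *%R); last first.
    apply: (dep_comp2 *%R); last exact: dep_scale_off.
    apply: (dep_comp f); apply: (dep_comp2 *%R); [exact: dep_sum_off | exact: dep_scale_off].
  apply: depS dz; apply/fintype.subsetP => k kA; rewrite inE; apply: contraL (nb_refl k) => jk.
  apply: (AJ j jJ) => //.
  by apply: (fintype.subsetP (ball_le nb_refl j (isT : (1 <= 2)%N))); rewrite ball1.
apply: le_trans (ler_norm_sum _ _ _) _.
apply: le_trans (_ : \sum_(j in J) ((112 * l + 8 * M) * (E z * E (fun w => `|xi j w| * near j w))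
   + 2 * M * E z * `|E (xi j)|) <= _).
  apply: ler_sum => j jJ; apply: le_trans (ler_normD _ _) _; apply: lerD.
    apply: le_trans (norm_Ex p_ge0 _) _.
    (* Decoupling [|S w|] costs a factor 6, and [16 * 6 + 16 = 112]. *)
    apply: le_trans (_ : E (fun w => 16 * l * (F j w * `|S w|) + (16 * l + 8 * M) * F j w) <= _).
      apply: le_Ex => // w; rewrite !normrM (ger0_norm (z0 w)).
      apply: le_trans (ler_wpM2l _ (rest_le j w)) _; first by rewrite mulr_ge0.
      by rewrite /F le_eqVlt; apply/orP; left; apply/eqP; ring.
    rewrite ExD !ExZl -EF //; have := FS j => h.
    have := ler_wpM2l l0 h; lra.
  rewrite normrM mulrC ler_wpM2r //.
  apply: le_trans (norm_Ex p_ge0 _) _.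
  apply: le_trans (_ : E (fun w => 2 * M * z w) <= _); last by rewrite ExZl.
  apply: le_Ex => // w; rewrite !normrM (ger0_norm (z0 w)) mulrC ler_wpM2r //.
  rewrite mulrC; case/andP: (scale_off_bounds j w) => h1 h2.
  apply: ler_pM => //; rewrite ger0_norm //; lra.
rewrite big_split /= -!mulr_sumr.
have hX : \sum_(j in J) E (fun w => `|xi j w| * near j w) <= D%:R ^+ 2 * g.
  apply: le_trans (E_abs_fnear lf mb); rewrite [leLHS]big_mkcond; apply: ler_sum => j _.
  case: ifP => // _; apply: Ex_ge0 => // w; exact: mulr_ge0 (normr_ge0 _) (near_ge0 _ _).
have hY : \sum_(j in J) `|E (xi j)| <= e.
  by apply: le_trans (mb_first mb); rewrite [leLHS]big_mkcond; apply: ler_sum => j _; case: ifP.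
have K0 : 0 <= (112 * l + 8 * M) * E z by rewrite mulr_ge0 // addr_ge0 ?mulr_ge0.
have K0' : 0 <= 2 * M * E z by rewrite !mulr_ge0.
have := ler_wpM2l K0 hX; have := ler_wpM2l K0' hY; lra.
Qed.

End WeightedSteinIdentity.

(** * Replacing random increments by their means *)

Section Concentration.
Context {R : realType} {O I : finType} (p : O -> R) (nb : I -> {set I}) (D : nat).
Variables (xi : I -> O -> R) (g b e h : R).
Hypothesis lf : local_field p nb D xi.
Hypothesis mb : moment_bounds p nb xi g b e.
Hypothesis h_gt0 : 0 < h.
Hypothesis lattice : forall i w, exists m : int, xi i w = m%:~R * h.
Let p_ge0 := lf_ge0 lf.
Let nb_refl := lf_refl lf.
Local Notation E := (Ex p).
Local Notation S := (fsum xi).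
Local Notation eta := (feta nb xi).
Local Notation U := (scale nb xi).
Local Notation W := (ratio nb xi).

Lemma feta_lattice j w : exists m : int, eta j w = m%:~R * h.
Proof.
rewrite /feta /nsum; elim/big_ind: _ => [|x y [m ->] [n ->]|i _]; last exact: lattice.
  by exists 0; rewrite mul0r.
by exists (m + n); rewrite intrD mulrDl.
Qed.

(* Replaces the random increment measure [\sum_j xi_j 1(t < eta_j)] by its mean;
   the error is Cauchy-Schwarz in the shift variable, so only third moments enter. *)
Lemma increment_fluctuation (A J : {set I}) (z : O -> R) (f : R -> R) (a : R) :
  (forall w, 0 <= z w) -> dep xi A z -> (forall j, j \in J -> sep nb A (nb j)) ->
  (forall x, `|f x| <= a) -> (forall v w, v <= w -> 0 <= f w - f v <= w - v) ->
  `|E (fun w => z w * U w * \sum_(j in J) xi j w * (f (W w) - f (W w - eta j w * U w)))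
   - \sum_(j in J) E (fun w' => xi j w' *
        E (fun w => z w * U w * (f (W w) - f (W w - eta j w' * U w))))|
  <= E z * (8 * a + D%:R ^+ 3 * (D%:R ^+ 2 * g) / 2).
Proof.
move=> z0 dz AJ fa fl.
pose G w s := f (s * U w).
have U0 w : 0 <= U w := scale_ge0 nb xi w.
(* [L] steps of length [h] cover [[0, 1]], hence every value of [|eta j|]. *)
pose L := Num.bound h^-1.
have L1 : 1 <= L%:R * h.
  rewrite -ler_pdivrMr // mul1r ltW //.
  by have := archi_boundP (x := h^-1); rewrite invr_ge0 ltW // => /(_ isT).
have mL (m : int) : `|m%:~R * h| <= 1 -> (absz m <= L)%N.
  rewrite normrM (gtr0_norm h_gt0) -intr_norm -abszE => m1.
  have := le_trans m1 L1; rewrite ler_pM2r //.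
  by rewrite -[`|m|%N%:~R]/(`|m|%N%:R : R) ler_nat.
pose inc w (c : bool * 'I_L) := increment h (G w) (S w) (c.1, nat_of_ord c.2).
pose rc y (c : bool * 'I_L) : R := reached h y (c.1, nat_of_ord c.2).
have incE w j w' : f (W w) - f (W w - eta j w' * U w) = \sum_c inc w c * rc (eta j w') c.
  have [m mE] := feta_lattice j w'.
  have -> : W w - eta j w' * U w = (S w - eta j w') * U w by rewrite mulrBl.
  rewrite -/(G w (S w - eta j w')) mE /inc /rc lattice_increment //.
  by apply: mL; rewrite -mE (norm_feta_le1 lf).
have rc_len j w : h * \sum_c rc (eta j w) c = `|eta j w|.
  have [m mE] := feta_lattice j w; rewrite mE /rc lattice_length //.
  by apply: mL; rewrite -mE (norm_feta_le1 lf).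
have inc_sq w : \sum_c inc w c ^+ 2 <= 2 * h * (2 * a).
  apply: sum_increment_sq => // [v s vs|s]; last exact: fa.
  have := fl (v * U w) (s * U w); rewrite ler_wpM2r // => /(_ isT) /andP[-> k2] /=.
  apply: le_trans k2 _; rewrite -mulrBl mulrC ler_wpM2r ?subr_ge0 //.
  by case/andP: (scale_bounds nb xi w).
pose N c w := \sum_(j in J) xi j w * rc (eta j w) c.
pose M c := \sum_(j in J) E (fun w => xi j w * rc (eta j w) c).
have -> : E (fun w => z w * U w * \sum_(j in J) xi j w * (f (W w) - f (W w - eta j w * U w)))
   - \sum_(j in J) E (fun w' => xi j w' *
        E (fun w => z w * U w * (f (W w) - f (W w - eta j w' * U w))))
   = E (fun w => z w * U w * \sum_c inc w c * (N c w - M c)).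
  rewrite (eq_Ex _ (G := fun w => z w * U w * \sum_c inc w c * N c w)); last first.
    move=> w; congr (_ * _); under eq_bigr do rewrite incE mulr_sumr.
    rewrite exchange_big; apply: eq_bigr => c _; rewrite mulr_sumr.
    by apply: eq_bigr => j _; rewrite mulrCA.
  have -> : \sum_(j in J) E (fun w' => xi j w' *
        E (fun w => z w * U w * (f (W w) - f (W w - eta j w' * U w))))
      = E (fun w => z w * U w * \sum_c inc w c * M c).
    transitivity (\sum_c M c * E (fun w => z w * U w * inc w c)).
      rewrite /M; under [RHS]eq_bigr do rewrite mulr_suml.
      rewrite [RHS]exchange_big; apply: eq_bigr => j _.
      under [RHS]eq_bigr do rewrite -ExZr.
      rewrite -[RHS]Ex_sum; apply: eq_Ex => w'.
      under [RHS]eq_bigr do rewrite -mulrA.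
      rewrite -mulr_sumr; congr (_ * _).
      under [RHS]eq_bigr do rewrite -ExZl.
      rewrite -Ex_sum; apply: eq_Ex => w; rewrite incE mulr_sumr.
      by apply: eq_bigr => c _; ring.
    under eq_bigr do rewrite -ExZl.
    rewrite -Ex_sum; apply: eq_Ex => w; rewrite mulr_sumr.
    by apply: eq_bigr => c _; ring.
  rewrite -ExB; apply: eq_Ex => w; rewrite -mulrBr -sumrB; congr (_ * _).
  by apply: eq_bigr => c _; rewrite mulrBr.
have varN c : E (fun w => (N c w - M c) ^+ 2) <=
    D%:R ^+ 3 * \sum_(j in J) E (fun w => xi j w ^+ 2 * rc (eta j w) c).
  have dN j : j \in J -> dep xi (ball nb 1 j) (fun w => xi j w * rc (eta j w) c).
    move=> _; rewrite ball1; apply: (dep_comp2 *%R); first exact: dep_xi.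
    by apply: (dep_comp (rc^~ c)); exact: dep_feta.
  have := variance_local lf dN; rewrite -natrX => /le_trans; apply.
  apply: ler_wpM2l => //; apply: ler_sum => j _; apply: le_Ex => // w.
  by rewrite exprMn ler_wpM2l ?sqr_ge0 // /rc /reached; case: (_ < _); rewrite ?expr1n ?expr0n.
have dNM c : dep xi (thicken nb J) (fun w => (N c w - M c) ^+ 2).
  apply: (dep_comp (fun x => (x - M c) ^+ 2)); apply: dep_sum => j jJ.
  have jT : nb j \subset thicken nb J by apply/fintype.subsetP => k jk; apply/thickenP; exists j.
  apply: (dep_comp2 *%R); first by apply: dep_xi; apply: (fintype.subsetP jT).
  by apply: (dep_comp (rc^~ c)); exact: dep_feta.
(* [N c] lives on the neighbourhoods of [J], which are separated from [A]; therefore the weight [z]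
   factors out of the variance of [N c]. *)
have sT : sep nb A (thicken nb J).
  by move=> i k iA /thickenP[j jJ jk]; apply: (AJ j jJ).
have Ez0 : 0 <= E z by apply: Ex_ge0.
apply: le_trans (norm_Ex p_ge0 _) _.
apply: le_trans (_ : E (fun w => z w * (8 * a) +
    \sum_c z w * (N c w - M c) ^+ 2 * (h / 2)) <= _).
  apply: le_Ex => // w; rewrite normrM normrM (ger0_norm (z0 w)) (ger0_norm (U0 w)).
  rewrite -mulr_suml -mulr_sumr -!mulrA -mulrDr ler_wpM2l //.
  (* Young's inequality balanced by [h]. The increments contribute at most [4 a], and the factor [h]
     left on the variances is cancelled because [eta j] reaches [|eta j| / h] cells. *)
  apply: le_trans (_ : 2 * \sum_c (inc w c ^+ 2 / h + h / 4 * (N c w - M c) ^+ 2) <= _).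
    apply: ler_pM => //; first by case/andP: (scale_bounds nb xi w).
    apply: le_trans (ler_norm_sum _ _ _) _; apply: ler_sum => c _.
    rewrite normrM -(real_normK (num_real (inc w c))) -(real_normK (num_real (N c w - M c))).
    rewrite -subr_ge0.
    have -> : `|inc w c| ^+ 2 / h + h / 4 * `|N c w - M c| ^+ 2 - `|inc w c| * `|N c w - M c|
       = (`|inc w c| - h / 2 * `|N c w - M c|) ^+ 2 / h by field; rewrite gt_eqF.
    by rewrite divr_ge0 ?sqr_ge0 // ltW.
  rewrite big_split /= -mulr_suml -mulr_sumr mulrDr; apply: lerD; last by lra.
  have : (\sum_c inc w c ^+ 2) / h <= 4 * a by rewrite ler_pdivrMr //; have := inc_sq w; lra.
  by lra.
rewrite ExD ExZr Ex_sum mulrDr lerD2l.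
apply: le_trans (_ : \sum_c E z * (h / 2) *
  (D%:R ^+ 3 * \sum_(j in J) E (fun w => xi j w ^+ 2 * rc (eta j w) c)) <= _).
  apply: ler_sum => c _; rewrite ExZr (lf_ind lf sT dz (dNM c)) mulrAC ler_wpM2l //.
  by rewrite mulr_ge0 // divr_ge0 // ltW.
rewrite -mulr_sumr -mulr_sumr exchange_big /=.
have -> : \sum_(j in J) \sum_(c : bool * 'I_L) E (fun w => xi j w ^+ 2 * rc (eta j w) c)
   = h^-1 * \sum_(j in J) E (fun w => xi j w ^+ 2 * `|eta j w|).
  rewrite mulr_sumr; apply: eq_bigr => j _; rewrite -Ex_sum -ExZl; apply: eq_Ex => w.
  by rewrite -mulr_sumr mulrCA -rc_len mulKf // gt_eqF.
have : \sum_(j in J) E (fun w => xi j w ^+ 2 * `|eta j w|) <= D%:R ^+ 2 * g.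
  apply: le_trans (E_sq_fabs lf mb); rewrite [leLHS]big_mkcond; apply: ler_sum => j _.
  case: ifP => _; last by apply: Ex_ge0 => // w; rewrite mulr_ge0 ?sqr_ge0 ?nabs_ge0.
  by apply: le_Ex => // w; rewrite ler_wpM2l ?sqr_ge0 ?norm_nsum_le.
move: (\sum_(j in J) _) => T hT.
rewrite (_ : _ * _ = E z * (D%:R ^+ 3 * T / 2)); last by field; rewrite gt_eqF.
rewrite ler_wpM2l // ler_wpM2r ?invr_ge0 //.
by rewrite ler_wpM2l ?exprn_ge0.
Qed.

End Concentration.

(** * Concentration under weights depending on a neighbourhood *)

Section ConditionalConcentration.
Context {R : realType} {O I : finType} (p : O -> R) (nb : I -> {set I}) (D : nat).
Variables (xi : I -> O -> R) (g b e h : R).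
Hypothesis lf : local_field p nb D xi.
Hypothesis mb : moment_bounds p nb xi g b e.
Hypothesis h_gt0 : 0 < h.
Hypothesis lattice : forall i w, exists m : int, xi i w = m%:~R * h.
Hypothesis g_gt0 : 0 < g.
Let p_ge0 := lf_ge0 lf.
Let p_sum1 := lf_sum1 lf.
Let nb_refl := lf_refl lf.
Let nb_sym := lf_sym lf.
Let nb_card := lf_card lf.
Local Notation E := (Ex p).
Local Notation S := (fsum xi).
Local Notation eta := (feta nb xi).
Local Notation U := (scale nb xi).
Local Notation W := (ratio nb xi).

Definition window (x l : R) (w : O) : R := (x <= W w <= x + l)%R%:R.

Lemma window_ge0 x l w : 0 <= window x l w. Proof. exact: ler0n. Qed.

Lemma window_le1 x l w : window x l w <= 1.
Proof. by rewrite /window -[leRHS]/(1%:R) ler_nat leq_b1. Qed.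

(** Allows a bound for windows of length [a] to be reapplied to the longer windows that carry the
    remainder of the ramp. *)
Lemma window_cover (z : O -> R) (a K x l : R) :
  (forall w, 0 <= z w) -> 0 < a -> 0 <= l ->
  (forall y, E (fun w => z w * window y a w) <= K) ->
  E (fun w => z w * window x l w) <= (l / a + 1) * K.
Proof.
move=> z0 a0 l0 hK.
have K0 : 0 <= K.
  by apply: le_trans (hK 0); apply: Ex_ge0 => // w; rewrite mulr_ge0 ?window_ge0.
have H n y : E (fun w => z w * window y (n.+1%:R * a) w) <= n.+1%:R * K.
  elim: n y => [|n IH] y; first by rewrite !mul1r.
  apply: le_trans (_ : E (fun w => z w * window y a w + z w * window (y + a) (n.+1%:R * a) w) <= _).
    apply: le_Ex => // w; rewrite -mulrDr ler_wpM2l // /window.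
    rewrite -!natrD ler_nat -[n.+2%:R]natr1.
    have := leP (W w) (y + a).
    case: (leP y (W w)) => h1 //=; case: (leP (W w) (y + a)) => h2 _ /=.
      by case: (_ <= _).
    rewrite (ltW h2) /= (_ : y + a + n.+1%:R * a = y + (n.+1%:R + 1) * a) //; ring.
  by rewrite ExD -[n.+2%:R]natr1 mulrDl mul1r [leRHS]addrC; exact: lerD.
have la0 : 0 <= l / a by rewrite divr_ge0 // ltW.
pose n := Num.trunc (l / a).
have /andP[n1 n2] := truncn_itv la0.
apply: le_trans (_ : E (fun w => z w * window x (n.+1%:R * a) w) <= _).
  apply: le_Ex => // w; rewrite ler_wpM2l // /window ler_nat.
  case: (leP x (W w)) => //= h1; case: (leP (W w) (x + l)) => //= h2.
  rewrite (le_trans h2) // lerD2l -ler_pdivrMr //; exact: ltW.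
apply: le_trans (H _ _) _; rewrite ler_wpM2r //.
by rewrite -natr1 lerD2r.
Qed.

Lemma fabs_small j w : `|eta j w| <= 8^-1.
Proof.
apply: le_trans (norm_nsum_le _ _ _) _.
apply: le_trans (_ : \sum_(k in nb j) (D ^ 4)%:R^-1 <= _).
  by apply: ler_sum => k _; exact: (lf_bdd lf).
have D0 := D_gt0 lf.
rewrite sumr_const -[leLHS]mulr_natr mulrC ler_pdivrMr ?ltr0n ?expn_gt0; last first.
  by rewrite (leq_trans _ (lf_deg lf)).
apply: le_trans (_ : D%:R <= _); first by rewrite ler_nat.
rewrite natrX exprS mulrCA ler_peMr ?ler0n //.
by have := D_ge2 lf; set d := D%:R => d2; have : 8 <= d ^+ 3; [rewrite !exprS; nra | lra].
Qed.

(** [E Q >= 3/4], and the ball takes away at most 1/8: the values [|xi j|] in it add up to at most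
    1, while [|eta j| <= D^-3 <= 1/8]. *)
Lemma far_quad_ge i : 2^-1 <= \sum_(j in ~: ball nb 4 i) E (fun w => xi j w * eta j w).
Proof.
have h1 : 3 / 4 <= E (fquad nb xi).
  by have := mb_quad mb; rewrite ler_norml; lra.
have h2 : E (fquad nb xi) = \sum_(j in ball nb 4 i) E (fun w => xi j w * eta j w)
    + \sum_(j in ~: ball nb 4 i) E (fun w => xi j w * eta j w).
  rewrite /fquad /nquad Ex_sum (bigID (mem (ball nb 4 i))) /=; congr (_ + _).
  by apply: eq_bigl => j; rewrite inE.
have h3 : \sum_(j in ball nb 4 i) E (fun w => xi j w * eta j w) <= 8^-1.
  rewrite -Ex_sum; apply: Ex_le_cst => // w.
  apply: le_trans (_ : \sum_(j in ball nb 4 i) `|xi j w| * 8^-1 <= _).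
    apply: ler_sum => j _; apply: le_trans (ler_norm _) _; rewrite normrM ler_wpM2l //.
    exact: fabs_small.
  by rewrite -mulr_suml; have := sum_ball_le1 lf i w (isT : (4 <= 4)%N); lra.
by rewrite h2 in h1; lra.
Qed.

(** The power 5 is that of the fluctuation term [D^3 * (D^2 g)]. Since [D^3 >= 8], the factor 96
    gives [768 D^2 g <= a], so the ramp remainder [48 (K / a) D^2 g] is at most [K / 16]. *)
Let a := 96 * (D%:R ^+ 5 * g).

Let a_gt0 : 0 < a.
Proof. by rewrite /a mulr_gt0 // mulr_gt0 // exprn_gt0 // (D_gt0 lf). Qed.

Let D2g_le : D%:R ^+ 2 * g * 768 <= a.
Proof.
rewrite /a (exprD _ 3 2) -(mulrA (_ ^+ 3)); set t := _ ^+ 2 * g.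
have t0 : 0 < t by rewrite mulr_gt0 // exprn_gt0 // (D_gt0 lf).
have := D_ge2 lf; set d := D%:R => d2; have : 8 <= d ^+ 3 by rewrite !exprS; nra.
by move: (d ^+ 3) => d3 hd3; nra.
Qed.

(** For the ramp, the main term is at least [X / 8 - K / 16], with [X] the quantity to be bounded.
    It is at most [(14 + 2 + 9) a E z]: 14 from the size of the ramp, 2 from deleting
    neighbourhoods, 9 from the fluctuation of the increments. Multiplying by 8 gives [K / 2] and
    200. *)
Lemma concentration_step (i : I) (z : O -> R) (K : R) :
  a <= 1 -> (forall w, 0 <= z w) -> dep xi (nb i) z ->
  (forall x, E (fun w => z w * window x a w) <= K) ->
  forall x, E (fun w => z w * window x a w) <= K / 2 + 200 * a * E z.
Proof.
move=> a1 z0 dz hK x.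
have Ez0 : 0 <= E z by apply: Ex_ge0.
have K0 : 0 <= K.
  by apply: le_trans (hK 0); apply: Ex_ge0 => // w; rewrite mulr_ge0 ?window_ge0.
have [f [t [fa fi t0 t1 frem]]] := ramp_exists x a_gt0.
(* [z] lives on a ball of radius 1 about [i] and the deletion error at [j] on one of radius 2 about
   [j]; beyond distance [1 + 2 + 1] these are not adjacent. *)
pose J := ~: ball nb 4 i.
have sepJ2 j : j \in J -> sep nb (nb i) (ball nb 2 j).
  rewrite inE => ij; rewrite -ball1; exact: (sep_balls (r := 1) (s := 2) nb_sym ij).
have sepJ1 j : j \in J -> sep nb (nb i) (nb j).
  move=> /sepJ2; apply: sepS => //; rewrite -ball1; exact: (ball_le nb_refl).
have nb1 w : \sum_(k in thicken nb (nb i)) `|xi k w| <= 1.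
  by have := sum_ball_le1 lf i w (isT : (2 <= 4)%N); rewrite ballS ball1.
have fl u v : `|f u - f v| <= 1 * `|u - v|.
  rewrite mul1r; have [uv|/ltW vu] := leP u v.
    by have /andP[k1 k2] := fi _ _ uv; rewrite distrC ger0_norm // distrC ger0_norm // subr_ge0.
  by have /andP[k1 k2] := fi _ _ vu; rewrite ger0_norm // ger0_norm // subr_ge0.
have := weighted_stein lf mb z0 dz sepJ2 nb1 fa fl.
have := increment_fluctuation lf mb h_gt0 lattice z0 dz sepJ1 fa fi.
set T1 := E (fun w => z w * (\sum_(j in J) xi j w) * f (W w) * U w).
set T2 := E _; set T3 := \sum_(j in J) _ => h23 h12.
have hT1 : `|T1| <= 14 * a * E z.
  apply: le_trans (norm_Ex p_ge0 _) _.
  apply: le_trans (_ : E (fun w => 2 * a * (z w * `|S w| + z w)) <= _).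
    apply: le_Ex => // w; rewrite !normrM (ger0_norm (z0 w)).
    rewrite (ger0_norm (scale_ge0 nb xi w)).
    have SJ : `|\sum_(j in J) xi j w| <= `|S w| + 1.
      have -> : \sum_(j in J) xi j w = S w - \sum_(j in ball nb 4 i) xi j w.
        rewrite /fsum [in RHS](bigID (mem (ball nb 4 i))) /= addrAC subrr add0r.
        by apply: eq_bigl => j; rewrite inE.
      apply: le_trans (ler_normB _ _) _; rewrite lerD2l.
      apply: le_trans (ler_norm_sum _ _ _) _; exact: (sum_ball_le1 lf).
    have -> : 2 * a * (z w * `|S w| + z w) = z w * (`|S w| + 1) * a * 2 by ring.
    have /andP[_ u2] := scale_bounds nb xi w.
    apply: ler_pM => //; rewrite ?mulr_ge0 ?scale_ge0 //.
    by apply: ler_pM => //; rewrite ?mulr_ge0 // ler_wpM2l.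
  rewrite ExZl ExD.
  have : E (fun w => z w * `|S w|) <= 6 * E z.
    by apply: (decouple_fsum lf mb z0 dz) => w; apply: le_trans (nb1 w) _; lra.
  by have := a_gt0; nra.
have hT3 : 8^-1 * E (fun w => z w * window x a w) - 48 * (K / a) * (D%:R ^+ 2 * g) <= T3.
  pose q j := E (fun w => xi j w * eta j w).
  (* The shift [eta j w'] is frozen here, and the remainder is supported in a window of length
     [3 a + 2 r], covered at cost [(4 + 2 r / a) K]. Using [r^2 / a] against the 4 and [r] against
     [2 r / a] gives [12 r^2 K / a], with [r = 2 |eta j w'|]. *)
  have rem j w' : `|E (fun w => z w * U w * (f (W w) - f (W w - eta j w' * U w)))
      - eta j w' * E (fun w => z w * U w ^+ 2 * t (W w))| <= 48 * (K / a) * eta j w' ^+ 2.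
    rewrite -ExZl -ExB; apply: le_trans (norm_Ex p_ge0 _) _.
    pose r := 2 * `|eta j w'|.
    have r0 : 0 <= r by rewrite mulr_ge0.
    apply: le_trans (_ : E (fun w => 2 * Num.min r (r ^+ 2 / a) *
        (z w * window (x - a - r) (3 * a + 2 * r) w)) <= _).
      apply: le_Ex => // w.
      have -> : z w * U w * (f (W w) - f (W w - eta j w' * U w)) -
          eta j w' * (z w * U w ^+ 2 * t (W w)) =
          z w * (U w * (f (W w) - f (W w - eta j w' * U w) - eta j w' * U w * t (W w))) by ring.
      rewrite normrM (ger0_norm (z0 w)) mulrCA ler_wpM2l //.
      rewrite normrM (ger0_norm (scale_ge0 nb xi w)) -[leRHS]mulrA.
      have /andP[_ u2] := scale_bounds nb xi w.
      apply: ler_pM => //; first exact: scale_ge0.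
      have -> : window (x - a - r) (3 * a + 2 * r) w = (x - a - r <= W w <= x + 2 * a + r)%R%:R.
        by rewrite /window (_ : x - a - r + (3 * a + 2 * r) = x + 2 * a + r) //; ring.
      apply: frem; rewrite normrM (ger0_norm (scale_ge0 nb xi w)) mulrC /r ler_wpM2r //.
    rewrite ExZl.
    have l0 : 0 <= 3 * a + 2 * r by have := a_gt0; lra.
    have m0 : 0 <= Num.min r (r ^+ 2 / a).
      by rewrite le_min r0 divr_ge0 ?sqr_ge0 // ltW.
    apply: le_trans (ler_wpM2l _ (window_cover (x - a - r) z0 a_gt0 l0 hK)) _.
      by rewrite mulr_ge0.
    have -> : 48 * (K / a) * eta j w' ^+ 2 = 12 * (r ^+ 2 / a) * K.
      by rewrite /r exprMn real_normK ?num_real //; field; rewrite gt_eqF.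
    rewrite [leLHS]mulrA; apply: ler_wpM2r => //.
    have -> : (3 * a + 2 * r) / a + 1 = 4 + 2 * (r / a) by field; rewrite gt_eqF.
    have m1 : Num.min r (r ^+ 2 / a) <= r by rewrite ge_min lexx.
    have m2 : Num.min r (r ^+ 2 / a) <= r ^+ 2 / a by rewrite ge_min lexx orbT.
    have ra0 : 0 <= r / a by rewrite divr_ge0 // ltW.
    have := ler_wpM2r ra0 m1; lra.
  have hE : E (fun w => z w * window x a w) * 4^-1 <= E (fun w => z w * U w ^+ 2 * t (W w)).
    rewrite -ExZr; apply: le_Ex => // w; rewrite -!mulrA ler_wpM2l // mulrA -expr2.
    have /andP[u1 _] := scale_bounds nb xi w.
    have u4 : 4^-1 <= U w ^+ 2 by rewrite expr2; nra.
    rewrite [leLHS]mulrC /window; have [hw|_] /= := boolP (x <= W w <= x + a).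
      by rewrite t1 // !mulr1.
    by rewrite mulr0 mulr_ge0 ?sqr_ge0.
  have T3E : \sum_(j in J) q j * E (fun w => z w * U w ^+ 2 * t (W w))
      - \sum_(j in J) 48 * (K / a) * E (fun w => `|xi j w| * eta j w ^+ 2) <= T3.
    rewrite -sumrB; apply: ler_sum => j _; rewrite /q -ExZr -ExZl -ExB.
    apply: le_Ex => // w'; rewrite lerBlDr -lerBlDl -mulrA -mulrBr.
    apply: le_trans (ler_norm _) _; rewrite normrM distrC mulrCA ler_wpM2l //.
  apply: le_trans T3E; rewrite -mulr_suml -mulr_sumr; apply: lerB.
    apply: le_trans (_ : 2^-1 * (E (fun w => z w * window x a w) * 4^-1) <= _); first by lra.
    apply: ler_pM => //; last exact: far_quad_ge.
    by rewrite divr_ge0 // Ex_ge0 // => w; rewrite mulr_ge0 ?window_ge0.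
  apply: ler_wpM2l; first by rewrite mulr_ge0 // divr_ge0 // ltW.
  apply: le_trans (E_abs_fabs_sq lf mb); rewrite [leLHS]big_mkcond; apply: ler_sum => j _.
  case: ifP => _; last by apply: Ex_ge0 => // w; rewrite mulr_ge0 ?sqr_ge0.
  apply: le_Ex => // w; rewrite ler_wpM2l // -real_normK ?num_real //.
  by rewrite lerXn2r ?nnegrE ?nabs_ge0 ?norm_nsum_le.
have D5 : D%:R ^+ 3 * (D%:R ^+ 2 * g) = a / 96 by rewrite /a (exprD _ 3 2); lra.
rewrite D5 in h23.
have e1 := mb_small mb; have e0 := e_ge0 mb.
have hKa : 48 * (K / a) * (D%:R ^+ 2 * g) <= K / 16.
  rewrite mulrC mulrA mulrC -[leRHS]mulr1 mulrA mulrAC -mulrA.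
  have := ler_wpM2r (divr_ge0 K0 (ltW a_gt0)) D2g_le.
  rewrite [a * _]mulrCA divff ?gt_eqF // mulr1; lra.
have B12 : (112 * 1 + 8 * a) * (D%:R ^+ 2 * g) + 2 * a * e <= 2 * a.
  have := D2g_le; have := a_gt0; have : 0 <= D%:R ^+ 2 * g by rewrite mulr_ge0 ?exprn_ge0 // ltW.
  by move: (_ * g) => y y0 ? ?; nra.
have := ler_wpM2r Ez0 B12 => B12'.
have B23 : E z * (8 * a + a / 96 / 2) <= 9 * a * E z by have := a_gt0; nra.
move: h12 h23 hT1; rewrite !ler_norml => /andP[h12 _] /andP[h23 _] /andP[_ h1].
move: h12 h23 h1 hT3 hKa B12' B23; move: (E (fun w => _ * window _ _ _)) => X.
lra.
Qed.

(** The weight [z] plays the part of conditioning on the variables near [i]. The bound is the fixed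
    point of [K -> K / 2 + 200 a E z]; for [a > 1] it is weaker than the trivial bound [E z]. *)
Lemma conditional_concentration (i : I) (z : O -> R) :
  (forall w, 0 <= z w) -> dep xi (nb i) z ->
  forall x, E (fun w => z w * window x a w) <= 400 * a * E z.
Proof.
move=> z0 dz x.
have Ez0 : 0 <= E z by apply: Ex_ge0.
have triv y : E (fun w => z w * window y a w) <= E z.
  by apply: le_Ex => // w; rewrite ler_piMr ?window_le1.
have [a1|/ltW a1] := leP a 1; last first.
  by apply: le_trans (triv x) _; rewrite ler_peMl //; lra.
(* Starting from the trivial bound, each application of [concentration_step]
   halves the excess over [400 * a * E z]. *)
have H m y : E (fun w => z w * window y a w) <= E z / m.+1%:R + 400 * a * E z.
  elim: m y => [|m IH] y.
    rewrite divr1; apply: le_trans (triv y) _; rewrite lerDl.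
    by apply: mulr_ge0 _ Ez0; apply: mulr_ge0; [exact: ler0n | exact: ltW].
  have := concentration_step a1 z0 dz IH y.
  have : E z / m.+1%:R / 2 <= E z / m.+2%:R.
    rewrite -mulrA -invfM ler_wpM2l // lef_pV2 ?posrE ?mulr_gt0 //.
    by rewrite -natrM ler_nat muln2 -addnn addSn ltnS -[leqLHS]addn1 leq_add.
  move: (E z / m.+1%:R) (E z / m.+2%:R) (E (fun w => _ * window _ _ _)) => ? ? ?; lra.
apply/ler_addgt0Pr => eps eps0.
pose m := Num.bound (E z / eps).
apply: le_trans (H m x) _; rewrite addrC lerD2l ler_pdivrMr // mulrC -ler_pdivrMr //.
have := archi_boundP (divr_ge0 Ez0 (ltW eps0)) => /ltW /le_trans; apply.
by rewrite ler_nat.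
Qed.

End ConditionalConcentration.

(** * Stein's method for the self-normalised sum *)

Section SteinBound.
Context {R : realType} {O I : finType} (p : O -> R) (nb : I -> {set I}) (D : nat).
Variables (xi : I -> O -> R) (g b e h : R).
Hypothesis lf : local_field p nb D xi.
Hypothesis mb : moment_bounds p nb xi g b e.
Hypothesis h_gt0 : 0 < h.
Hypothesis lattice : forall i w, exists m : int, xi i w = m%:~R * h.
Hypothesis g_gt0 : 0 < g.
Let p_ge0 := lf_ge0 lf.
Let p_sum1 := lf_sum1 lf.
Let nb_refl := lf_refl lf.
Local Notation E := (Ex p).
Local Notation S := (fsum xi).
Local Notation eta := (feta nb xi).
Local Notation U := (scale nb xi).
Local Notation W := (ratio nb xi).
Local Notation Q := (fquad nb xi).

Lemma E_fquad_dev :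
  E (fun w => (Q w - 1) ^+ 2) <= D%:R ^+ 5 * g + (E Q - 1) ^+ 2.
Proof.
have -> : E (fun w => (Q w - 1) ^+ 2) = E (fun w => (Q w - E Q) ^+ 2) + (E Q - 1) ^+ 2.
  rewrite (eq_Ex _ (G := fun w => (Q w - E Q) ^+ 2
      + (2 * (E Q - 1) * (Q w - E Q) + (E Q - 1) ^+ 2))); last by move=> w; ring.
  by rewrite !ExD ExZl ExB !Ex_cst // subrr mulr0 add0r.
rewrite lerD2r; apply: le_trans (E_fquad_var lf mb) _.
by rewrite natrX mulrA -exprD.
Qed.

(** The range of [x] extends down to [- a] so that the induction may pass from any [x >= 0] to
    [x - a]. *)
Lemma count_multiples (a x : R) (n : nat) : 0 < a -> - a <= x ->
  \sum_(k < n) (k%:R * a <= x)%R%:R <= x / a + 1.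
Proof.
move=> a0; elim: n x => [|n IH] x xa.
  rewrite big_ord0 -[1](divff (x := a)) ?gt_eqF // -mulrDl.
  by rewrite divr_ge0 ?(ltW a0) //; lra.
have [x0|x0] := ltP x 0.
  rewrite big1 => [|k _].
    rewrite -[1](divff (x := a)) ?gt_eqF // -mulrDl.
    by rewrite divr_ge0 ?(ltW a0) //; lra.
  rewrite (_ : (_ <= _) = false) //; apply/negbTE; rewrite -ltNge.
  by apply: lt_le_trans x0 _; rewrite mulr_ge0 // ltW.
rewrite big_ord_recl mul0r x0.
have := IH (x - a); rewrite mulrBl divff ?gt_eqF // => /(_ ltac:(lra)).
under [X in _ -> _ + X <= _]eq_bigr do rewrite lift0 -natr1 mulrDl mul1r -lerBrDr.
by rewrite -[true%:R]/(1 : R); move: (\sum_(k < n) _) => s; lra.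
Qed.

(** Concentration needs windows of fixed length, whereas [2 |eta j|] is random. The event is
    therefore layered by [k], the integer part of [|W - y| / a]: on each layer [W] lies in one of
    two windows of length [a], and the remaining constraint [k a <= 2 |eta j|] joins the weight,
    which still depends on [nb j] only. Summing over [k] counts at most [2 |eta j| / a + 1]
    layers. *)
Lemma E_near_level (j : I) (y a : R) : a = 96 * (D%:R ^+ 5 * g) ->
  E (fun w => `|xi j w| * `|eta j w| * (`|W w - y| <= 2 * `|eta j w|)%R%:R)
  <= 1600 * E (fun w => `|xi j w| * `|eta j w| ^+ 2)
     + 800 * a * E (fun w => `|xi j w| * `|eta j w|).
Proof.
move=> aE.
have a0 : 0 < a by rewrite aE mulr_gt0 // mulr_gt0 // exprn_gt0 // (D_gt0 lf).
pose M := (Num.bound (2 / a)).+1.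
pose z k w := `|xi j w| * `|eta j w| * (k%:R * a <= 2 * `|eta j w|)%R%:R.
have z0 k w : 0 <= z k w by rewrite !mulr_ge0.
have dz k : dep xi (nb j) (z k).
  apply: (dep_comp2 *%R).
    apply: (dep_comp2 *%R); apply: (dep_comp Num.norm); last exact: dep_feta.
    exact: dep_xi.
  by apply: (dep_comp (fun t => (k%:R * a <= 2 * `|t|)%R%:R)); exact: dep_feta.
have conc k x := conditional_concentration lf mb h_gt0 lattice g_gt0 (z0 k) (dz k) x.
rewrite -aE in conc.
apply: le_trans (_ : E (fun w => \sum_(k < M) (z k w * window nb xi (y + k%:R * a) a w
    + z k w * window nb xi (y - k.+1%:R * a) a w)) <= _).
  apply: le_Ex => // w; have [hw|_] := boolP (`|W w - y| <= 2 * `|eta j w|); last first.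
    rewrite mulr0; apply: sumr_ge0 => k _; rewrite -mulrDr.
    by rewrite mulr_ge0 // addr_ge0 ?window_ge0.
  have t0 : 0 <= `|W w - y| / a by rewrite divr_ge0 // ltW.
  have /andP[n1 n2] := truncn_itv t0; set k := Num.truncn _ in n1 n2.
  have kM : (k < M)%N.
    rewrite ltnS -(ler_nat R); apply: le_trans n1 _.
    have := archi_boundP (x := 2 / a); rewrite divr_ge0 ?(ltW a0) // => /(_ isT)/ltW.
    apply: le_trans; rewrite ler_pM2r ?invr_gt0 //; apply: le_trans hw _.
    by have := norm_feta_le1 lf j w; lra.
  rewrite (bigD1 (Ordinal kM)) //= mulr1.
  apply: le_trans (_ : _ <= z k w * window nb xi (y + k%:R * a) a w
      + z k w * window nb xi (y - k.+1%:R * a) a w) _; last first.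
    rewrite lerDl; apply: sumr_ge0 => i _; rewrite -mulrDr.
    by rewrite mulr_ge0 // addr_ge0 ?window_ge0.
  rewrite -mulrDr /z; rewrite ler_pdivlMr // in n1; rewrite ltr_pdivrMr // in n2.
  rewrite (le_trans n1 hw) mulr1 ler_peMr ?mulr_ge0 // /window -natrD ler1n.
  rewrite -natr1 in n2 *.
  have [Wy|Wy] := leP y (W w).
    rewrite ger0_norm ?subr_ge0 // in n1 n2.
    by rewrite (_ : y + k%:R * a <= W w <= y + k%:R * a + a) // ; apply/andP; split; lra.
  rewrite ltr0_norm ?subr_lt0 // in n1 n2.
  rewrite (_ : y - (k%:R + 1) * a <= W w <= y - (k%:R + 1) * a + a) ?addn1 //.
  by apply/andP; split; lra.
rewrite Ex_sum.
apply: le_trans (_ : \sum_(k < M) 800 * a * E (z k) <= _).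
  by apply: ler_sum => k _; rewrite ExD; have := conc k (y + k%:R * a);
    have := conc k (y - k.+1%:R * a); lra.
rewrite -mulr_sumr -Ex_sum -ExZl.
apply: le_trans (_ : E (fun w => 1600 * (`|xi j w| * `|eta j w| ^+ 2)
   + 800 * a * (`|xi j w| * `|eta j w|)) <= _); last by rewrite ExD !ExZl.
apply: le_Ex => // w; rewrite /z -mulr_sumr.
have := @count_multiples a (2 * `|eta j w|) M a0.
have n0 := normr_ge0 (eta j w).
move=> /(_ ltac:(lra)); move: (\sum_(k < M) _) => s hs.
have k0 : 0 <= 800 * a * (`|xi j w| * `|eta j w|).
  apply: mulr_ge0; last exact: mulr_ge0.
  by apply: mulr_ge0; [exact: ler0n | exact: ltW].
apply: le_trans (_ : 800 * a * (`|xi j w| * `|eta j w|) * s <= _); first by lra.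
apply: le_trans (ler_wpM2l k0 hs) _.
by rewrite le_eqVlt; apply/orP; left; apply/eqP; field; rewrite gt_eqF.
Qed.

(** The expression [x * f x + 1(x <= y) - Phi y] stands for the derivative of [f], so that no
    differentiability enters. In the expansion hypothesis the indicator pays for the jump of that
    derivative at [y]. *)
Lemma stein_bound (C : R) (f Phi : R -> R) (y : R) :
  (forall x, `|f x| <= C) -> (forall x x', `|f x - f x'| <= C * `|x - x'|) ->
  (forall x, `|x * f x + (x <= y)%R%:R - Phi y| <= C) ->
  (forall x s r : R, `|s| <= r ->
     `|f x - f (x - s) - s * (x * f x + (x <= y)%R%:R - Phi y)|
     <= C * r * (r * (1 + `|x|) + (`|x - y| <= r)%R%:R)) ->
  `|E (fun w => (W w <= y)%R%:R) - Phi y| <=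
    C * (400 * 1000) * (D%:R ^+ 5 * g + D%:R ^+ 6 * g * b + e + (E Q - 1) ^+ 2).
Proof.
move=> fC fl f'C frem.
have C0 : 0 <= C by apply: le_trans (fC 0).
pose f' x := x * f x + (x <= y)%R%:R - Phi y.
have sep0 j : j \in [set: I] -> sep nb finset.set0 (ball nb 2 j) by move=> _ i k; rewrite inE.
have sum0 w : \sum_(k in thicken nb finset.set0) `|xi k w| <= 1.
  by rewrite /thicken big_set0 big_set0.
have := weighted_stein lf mb (z := fun=> 1) (fun=> ler01) (@dep_cst _ _ _ _ _ _ _) sep0 sum0 fC fl.
rewrite Ex_cst // mulr1.
set T1 := E _; set T2 := E _ => h12.
have T1E : T1 = E (fun w => f' (W w)) - E (fun w => (W w <= y)%R%:R) + Phi y.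
  rewrite -[Phi y](Ex_cst p_sum1) -ExB -ExD; apply: eq_Ex => w.
  rewrite /f' mul1r (eq_bigl xpredT); last by move=> i; rewrite inE.
  rewrite -/(S w) mulrAC -/(W w); ring.
have h2 : `|T2 - E (fun w => Q w * U w ^+ 2 * f' (W w))| <=
    C * (104 * (D%:R ^+ 2 * g) + 4 * (1600 * (D%:R ^+ 2 * g)
       + 800 * (96 * (D%:R ^+ 5 * g)) * (D%:R * b))).
  rewrite -ExB; apply: le_trans (norm_Ex p_ge0 _) _.
  apply: le_trans (_ : E (fun w => \sum_j C * (8 * (`|xi j w| * fabs nb xi j w ^+ 2
       + 2 * (`|xi j w| * fabs nb xi j w ^+ 2 * `|S w|))
       + 4 * (`|xi j w| * `|eta j w| * (`|W w - y| <= 2 * `|eta j w|)%R%:R))) <= _).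
    apply: le_Ex => // w; rewrite mul1r.
    have -> : U w * (\sum_(j in [set: I]) xi j w * (f (W w) - f (W w - eta j w * U w)))
        - Q w * U w ^+ 2 * f' (W w) =
        \sum_j U w * xi j w * (f (W w) - f (W w - eta j w * U w) - eta j w * U w * f' (W w)).
      rewrite (eq_bigl xpredT); last by move=> i; rewrite inE.
      rewrite /fquad /nquad mulr_sumr -mulrA mulr_suml -sumrB; apply: eq_bigr => j _.
      by rewrite /feta; ring.
    apply: le_trans (ler_norm_sum _ _ _) _; apply: ler_sum => j _.
    have /andP[_ u2] := scale_bounds nb xi w; have u0 := scale_ge0 nb xi w.
    rewrite !normrM (ger0_norm u0).
    have hs : `|eta j w * U w| <= 2 * `|eta j w|.
      by rewrite normrM (ger0_norm u0) mulrC ler_wpM2r.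
    have := frem (W w) _ _ hs; rewrite -/(f' (W w)).
    set X := `|f (W w) - _ - _| => hX.
    have W2 : `|W w| <= 2 * `|S w| by rewrite normrM (ger0_norm u0) mulrC ler_wpM2r.
    set i1 := (`|W w - y| <= _)%R%:R in hX *.
    have i10 : 0 <= i1 :> R by [].
    have n0 := normr_ge0 (eta j w); have ne := norm_nsum_le nb (xi^~ w) j.
    rewrite -/(feta nb xi j w) -/(fabs nb xi j w) in ne.
    have fa0 := le_trans n0 ne.
    have x0 := normr_ge0 (xi j w); have s0 := normr_ge0 (S w).
    apply: le_trans (_ : 2 * `|xi j w| * X <= _).
      by apply: ler_wpM2r; [exact: normr_ge0 | apply: ler_wpM2r].
    apply: le_trans (ler_wpM2l (mulr_ge0 (ler0n _ 2) x0) hX) _.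
    have ee : `|eta j w| ^+ 2 <= fabs nb xi j w ^+ 2 by rewrite lerXn2r ?nnegrE.
    rewrite -subr_ge0.
    have -> : C * (8 * (`|xi j w| * fabs nb xi j w ^+ 2 +
          2 * (`|xi j w| * fabs nb xi j w ^+ 2 * `|S w|))
          + 4 * (`|xi j w| * `|eta j w| * i1))
        - 2 * `|xi j w| * (C * (2 * `|eta j w|) * (2 * `|eta j w| * (1 + `|W w|) + i1))
      = C * (8 * `|xi j w|) * ((fabs nb xi j w ^+ 2 - `|eta j w| ^+ 2) * (1 + 2 * `|S w|)
          + `|eta j w| ^+ 2 * (2 * `|S w| - `|W w|)) by ring.
    apply: mulr_ge0; first by rewrite !mulr_ge0.
    apply: addr_ge0; apply: mulr_ge0; rewrite ?subr_ge0 ?sqr_ge0 //; lra.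
  rewrite Ex_sum.
  (* [104 = 8 (1 + 2 * 6)], the 6 being the price of decoupling [|S w|]. *)
  apply: le_trans (_ : \sum_j (C * (104 * E (fun w => `|xi j w| * fabs nb xi j w ^+ 2)
    + 4 * (1600 * E (fun w => `|xi j w| * fabs nb xi j w ^+ 2)
       + 800 * (96 * (D%:R ^+ 5 * g)) * E (fun w => `|xi j w| * fabs nb xi j w)))) <= _).
    apply: ler_sum => j _; rewrite ExZl ExD !ExZl ExD ExZl ler_wpM2l //.
    have d1 : E (fun w => `|xi j w| * fabs nb xi j w ^+ 2 * `|S w|) <=
        6 * E (fun w => `|xi j w| * fabs nb xi j w ^+ 2).
      apply: (decouple_fsum lf mb (A := nb j)) => [w||w].
      - by rewrite mulr_ge0 ?sqr_ge0.
      - apply: (dep_comp2 *%R); first by apply: (dep_comp Num.norm); exact: dep_xi.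
        by apply: (dep_comp (fun t => t ^+ 2)); exact: dep_fabs.
      - by have := sum_ball_le1 lf j w (isT : (2 <= 4)%N); rewrite ballS ball1; lra.
    have d2 := E_near_level j y erefl.
    have d3 : E (fun w => `|xi j w| * `|eta j w| ^+ 2) <=
        E (fun w => `|xi j w| * fabs nb xi j w ^+ 2).
      apply: le_Ex => // w; rewrite ler_wpM2l // lerXn2r ?nnegrE ?norm_nsum_le //.
      exact: nabs_ge0.
    have d4 : E (fun w => `|xi j w| * `|eta j w|) <= E (fun w => `|xi j w| * fabs nb xi j w).
      by apply: le_Ex => // w; rewrite ler_wpM2l // norm_nsum_le.
    have k0 : 0 <= 800 * (96 * (D%:R ^+ 5 * g)).
      by do 2!(apply: mulr_ge0; first exact: ler0n); rewrite mulr_ge0 ?exprn_ge0 // ltW.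
    have := ler_wpM2l k0 d4; lra.
  rewrite -mulr_sumr ler_wpM2l // big_split /= -!mulr_sumr big_split /= -!mulr_sumr.
  have k0 : 0 <= 800 * (96 * (D%:R ^+ 5 * g)).
    by do 2!(apply: mulr_ge0; first exact: ler0n); rewrite mulr_ge0 ?exprn_ge0 // ltW.
  have := ler_wpM2l k0 (E_abs_fabs lf mb); have := E_abs_fabs_sq lf mb; lra.
have h3 : `|E (fun w => Q w * U w ^+ 2 * f' (W w)) - E (fun w => f' (W w))| <=
    4 * C * (D%:R ^+ 5 * g + (E Q - 1) ^+ 2).
  rewrite -ExB; apply: le_trans (norm_Ex p_ge0 _) _.
  apply: le_trans (ler_wpM2l _ E_fquad_dev); last by rewrite mulr_ge0.
  rewrite -ExZl; apply: le_Ex => // w.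
  have -> : Q w * U w ^+ 2 * f' (W w) - f' (W w) = (Q w * U w ^+ 2 - 1) * f' (W w) by ring.
  rewrite normrM mulrAC; apply: ler_pM => //; [exact: invroot_sqr_err | exact: f'C].
have dd : D%:R ^+ 2 * g <= D%:R ^+ 5 * g.
  by rewrite ler_wpM2r ?(ltW g_gt0) // ler_weXn2l //; have := D_ge2 lf; lra.
have d6 : D%:R ^+ 6 * g * b = D%:R ^+ 5 * g * (D%:R * b) by rewrite exprSr; ring.
rewrite d6.
have g50 : 0 <= D%:R ^+ 5 * g by rewrite mulr_ge0 ?exprn_ge0 // ltW.
have b0 : 0 <= b.
  apply: le_trans (mb_second mb); apply: sumr_ge0 => i _; apply: Ex_ge0 => // w.
  exact: sqr_ge0.
have gb0 : 0 <= D%:R ^+ 5 * g * (D%:R * b).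
  by apply: mulr_ge0 => //; apply: mulr_ge0.
have q0 := sqr_ge0 (E Q - 1); have e0 := e_ge0 mb.
apply: le_trans (_ : ((112 * C + 8 * C) * (D%:R ^+ 2 * g) + 2 * C * e)
   + C * (104 * (D%:R ^+ 2 * g) + 4 * (1600 * (D%:R ^+ 2 * g)
       + 800 * (96 * (D%:R ^+ 5 * g)) * (D%:R * b)))
   + 4 * C * (D%:R ^+ 5 * g + (E Q - 1) ^+ 2) <= _).
  move: h12 h2 h3; rewrite T1E.
  move: (_ * (_ * g) + _ * e) (C * (104 * _ + _)) (4 * C * _) => B1 B2 B3.
  by rewrite !ler_norml => /andP[? ?] /andP[? ?] /andP[? ?]; apply/andP; split; lra.
move: dd g50 gb0 q0; move: (D%:R ^+ 2 * g) (D%:R ^+ 5 * g) (D%:R * b) ((E Q - 1) ^+ 2) => x1 x2 x3 x4 *.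
rewrite -!mulrA; apply: le_trans (_ : C * (224 * x1 + 2 * e
   + 4 * (1600 * x1 + 800 * (96 * x2) * x3) + 4 * (x2 + x4)) <= _).
  by rewrite le_eqVlt; apply/orP; left; apply/eqP; ring.
(* The largest coefficient is [4 * 800 * 96 = 307200], rounded up to [400 * 1000]. *)
by apply: ler_wpM2l => //; lra.
Qed.

End SteinBound.

(** * The contribution of the sample means to the normaliser *)

Section CentringCorrection.
Context {R : realType} {O I : finType} (p : O -> R) (nb : I -> {set I}) (D : nat).
Variables (xi : I -> O -> R) (g b e : R).
Hypothesis lf : local_field p nb D xi.
Hypothesis mb : moment_bounds p nb xi g b e.
Let p_ge0 := lf_ge0 lf.
Let p_sum1 := lf_sum1 lf.
Let nb_refl := lf_refl lf.
Let nb_sym := lf_sym lf.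
Let nb_card := lf_card lf.
Local Notation E := (Ex p).
Local Notation S := (fsum xi).
Local Notation eta := (feta nb xi).

Definition etasum (w : O) : R := \sum_i eta i w.

Let c (i : I) : R := #|nb i|%:R.
Let T := wsum xi c.

Let c_le i : `|c i| <= D%:R.
Proof. by rewrite ger0_norm ?ler0n // ler_nat. Qed.

(** By double counting, [etasum] is a sum of the [xi i] weighted by neighbourhood sizes, a form to
    which [decouple] and [variance_local] apply. *)
Lemma etasumE w : etasum w = T w.
Proof.
rewrite /etasum /feta /nsum (sum_nb_exchange nb_sym (fun _ j => xi j w)).
by apply: eq_bigr => i _; rewrite sumr_const mulr_natl.
Qed.

Let b_ge0 : 0 <= b.
Proof.
apply: le_trans (mb_second mb); apply: sumr_ge0 => i _; apply: Ex_ge0 => // w.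
exact: sqr_ge0.
Qed.

Let E_T_sq : E (fun w => T w ^+ 2) <= D%:R ^+ 2 / 4 + D%:R ^+ 3 * b.
Proof.
have D0 := D_gt0 lf.
have dZ i : i \in [set: I] -> dep xi (ball nb 0 i) (fun w => c i * xi i w).
  by move=> _; apply: (dep_comp ( *%R (c i))); apply: dep_xi; rewrite ball0 inE.
have ET : E T = \sum_i c i * E (xi i).
  by rewrite /T /wsum Ex_sum; apply: eq_bigr => i _; rewrite ExZl.
have tE (F : I -> R) : \sum_(i in [set: I]) F i = \sum_i F i.
  by apply: eq_bigl => i; rewrite inE.
have := variance_local lf dZ; rewrite !tE expn1.
rewrite (eq_Ex _ (G := fun w => (T w - E T) ^+ 2)); last first.
  by move=> w; rewrite tE ET; under [X in (_ - X) ^+ 2]eq_bigr do rewrite ExZl.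
rewrite Ex_centered_sq // => h1.
have h2 : E T ^+ 2 <= D%:R ^+ 2 / 4.
  rewrite -real_normK ?num_real // (_ : D%:R ^+ 2 / 4 = (D%:R / 2) ^+ 2); last by field.
  rewrite lerXn2r ?nnegrE ?divr_ge0 ?ler0n // ET.
  apply: le_trans (ler_norm_sum _ _ _) _.
  apply: le_trans (_ : \sum_i D%:R * `|E (xi i)| <= _).
    by apply: ler_sum => i _; rewrite normrM ler_wpM2r.
  rewrite -mulr_sumr; have := ler_wpM2l (ltW D0) (mb_first mb).
  have := ler_wpM2l (ltW D0) (mb_small mb); lra.
have h3 : \sum_i E (fun w => (c i * xi i w) ^+ 2) <= D%:R ^+ 2 * b.
  apply: le_trans (ler_wpM2l _ (mb_second mb)); last by rewrite exprn_ge0 // ltW.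
  rewrite mulr_sumr; apply: ler_sum => i _; rewrite -ExZl; apply: le_Ex => // w.
  rewrite exprMn ler_wpM2r ?sqr_ge0 // -real_normK ?num_real //.
  by rewrite lerXn2r ?nnegrE ?ler0n.
have := ler_wpM2l (ltW D0) h3; rewrite mulrA -exprS; lra.
Qed.

Let E_abs_T : E (fun w => `|T w|) <= D%:R + D%:R ^+ 2 * b.
Proof.
have D0 := D_gt0 lf.
apply: le_trans (_ : E (fun w => T w ^+ 2 * (2 * D%:R)^-1 + D%:R / 2) <= _).
  apply: le_Ex => // w; rewrite -real_normK ?num_real // -subr_ge0.
  have -> : `|T w| ^+ 2 / (2 * D%:R) + D%:R / 2 - `|T w| =
      (`|T w| - D%:R) ^+ 2 / (2 * D%:R) by field; rewrite gt_eqF.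
  by rewrite divr_ge0 ?sqr_ge0 // mulr_ge0 // ltW.
rewrite ExD ExZr Ex_cst // -lerBrDr ler_pdivrMr ?mulr_gt0 //.
apply: le_trans E_T_sq _; rewrite -subr_ge0.
have -> : (D%:R + D%:R ^+ 2 * b - D%:R / 2) * (2 * D%:R)
   - (D%:R ^+ 2 / 4 + D%:R ^+ 3 * b) = D%:R ^+ 2 * (3 / 4 + D%:R * b) :> R by field.
by rewrite mulr_ge0 ?exprn_ge0 ?(ltW D0) // addr_ge0 ?divr_ge0 // mulr_ge0 // ltW.
Qed.

Let T_off (i : I) (w : O) : R := \sum_(k | k \notin nb i) c k * xi k w.

Let T_off_diff i w : `|T w - T_off i w| <= D%:R * fabs nb xi i w.
Proof.
rewrite /T /wsum (bigID (mem (nb i))) /= addrK.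
apply: le_trans (ler_norm_sum _ _ _) _; rewrite mulr_sumr; apply: ler_sum => k _.
by rewrite normrM ler_wpM2r.
Qed.

(** One factor of [S^2] is expanded into the [xi i]. In the term of [i] the other [S] and [T] lose
    the neighbourhood of [i], leaving a product with the mean [E (xi i)], and the error is
    decoupled. Cauchy-Schwarz applied to [S^2 |T|] would call for a fourth moment of [S]. *)
Lemma E_centring : E (fun w => (1 + S w ^+ 2) * `|etasum w|) <= 12 * D%:R ^+ 3 * (1 + b) ^+ 2.
Proof.
have D0 := D_gt0 lf; have D2 := D_ge2 lf.
rewrite (eq_Ex _ (G := fun w => `|T w| + \sum_i xi i w * (S w * `|T w|))); last first.
  by move=> w; rewrite etasumE -mulr_suml -/(S w); ring.
rewrite ExD Ex_sum.
pose F i w := `|xi i w| * fabs nb xi i w.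
have F0 i w : 0 <= F i w by rewrite mulr_ge0 ?nabs_ge0.
have dF i : dep xi (nb i) (F i).
  apply: (dep_comp2 *%R); last exact: dep_fabs.
  by apply: (dep_comp Num.norm); exact: dep_xi.
have th1 i w : \sum_(k in thicken nb (nb i)) `|xi k w| <= 2.
  by have := sum_ball_le1 lf i w (isT : (2 <= 4)%N); rewrite ballS ball1; lra.
have FT i : E (fun w => F i w * `|T w|) <= E (F i) * (5 * D%:R + D%:R ^+ 2 * b).
  apply: le_trans (decouple lf (ltW D0) c_le (F0 i) (dF i) (th1 i)) _.
  rewrite ler_wpM2l ?Ex_ge0 //; have := E_abs_T; lra.
have FS i : E (fun w => F i w * `|S w|) <= 6 * E (F i).
  exact: (decouple_fsum lf mb (F0 i) (dF i) (th1 i)).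
pose G i w := sum_off nb xi i w * `|T_off i w|.
have GE i : E (fun w => xi i w * G i w) = E (xi i) * E (G i).
  apply: (lf_ind lf (A := [set i]) (B := ~: nb i)); first by move=> _ k /finset.set1P ->; rewrite inE.
    by apply: dep_xi; rewrite inE.
  apply: (dep_comp2 *%R); first exact: dep_sum_off.
  apply: (dep_comp Num.norm); apply: dep_sum => k ki.
  by apply: (dep_comp ( *%R (c k))); apply: dep_xi; rewrite inE.
(* A bound for the expectation of [(|S| + 1) (|T| + D)], after [|S| |T| <= S^2 / 2 + T^2 / 2]. *)
pose V := 2 + D%:R ^+ 2 / 8 + D%:R ^+ 3 * b / 2 + 4 * D%:R + D%:R ^+ 2 * b.
have V0 : 0 <= V by rewrite /V !addr_ge0 ?mulr_ge0 ?exprn_ge0 ?invr_ge0 // ltW.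
have EG i : `|E (G i)| <= V.
  apply: le_trans (norm_Ex p_ge0 _) _.
  apply: le_trans (_ : E (fun w => S w ^+ 2 / 2 + T w ^+ 2 / 2 + D%:R * `|S w| + `|T w| + D%:R) <= _).
    apply: le_Ex => // w; rewrite /G normrM normr_id.
    have s1 := norm_sum_off_le lf i w.
    have t1 : `|T_off i w| <= `|T w| + D%:R.
      rewrite -[T_off i w](subrKC (T w)); apply: le_trans (ler_normD _ _) _; rewrite lerD2l.
      rewrite distrC; apply: le_trans (T_off_diff i w) _.
      by rewrite ler_piMr ?(ltW D0) // (fabs_le1 lf).
    apply: le_trans (ler_pM (normr_ge0 _) (normr_ge0 _) s1 t1) _.
    rewrite -(real_normK (num_real (S w))) -(real_normK (num_real (T w))).
    by have := sqr_ge0 (`|S w| - `|T w|); lra.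
  rewrite !ExD !ExZr ExZl Ex_cst //.
  have := E_fsum_sq lf mb; have := E_T_sq; have := E_abs_T.
  have := ler_wpM2l (ltW D0) (E_abs_fsum lf mb); rewrite /V; lra.
have main : \sum_i E (fun w => xi i w * (S w * `|T w|)) <=
    \sum_i (E (F i) * (12 * D%:R + D%:R ^+ 2 * b) + `|E (xi i)| * V).
  apply: ler_sum => i _.
  have -> : E (fun w => xi i w * (S w * `|T w|)) =
      E (fun w => xi i w * (S w * `|T w| - G i w)) + E (xi i) * E (G i).
    by rewrite -GE -ExD; apply: eq_Ex => w; ring.
  apply: lerD; last first.
    apply: le_trans (ler_norm _) _; rewrite normrM ler_wpM2l //.
  apply: le_trans (_ : E (fun w => F i w * `|T w| + D%:R * (F i w * `|S w| + F i w)) <= _).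
    apply: le_Ex => // w; apply: le_trans (ler_norm _) _; rewrite normrM.
    have -> : S w * `|T w| - G i w = eta i w * `|T w| + sum_off nb xi i w * (`|T w| - `|T_off i w|).
      have -> : eta i w = S w - sum_off nb xi i w by rewrite sum_offE; ring.
      by rewrite /G; ring.
    apply: le_trans (ler_wpM2l (normr_ge0 _) (ler_normD _ _)) _.
    rewrite mulrDr; apply: lerD.
      rewrite /F normrM normr_id mulrA ler_wpM2r // ler_wpM2l // norm_nsum_le //.
    rewrite /F normrM.
    apply: le_trans (_ : `|xi i w| * ((`|S w| + 1) * (D%:R * fabs nb xi i w)) <= _).
      rewrite ler_wpM2l //; apply: ler_pM => //; first exact: (norm_sum_off_le lf).
      apply: le_trans (T_off_diff i w); exact: ler_dist_dist.
    by rewrite le_eqVlt; apply/orP; left; apply/eqP; ring.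
  rewrite ExD ExZl ExD.
  have := FT i; have := ler_wpM2l (ltW D0) (FS i); lra.
have sumF : \sum_i E (F i) <= D%:R * b by exact: (E_abs_fabs lf mb).
rewrite big_split /= -!mulr_suml in main.
have k1 : 0 <= 12 * D%:R + D%:R ^+ 2 * b.
  by rewrite addr_ge0 // mulr_ge0 ?exprn_ge0 // ltW.
have m1 := ler_wpM2r k1 sumF.
have m2 := ler_wpM2r V0 (mb_first mb); have m3 := ler_wpM2r V0 (mb_small mb).
apply: le_trans (_ : D%:R + D%:R ^+ 2 * b + (D%:R * b * (12 * D%:R + D%:R ^+ 2 * b) + V / 2) <= _).
  by apply: lerD; [exact: E_abs_T | lra].
rewrite /V; move: b_ge0 D0 D2; set d := D%:R; move: d => d b0 d0 d2.
have d3 : 2 * d ^+ 2 <= d ^+ 3 by rewrite exprS ler_wpM2r ?sqr_ge0.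
have d4 : 2 * d <= d ^+ 2 by rewrite expr2 ler_wpM2r // ltW.
have bd3 := ler_wpM2l b0 d3; have bd0 : 0 <= b * d ^+ 2 by rewrite mulr_ge0 ?sqr_ge0.
have b2 : 0 <= b ^+ 2 * d ^+ 3 by rewrite mulr_ge0 ?exprn_ge0 // ltW.
lra.
Qed.

End CentringCorrection.

(** * Stability of the statistic under rounding and centring *)

Section DiscretisedStatistic.
Context {R : realType} {I : finType} (nb : I -> {set I}) (D : nat).
Hypothesis nb_card : forall i, (#|nb i| <= D)%N.
Variables (x y : I -> R) (h r : R).
Hypothesis h_gt0 : 0 < h.
Hypothesis x_le1 : forall i, `|x i| <= 1.
Hypothesis y_le1 : forall i, `|y i| <= 1.
Hypothesis xy_le : forall i, `|x i - y i| <= h.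
Let n : R := #|I|%:R.

Let Dn0 : 0 <= D%:R :> R. Proof. exact: ler0n. Qed.
Let n0 : 0 <= n. Proof. exact: ler0n. Qed.

Let sum_le (F : I -> R) (c : R) : (forall i, `|F i| <= c) -> `|\sum_i F i| <= n * c.
Proof.
move=> Fc; apply: le_trans (ler_norm_sum _ _ _) _.
apply: le_trans (_ : \sum_(i : I) c <= _); first exact: ler_sum.
by rewrite sumr_const mulr_natl.
Qed.

Let nsum_le (F : I -> R) (c : R) i : 0 <= c -> (forall j, `|F j| <= c) ->
  `|\sum_(j in nb i) F j| <= D%:R * c.
Proof.
move=> c0 Fc; apply: le_trans (ler_norm_sum _ _ _) _.
apply: le_trans (_ : \sum_(j in nb i) c <= _); first exact: ler_sum.
by rewrite sumr_const -[leLHS]mulr_natl ler_wpM2r // ler_nat.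
Qed.

Let S (z : I -> R) : R := \sum_i z i.
Let T (z : I -> R) : R := \sum_i nsum nb z i.

Let prod_diff (a b c d k l : R) : `|a| <= k -> `|d| <= l ->
  `|a * b - c * d| <= k * `|b - d| + `|a - c| * l.
Proof.
move=> ak dl; have -> : a * b - c * d = a * (b - d) + (a - c) * d by ring.
apply: le_trans (ler_normD _ _) _; rewrite !normrM.
by apply: lerD; [rewrite ler_wpM2r | rewrite ler_wpM2l].
Qed.

Let S_diff : `|S x - S y| <= n * h.
Proof. by rewrite -sumrB; exact: sum_le. Qed.

Let T_diff : `|T x - T y| <= n * (D%:R * h).
Proof.
rewrite -sumrB; apply: sum_le => i; rewrite /nsum -sumrB.
by apply: nsum_le; first exact: ltW.
Qed.

Let Q_diff : `|nquad nb x - nquad nb y| <= n * (D%:R * (2 * h)).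
Proof.
rewrite -sumrB; apply: sum_le => i; rewrite /nsum !mulr_sumr -sumrB.
apply: nsum_le => [|j]; first by rewrite mulr_ge0 // ltW.
by have := prod_diff (x j) (y i) (x_le1 i) (y_le1 j); have := xy_le i; have := xy_le j; lra.
Qed.

Let S_le (z : I -> R) : (forall i, `|z i| <= 1) -> `|S z| <= n.
Proof. by move=> z1; rewrite -[leRHS]mulr1; exact: sum_le. Qed.

Let T_le (z : I -> R) : (forall i, `|z i| <= 1) -> `|T z| <= n * D%:R.
Proof.
move=> z1; apply: sum_le => i; rewrite -[leRHS]mulr1; exact: nsum_le.
Qed.

(** Keeping [V] near [nquad nb y] requires [|S T| / n] to be small. The error of the scale is then
    multiplied by [S], which requires the same of [S^2 |T| / n]. The weight [1 + S^2] controls both.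
    The range [[1/4, 4]] is where the clipping is inactive. *)
Lemma discretised_statistic :
  (0 < #|I|)%N -> (0 < D)%N -> r <= 8^-1 -> 8 * n ^+ 2 * D%:R * h <= r ->
  `|nquad nb y - 1| <= 2^-1 -> (1 + S y ^+ 2) * `|T y| <= n * r ->
  let V := nquad nb x - S x * T x / n in
  4^-1 <= V <= 4 /\ `|S x * invroot V - S y * invroot (nquad nb y)| <= 7 * r.
Proof.
move=> I0 D0 r8 hr Q1 bad V.
have n1 : 1 <= n by rewrite ler1n.
have D1 : 1 <= D%:R :> R by rewrite ler1n.
have n00 : 0 < n by lra.
have ST_diff : `|S x * T x - S y * T y| <= n * (n * (D%:R * (2 * h))).
  apply: le_trans (prod_diff _ _ (S_le x_le1) (T_le y_le1)) _.
  have := ler_wpM2l n0 T_diff; have := ler_wpM2r (mulr_ge0 n0 Dn0) S_diff; lra.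
have STy : `|S y * T y| / n <= r / 2.
  rewrite ler_pdivrMr // normrM.
  have := sqr_ge0 (`|S y| - 1); rewrite sqrrB1 real_normK ?num_real // => k.
  have := normr_ge0 (T y) => t0; have := ler_wpM2r t0 k; rewrite mul0r; lra.
have k0 : n * (D%:R * h) <= n ^+ 2 * D%:R * h.
  by rewrite expr2 -!mulrA ler_wpM2l // ler_peMl // mulr_ge0 // ltW.
have k1 : n * h <= n ^+ 2 * D%:R * h.
  by apply: le_trans k0; rewrite ler_wpM2l // ler_peMl // ltW.
have VQ : `|V - nquad nb y| <= r / 2 + 4 * (n * (D%:R * h)).
  have -> : V - nquad nb y = (nquad nb x - nquad nb y) - (S x * T x - S y * T y) / n
     - S y * T y / n by rewrite /V; ring.
  apply: le_trans (ler_normB _ _) _; rewrite [leRHS]addrC; apply: lerD; last first.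
    by rewrite normrM normfV (ger0_norm n0).
  apply: le_trans (ler_normB _ _) _; rewrite normrM normfV (ger0_norm n0).
  have : `|S x * T x - S y * T y| / n <= n * (D%:R * (2 * h)).
    by rewrite ler_pdivrMr // [leRHS]mulrC.
  have := Q_diff; lra.
have VQr : `|V - nquad nb y| <= r by lra.
split.
  move: VQr Q1; rewrite !ler_norml; lra.
have -> : S x * invroot V - S y * invroot (nquad nb y) =
  (S x - S y) * invroot V + S y * (invroot V - invroot (nquad nb y)) by ring.
apply: le_trans (ler_normD _ _) _; rewrite !normrM.
have /andP[u1 u2] := invroot_bounds V.
have e1 : `|S x - S y| * `|invroot V| <= n * h * 2.
  by apply: ler_pM => //; rewrite ger0_norm //; lra.
have e2 : `|S y| * `|invroot V - invroot (nquad nb y)| <= `|S y| * (4 * `|V - nquad nb y|).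
  by rewrite ler_wpM2l // invroot_lip.
have VQ2 : `|V - nquad nb y| <= `|S y * T y| / n + 4 * (n * (D%:R * h)).
  have -> : V - nquad nb y = (nquad nb x - nquad nb y) - (S x * T x - S y * T y) / n
     - S y * T y / n by rewrite /V; ring.
  apply: le_trans (ler_normB _ _) _; rewrite [leRHS]addrC; apply: lerD; last first.
    by rewrite normrM normfV (ger0_norm n0).
  apply: le_trans (ler_normB _ _) _; rewrite normrM normfV (ger0_norm n0).
  have : `|S x * T x - S y * T y| / n <= n * (D%:R * (2 * h)).
    by rewrite ler_pdivrMr // [leRHS]mulrC.
  have := Q_diff; lra.
have e3 : `|S y| * `|V - nquad nb y| <= `|S y| * (`|S y * T y| / n) + 4 * (n ^+ 2 * D%:R * h).
  apply: le_trans (ler_wpM2l (normr_ge0 _) VQ2) _; rewrite mulrDr lerD2l.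
  apply: le_trans (ler_wpM2r _ (S_le y_le1)) _.
    by rewrite mulr_ge0 // mulr_ge0 // mulr_ge0 // ltW.
  by rewrite le_eqVlt; apply/orP; left; apply/eqP; ring.
have e4 : `|S y| * (`|S y * T y| / n) <= r.
  rewrite mulrA ler_pdivrMr // normrM mulrA -expr2 real_normK ?num_real //.
  by have t0 := normr_ge0 (T y); lra.
have r0 : 0 <= n * h by rewrite mulr_ge0 // ltW.
(* As [n^2 D h <= r / 8], the two parts add up to at most [r / 4 + 4 (r + r / 2)], below [7 r]. *)
lra.
Qed.

End DiscretisedStatistic.

Local Open Scope classical_set_scope.
Local Open Scope ring_scope.

(** * The normal distribution and Stein's equation *)

Section NormalDistribution.
Context {R : realType}.
Implicit Types x y z : R.

Definition Phi z : R := fine (std_normal_cdf z).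
Definition density x : R := normal_peak 1 * expR (- (x ^+ 2 / 2)).
Definition recip_density x : R := (normal_peak 1)^-1 * expR (x ^+ 2 / 2).

Let peak_gt0 : 0 < normal_peak 1 :> R.
Proof. by apply: normal_peak_gt0; rewrite oner_eq0. Qed.

Lemma density_gt0 x : 0 < density x.
Proof. by rewrite mulr_gt0 ?expR_gt0. Qed.

Lemma recip_density_gt0 x : 0 < recip_density x.
Proof. by apply: mulr_gt0; [rewrite invr_gt0; exact: peak_gt0 | exact: expR_gt0]. Qed.

Lemma densityK x : density x * recip_density x = 1.
Proof.
rewrite /density /recip_density mulrACA divff ?gt_eqF // mul1r.
by rewrite -expRD addNr expR0.
Qed.

Lemma normal_pdf_density : normal_pdf 0 1 = density.
Proof.
rewrite normal_pdfE ?oner_eq0 //; apply/funext => x.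
by rewrite /density /normal_fun subr0 expr1n mulNr -[1 *+ 2]/(2 : R).
Qed.

Lemma PhiE z : (Phi z)%:E = std_normal_cdf z.
Proof. by rewrite /Phi fineK // fin_num_measure. Qed.

Lemma Phi_ge0 z : 0 <= Phi z.
Proof. by rewrite -lee_fin PhiE. Qed.

Lemma Phi_le1 z : Phi z <= 1.
Proof. by rewrite -lee_fin PhiE; exact: probability_le1. Qed.

Lemma Phi_mono x y : x <= y -> Phi x <= Phi y.
Proof.
move=> xy; rewrite -lee_fin !PhiE; apply: le_measure; rewrite ?inE //.
by move=> t /=; rewrite !in_itv /= => /le_trans; apply.
Qed.

Lemma is_derive_Phi x : is_derive x 1 Phi (density x).
Proof.
have int1 : lebesgue_measure.-integrable `]-oo, (x + 1)]
    (EFin \o normal_pdf (0 : R) 1).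
  apply: (integrableS _ _ (subsetT _)) => //; exact: integrable_normal_pdf.
have c1 : {for x, continuous (normal_pdf (0 : R) 1)}.
  by apply: continuous_normal_pdf; rewrite oner_eq0.
have xx : x < x + 1 by rewrite ltrDl.
have [d1 d2] := continuous_FTC1 xx int1 (ltNyr x) c1.
rewrite -normal_pdf_density -d2 derive1E.
exact: derivableP d1.
Qed.

(** The identity as a random variable under the normal law: its cumulative distribution function is
    [Phi], whose limits at infinity follow from the general ones. *)
Let idR : measurableTypeR R -> R := idfun.
HB.instance Definition _ :=
  @isMeasurableFun.Build _ _ _ _ idR (@measurable_id _ _ setT).

Let cdf_idR w : fine (cdf (idR : {RV (normal_prob (0 : R) 1) >-> R}) w) = Phi w.
Proof. by []. Qed.

Lemma Phi_cvgy (eps : R) : 0 < eps -> exists w0, forall w, w0 <= w -> 1 - Phi w < eps.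
Proof.
move=> e0.
have := @cvg_cdfy1 _ _ _ (normal_prob (0 : R) 1) (idR : {RV (normal_prob (0 : R) 1) >-> R}).
move=> /fine_cvgP [_ /cvgrPdist_lt /(_ _ e0) [M [_ HM]]].
exists (M + 1) => w Mw; have /HM /= : M < w by rewrite (lt_le_trans _ Mw) // ltrDl.
by rewrite cdf_idR; apply: le_lt_trans; exact: ler_norm.
Qed.

Lemma Phi_cvgNy (eps : R) : 0 < eps -> exists w0, forall w, w <= w0 -> Phi w < eps.
Proof.
move=> e0.
have := @cvg_cdfNy0 _ _ _ (normal_prob (0 : R) 1) (idR : {RV (normal_prob (0 : R) 1) >-> R}).
move=> /fine_cvgP [_ /cvgrPdist_lt /(_ _ e0) [M [_ HM]]].
exists (M - 1) => w Mw; have /HM /= : w < M by rewrite (le_lt_trans Mw) // gtrDl ltrN10.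
by rewrite cdf_idR sub0r normrN; apply: le_lt_trans; exact: ler_norm.
Qed.

Lemma is_derive_density x : is_derive x 1 density (- x * density x).
Proof.
have h : is_derive x 1 (fun t : R => - (t ^+ 2 / 2)) (- x).
  by apply: is_derive_eq; rewrite !scaler0 ?addr0 /GRing.scale /=; lra.
rewrite /density; apply: is_derive_eq.
by rewrite /GRing.scale /=; ring.
Qed.

Lemma is_derive_recip_density x : is_derive x 1 recip_density (x * recip_density x).
Proof.
have h : is_derive x 1 (fun t : R => t ^+ 2 / 2) x.
  by apply: is_derive_eq; rewrite !scaler0 ?addr0 /GRing.scale /=; lra.
rewrite /recip_density; apply: is_derive_eq.
by rewrite /GRing.scale /=; ring.
Qed.

Lemma derive_mono (F dF : R -> R) (a b : R) : a <= b ->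
  (forall x, is_derive x 1 F (dF x)) -> (forall x, a <= x <= b -> 0 <= dF x) ->
  F a <= F b.
Proof.
move=> ab dFx dF0.
have cF : {within `[a, b], continuous F}.
  by apply: derivable_within_continuous => x _; apply: ex_derive.
have [c cab E] := MVT_segment ab (fun x _ => dFx x) cF.
by rewrite -subr_ge0 E mulr_ge0 ?subr_ge0 // dF0.
Qed.

(** [H t = 1 - Phi t - density t / x] has derivative [density t * (t / x - 1)], so it increases
    beyond [x]; far out it is below any positive number, hence [H x <= 0]. *)
Lemma mills_right x : 0 < x -> x * (1 - Phi x) <= density x.
Proof.
move=> x0; rewrite mulrC -ler_pdivlMr // -subr_le0.
apply/ler_addgt0Pr => eps e0; rewrite add0r.
have [w0 hw] := Phi_cvgy e0; pose w := Num.max w0 x.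
have w0w : w0 <= w by rewrite le_max lexx.
have xw : x <= w by rewrite le_max lexx orbT.
pose H (t : R) := 1 - Phi t - density t / x.
have dH (t : R) : is_derive t 1 H (- density t + t * density t / x).
  have := is_derive_Phi t; have := is_derive_density t => ? ?.
  by rewrite /H; apply: is_derive_eq; rewrite !scaler0 /GRing.scale /=; ring.
have HH : H x <= H w.
  apply: (derive_mono xw dH) => t /andP[xt _].
  rewrite addrC subr_ge0 mulrAC -[leLHS]mul1r ler_pM2r ?density_gt0 //.
  by rewrite ler_pdivlMr // mul1r.
apply: le_trans HH _; apply: ltW; apply: le_lt_trans (hw _ w0w).
by rewrite /H gerDl oppr_le0 divr_ge0 ?(ltW (density_gt0 _)) // ltW.
Qed.

Lemma mills_left x : x < 0 -> - x * Phi x <= density x.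
Proof.
move=> x0; have nx0 : 0 < - x by rewrite oppr_gt0.
rewrite mulrC -ler_pdivlMr // -subr_le0.
apply/ler_addgt0Pr => eps e0; rewrite add0r.
have [w0 hw] := Phi_cvgNy e0; pose w := Num.min w0 x.
have w0w : w <= w0 by rewrite ge_min lexx.
have xw : w <= x by rewrite ge_min lexx orbT.
pose H (t : R) := - (Phi t - density t / - x).
have dH (t : R) : is_derive t 1 H (- density t - t * density t / - x).
  have := is_derive_Phi t; have := is_derive_density t => ? ?.
  by rewrite /H; apply: is_derive_eq; rewrite !scaler0 /GRing.scale /=; ring.
have HH : H w <= H x.
  apply: (derive_mono xw dH) => t /andP[_ xt].
  rewrite addrC subr_ge0 -!mulNr mulrAC -[leLHS]mul1r ler_pM2r ?density_gt0 //.
  by rewrite ler_pdivlMr // mul1r lerN2.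
rewrite /H lerN2 in HH.
apply: le_trans HH _; apply: ltW; apply: le_lt_trans (hw _ w0w).
by rewrite gerDl oppr_le0 divr_ge0 ?(ltW (density_gt0 _)) // ltW.
Qed.

Lemma Phi_lip x y : x <= y -> Phi y - Phi x <= y - x.
Proof.
move=> xy.
have d1 t : density t <= 1.
  rewrite -normal_pdf_density; apply: le_trans (normal_pdf_ub _ _ _) _; rewrite ?oner_eq0 //.
  have s0 : (1 : R) <= Num.sqrt (1 ^+ 2 * pi *+ 2).
    rewrite expr1n mul1r -[leLHS]sqrtr1 ler_sqrt; last by rewrite mulrn_wge0 // pi_ge0.
    by have := pi_ge2 R; rewrite mulr2n; lra.
  by rewrite /normal_peak invf_le1 // (lt_le_trans ltr01).
pose H (t : R) := t - Phi t.
have dH (t : R) : is_derive t 1 H (1 - density t).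
  by have := is_derive_Phi t => ?; rewrite /H; apply: is_derive_eq.
have HH : H x <= H y by apply: (derive_mono xy dH) => t _; rewrite subr_ge0.
by rewrite /H in HH; lra.
Qed.

(** The two Mills ratios. They solve [u' = x u + 1] and [u' = x u - 1] respectively, and the Stein
    solution glues multiples of them at the level. *)
Definition stein_left x : R := Phi x * recip_density x.
Definition stein_right x : R := (1 - Phi x) * recip_density x.

Let is_derive_left x : is_derive x 1 stein_left (1 + x * stein_left x).
Proof.
have := is_derive_Phi x; have := is_derive_recip_density x => ? ?.
rewrite /stein_left; apply: is_derive_eq; rewrite /GRing.scale /= -(densityK x); ring.
Qed.

Let is_derive_right x : is_derive x 1 stein_right (- 1 + x * stein_right x).
Proof.
have := is_derive_Phi x; have := is_derive_recip_density x => ? ?.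
rewrite /stein_right; apply: is_derive_eq; rewrite /GRing.scale /=.
by rewrite add0r mul1r mulrN [recip_density x * density x]mulrC densityK; ring.
Qed.

Let left_ge0 x : 0 <= stein_left x.
Proof. by rewrite mulr_ge0 ?Phi_ge0 // ltW // recip_density_gt0. Qed.

Let right_ge0 x : 0 <= stein_right x.
Proof. by rewrite mulr_ge0 ?subr_ge0 ?Phi_le1 // ltW // recip_density_gt0. Qed.

Let left_mul x : x <= 0 -> - x * stein_left x <= 1.
Proof.
rewrite le_eqVlt => /orP[/eqP ->|x0]; first by rewrite oppr0 mul0r.
by rewrite mulrA -[leRHS](densityK x) ler_pM2r ?recip_density_gt0 // mills_left.
Qed.

Let right_mul x : 0 <= x -> x * stein_right x <= 1.
Proof.
rewrite le_eqVlt => /orP[/eqP <-|x0]; first by rewrite mul0r.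
by rewrite mulrA -[leRHS](densityK x) ler_pM2r ?recip_density_gt0 // mills_right.
Qed.

(** Bounds each Mills ratio on its decaying side: by 1 where [|x| >= 1], from the Mills inequality,
    and by [1 / density 1] where [|x| <= 1]. *)
Definition stein_cst : R := recip_density 1 + 1.

Let recip_le x : x ^+ 2 <= 1 -> recip_density x <= recip_density 1.
Proof.
move=> x1; rewrite ler_pM2l; last by rewrite invr_gt0; exact: peak_gt0.
by rewrite ler_expR ler_pM2r ?invr_gt0 // expr1n.
Qed.

Let left_le x : x <= 0 -> stein_left x <= stein_cst.
Proof.
move=> x0; have r1 := ltW (recip_density_gt0 1); have l0 := left_ge0 x.
have [x1|x1] := leP x (- 1).
  by have := left_mul x0; rewrite /stein_cst; nra.
have hr : recip_density x <= recip_density 1 by apply: recip_le; nra.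
have := Phi_le1 x; have := Phi_ge0 x; have := ltW (recip_density_gt0 x).
by rewrite /stein_cst /stein_left; nra.
Qed.

Let right_le x : 0 <= x -> stein_right x <= stein_cst.
Proof.
move=> x0; have r1 := ltW (recip_density_gt0 1); have l0 := right_ge0 x.
have [x1|x1] := leP 1 x.
  by have := right_mul x0; rewrite /stein_cst; nra.
have hr : recip_density x <= recip_density 1 by apply: recip_le; nra.
have := Phi_le1 x; have := Phi_ge0 x; have := ltW (recip_density_gt0 x).
by rewrite /stein_cst /stein_right; nra.
Qed.

Section Solution.
Variable z : R.

Definition stein x : R :=
  if x <= z then stein_left x * (1 - Phi z) else stein_right x * Phi z.

Definition steinD x : R := x * stein x + (x <= z)%R%:R - Phi z.

Let steinE_left x : x <= z -> stein x = stein_left x * (1 - Phi z).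
Proof. by rewrite /stein => ->. Qed.

Let steinE_right x : z <= x -> stein x = stein_right x * Phi z.
Proof.
rewrite /stein; case: (leP x z) => // xz zx.
have -> : x = z by apply/eqP; rewrite eq_le xz zx.
by rewrite /stein_left /stein_right; ring.
Qed.

(** The branch of [stein] is decided by [z], but the decay of a Mills ratio depends on the sign of
    [x]. Monotonicity of [Phi] bounds either branch by either ratio, so the resulting bounds are
    uniform in [z]. *)
Let stein_envelope x : 0 <= stein x /\
  (x <= 0 -> stein x <= stein_left x) /\ (0 <= x -> stein x <= stein_right x).
Proof.
have p0 := Phi_ge0 z; have p1 := Phi_le1 z; have l0 := left_ge0 x; have r0 := right_ge0 x.
have q0 := ltW (recip_density_gt0 x).
have [xz|/ltW zx] := leP x z.
  rewrite steinE_left //; split; first by rewrite mulr_ge0 ?subr_ge0.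
  split=> x0; first by nra.
  rewrite /stein_left /stein_right mulrAC ler_wpM2r //.
  have := Phi_mono xz; have := Phi_le1 x; have := Phi_ge0 x; nra.
rewrite steinE_right //; split; first by rewrite mulr_ge0.
split=> x0; last by nra.
rewrite /stein_left /stein_right mulrAC ler_wpM2r //.
have := Phi_mono zx; have := Phi_le1 x; have := Phi_ge0 x; nra.
Qed.

Lemma stein_bounded x : `|stein x| <= stein_cst.
Proof.
have [s0 [sl sr]] := stein_envelope x; rewrite ger0_norm //.
have [x0|/ltW x0] := leP x 0.
  exact: le_trans (sl x0) (left_le x0).
exact: le_trans (sr x0) (right_le x0).
Qed.

Lemma stein_mul_bounded x : `|x * stein x| <= 1.
Proof.
have [s0 [sl sr]] := stein_envelope x; rewrite normrM (ger0_norm s0).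
have [x0|/ltW x0] := leP x 0.
  rewrite ler0_norm //; apply: le_trans (left_mul x0).
  by rewrite ler_wpM2l ?oppr_ge0 // sl.
rewrite ger0_norm //; apply: le_trans (right_mul x0).
by rewrite ler_wpM2l // sr.
Qed.

Lemma steinD_bounded x : `|steinD x| <= 2.
Proof.
have := stein_mul_bounded x; have := Phi_ge0 z; have := Phi_le1 z.
rewrite /steinD; move: (x * stein x) => t.
by case: (x <= z); rewrite !ler_norml /=; lra.
Qed.

(* On either closed side of [z] the solution is a smooth function. *)
Let stein_mvt x y : x < y -> y <= z \/ z <= x ->
  exists2 c, x < c < y & stein y - stein x = steinD c * (y - x).
Proof.
move=> xy [yz|zx].
  pose F (t : R) := stein_left t * (1 - Phi z).
  have dF (t : R) : is_derive t 1 F ((1 + t * stein_left t) * (1 - Phi z)).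
    have := is_derive_left t => ?; rewrite /F; apply: is_derive_eq.
    by rewrite scaler0 add0r /GRing.scale /= mulrC.
  have cF : {within `[x, y], continuous F}.
    by apply: derivable_within_continuous => t _; apply: ex_derive.
  have [c] := MVT xy (fun t _ => dF t) cF; rewrite in_itv /= => /andP[xc cy] E.
  have cz : c <= z by apply: le_trans yz; exact: ltW.
  exists c; first by rewrite xc cy.
  rewrite !steinE_left //; last by apply: le_trans yz; exact: ltW.
  by rewrite -[LHS]/(F y - F x) E /steinD cz steinE_left // -[true%:R]/(1 : R); ring.
pose F (t : R) := stein_right t * Phi z.
have dF (t : R) : is_derive t 1 F ((- 1 + t * stein_right t) * Phi z).
  have := is_derive_right t => ?; rewrite /F; apply: is_derive_eq.
  by rewrite scaler0 add0r /GRing.scale /= mulrC.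
have cF : {within `[x, y], continuous F}.
  by apply: derivable_within_continuous => t _; apply: ex_derive.
have [c] := MVT xy (fun t _ => dF t) cF; rewrite in_itv /= => /andP[xc cy] E.
have zc : z < c by apply: le_lt_trans xc.
exists c; first by rewrite xc cy.
rewrite !steinE_right //; last by apply: le_trans zx _; exact: ltW.
rewrite -[LHS]/(F y - F x) E /steinD (leNgt c) zc steinE_right ?(ltW zc) //.
rewrite -[(~~ true)%:R]/(0 : R); ring.
Qed.

Let stein_lip_side x y : x < y -> y <= z \/ z <= x -> `|stein y - stein x| <= 2 * (y - x).
Proof.
move=> xy side; have [c _ ->] := stein_mvt xy side.
by rewrite normrM (ger0_norm (_ : 0 <= y - x)) ?subr_ge0 ?(ltW xy) // ler_wpM2r ?subr_ge0 ?(ltW xy) ?steinD_bounded.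
Qed.

Lemma stein_lip x y : `|stein x - stein y| <= 2 * `|x - y|.
Proof.
wlog xy : x y / x < y.
  move=> H; case: (ltgtP x y) => [/H//|/H|->]; last by rewrite !subrr normr0 mulr0.
  by rewrite distrC (distrC y).
rewrite distrC (distrC x) (ger0_norm (_ : 0 <= y - x)) ?subr_ge0 ?(ltW xy) //.
have [yz|zy] := leP y z; first by apply: stein_lip_side => //; left.
have [zx|xz] := leP z x; first by apply: stein_lip_side => //; right.
have h1 := stein_lip_side xz (or_introl (lexx z)).
have h2 := stein_lip_side zy (or_intror (lexx z)).
rewrite -[stein y - _](subrKA (stein z)).
by apply: le_trans (ler_normD _ _) _; lra.
Qed.

(** Within [r] of [z] the Lipschitz bound suffices, at the price of the indicator. Otherwise [x] and
    [x - s] lie on one side of [z], so the intermediate point [c] has the same indicator as [x]; it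
    cancels in [steinD c - steinD x], leaving [(c - x) stein c + x (stein c - stein x)], of order
    [r (1 + |x|)]. *)
Lemma stein_expansion x s (r : R) : `|s| <= r ->
  `|stein x - stein (x - s) - s * steinD x|
  <= (stein_cst + 4) * r * (r * (1 + `|x|) + (`|x - z| <= r)%R%:R).
Proof.
move=> sr; have c0 : 0 <= stein_cst by apply: le_trans (stein_bounded 0).
have r0 : 0 <= r by apply: le_trans sr.
have x0 := normr_ge0 x.
have crude : `|stein x - stein (x - s) - s * steinD x| <= 4 * `|s|.
  apply: le_trans (ler_normB _ _) _.
  have := stein_lip x (x - s); rewrite subKr => h1.
  have := steinD_bounded x => h2; have := normr_ge0 s => s0.
  by rewrite normrM; nra.
have [xz|xz] := boolP (`|x - z| <= r).
  apply: le_trans crude _; rewrite /= -mulrA.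
  have : 0 <= r * (r * (1 + `|x|)) by rewrite !mulr_ge0 // addr_ge0.
  by nra.
rewrite addr0; rewrite -ltNge in xz.
have [->|s0] := eqVneq s 0.
  rewrite subr0 subrr mul0r subrr normr0.
  exact: (mulr_ge0 (mulr_ge0 (addr_ge0 c0 (ler0n _ 4)) r0) (mulr_ge0 r0 (addr_ge0 ler01 x0))).
have side : (x <= z /\ x - s <= z) \/ (z < x /\ z < x - s).
  by move: xz sr; rewrite ltr_normr ler_norml => /orP[] ? /andP[? ?]; [right|left]; split; lra.
have [c cx E] : exists2 c, `|c - x| <= `|s| /\ ((x <= z) = (c <= z)) &
    stein x - stein (x - s) = s * steinD c.
  have [sp|sn] := ltP 0 s.
    have xs : x - s < x by rewrite ltrBlDr ltrDl.
    have [|c /andP[c1 c2] E] := stein_mvt xs.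
      by case: side => -[? ?]; [left|right] => //; exact: ltW.
    exists c; last by rewrite E mulrC; congr (_ * _); ring.
    split; first by rewrite (gtr0_norm sp) ler_norml; lra.
    by case: side => -[h1 h2]; [rewrite h1 (le_trans (ltW c2)) | rewrite !leNgt h1 (lt_trans h2)].
  have sn' : s < 0 by rewrite lt_neqAle s0.
  have xs : x < x - s by rewrite ltrBrDr gtrDl.
  have [|c /andP[c1 c2] E] := stein_mvt xs.
    by case: side => -[? ?]; [left|right] => //; exact: ltW.
  exists c; last by rewrite -[LHS]opprB E -mulrN mulrC; congr (_ * _); ring.
  split; first by rewrite (ltr0_norm sn') ler_norml; lra.
  by case: side => -[h1 h2]; [rewrite h1 (le_trans (ltW c2)) | rewrite !leNgt h1 (lt_trans h1)].
case: cx => cs cz; rewrite E -mulrBr normrM.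
have -> : steinD c - steinD x = (c - x) * stein c + x * (stein c - stein x).
  by rewrite /steinD cz; ring.
have k1 : `|(c - x) * stein c + x * (stein c - stein x)| <= r * (stein_cst + 2 * `|x|).
  apply: le_trans (ler_normD _ _) _; rewrite !normrM mulrDr.
  apply: lerD; first by apply: ler_pM => //; [exact: le_trans cs sr | exact: stein_bounded].
  rewrite [leLHS]mulrC; apply: le_trans (_ : 2 * r * `|x| <= _).
    rewrite ler_wpM2r //; apply: le_trans (stein_lip _ _) _.
    by rewrite ler_wpM2l // (le_trans cs).
  by rewrite le_eqVlt; apply/orP; left; apply/eqP; ring.
apply: le_trans (ler_pM (normr_ge0 _) (normr_ge0 _) sr k1) _.
rewrite -!mulrA; have -> : (stein_cst + 4) * (r * (r * (1 + `|x|))) =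
  r * (r * (stein_cst + 2 * `|x|)) + r * (r * (stein_cst * `|x| + 2 * `|x| + 4)) by ring.
rewrite lerDl; apply: mulr_ge0 => //; apply: mulr_ge0 => //.
by rewrite !addr_ge0 ?mulr_ge0.
Qed.
End Solution.

End NormalDistribution.

(** * Discretisation *)

Section RealExpectation.
Context {dsp : measure_display} {T : measurableType dsp} {R : realType}.
Variable P : probability T R.

Definition integ (f : T -> R) : Prop := P.-integrable [set: T] (EFin \o f).
Definition Er (f : T -> R) : R := \int[P]_t f t.

Lemma integ_measurable f : integ f -> measurable_fun [set: T] f.
Proof. by move=> /measurable_int /measurable_EFinP. Qed.

Lemma integ_le (f k : T -> R) : measurable_fun [set: T] f -> integ k ->
  (forall t, `|f t| <= k t) -> integ f.
Proof.
move=> mf ik fk; apply: (le_integrable _ _ _ ik) => //; first exact/measurable_EFinP.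
by move=> t _ /=; rewrite lee_fin; apply: le_trans (fk t) (ler_norm _).
Qed.

Lemma integ_cst c : integ (fun=> c).
Proof. exact: finite_measure_integrable_cst. Qed.

Lemma integD f k : integ f -> integ k -> integ (fun t => f t + k t).
Proof. by move=> fi ki; exact: (integrableD measurableT fi ki). Qed.

Lemma integZl c f : integ f -> integ (fun t => c * f t).
Proof. by move=> fi; exact: (integrableZl measurableT c fi). Qed.

Lemma integB f k : integ f -> integ k -> integ (fun t => f t - k t).
Proof. by move=> fi ki; exact: (integrableB measurableT fi ki). Qed.

Lemma integ_norm f : integ f -> integ (fun t => `|f t|).
Proof. by move=> fi; exact: (integrable_norm fi). Qed.

Lemma integ_sum (J : finType) (Q : pred J) (F : J -> T -> R) :
  (forall j, Q j -> integ (F j)) -> integ (fun t => \sum_(j | Q j) F j t).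
Proof.
move=> Fi; rewrite (_ : (fun t => _) = \sum_(j | Q j) F j); last first.
  by apply/funext => t; rewrite fct_sumE.
elim/big_ind: _ => //; first exact: (integ_cst 0).
by move=> f k fi ki; exact: integD.
Qed.

Lemma ErD f k : integ f -> integ k -> Er (fun t => f t + k t) = Er f + Er k.
Proof. by move=> fi ki; exact: RintegralD. Qed.

Lemma ErB f k : integ f -> integ k -> Er (fun t => f t - k t) = Er f - Er k.
Proof. by move=> fi ki; exact: RintegralB. Qed.

Lemma ErZl c f : integ f -> Er (fun t => c * f t) = c * Er f.
Proof. by move=> fi; exact: RintegralZl. Qed.

Lemma fine_expectation f : fine ('E_P[f])%E = Er f.
Proof. by rewrite unlock. Qed.

Lemma Er_cst c : Er (fun=> c) = c.
Proof. by rewrite -fine_expectation (expectation_cst P). Qed.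

Lemma Er_sum (J : finType) (Q : pred J) (F : J -> T -> R) :
  (forall j, Q j -> integ (F j)) ->
  Er (fun t => \sum_(j | Q j) F j t) = \sum_(j | Q j) Er (F j).
Proof.
move=> Fi; pose F' j := if Q j then F j else fun=> 0.
have Fi' j : integ (F' j) by rewrite /F'; case: ifP => [/Fi//|_]; exact: integ_cst.
rewrite [RHS]big_mkcond (_ : (fun t => _) = fun t => \sum_j F' j t); last first.
  by apply/funext => t; rewrite big_mkcond; apply: eq_bigr => j _; rewrite /F'; case: ifP.
have -> : \sum_j (if Q j then Er (F j) else 0) = \sum_j Er (F' j).
  by apply: eq_bigr => j _; rewrite /F'; case: ifP => // _; rewrite Er_cst.
move: (index_enum J) => s; elim: s => [|j s IH].
  by under eq_fun do rewrite big_nil; rewrite big_nil Er_cst.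
under eq_fun do rewrite big_cons; rewrite big_cons -IH ErD //.
rewrite (_ : (fun t => _) = \sum_(i <- s) F' i); last by apply/funext => t; rewrite fct_sumE.
elim/big_ind: _ => //; first exact: (integ_cst 0).
by move=> f k fi ki; exact: integD.
Qed.

Lemma le_Er f k : integ f -> integ k -> (forall t, f t <= k t) -> Er f <= Er k.
Proof. by move=> fi ki fk; apply: le_Rintegral. Qed.

Lemma norm_Er f : integ f -> `|Er f| <= Er (fun t => `|f t|).
Proof. by move=> fi; apply: le_normr_Rintegral. Qed.

Lemma Er_indic (B : T -> bool) : measurable [set t | B t] ->
  integ (fun t => (B t)%:R) /\ Er (fun t => (B t)%:R) = fine (P [set t | B t]).
Proof.
move=> mB; have -> : (fun t => (B t)%:R) = \1_[set t | B t] :> (T -> R).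
  by apply/funext => t; rewrite indicE mem_setE.
split; first exact: integrable_indic.
by rewrite /Er /Rintegral integral_indic // setIT.
Qed.

Section FiniteImage.
Context {O : finType} (key : T -> O).
Hypothesis key_meas : forall o, measurable [set t | key t == o].

Definition law (o : O) : R := fine (P [set t | key t == o]).

Lemma law_ge0 o : 0 <= law o.
Proof. exact: fine_ge0. Qed.

(** The bridge between the two calculi: integrals of functions of a finite-valued map are sums [Ex]
    over its law. *)
Lemma key_expectation (G : O -> R) :
  integ (fun t => G (key t)) /\ Er (fun t => G (key t)) = Ex law G.
Proof.
have E : (fun t => G (key t)) = fun t => \sum_o G o * (key t == o)%:R.
  apply/funext => t; rewrite (bigD1 (key t)) //= eqxx mulr1 big1 ?addr0 // => o.
  by rewrite eq_sym => /negbTE ->; rewrite mulr0.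
have I o : integ (fun t => G o * (key t == o)%:R).
  by apply: integZl; case: (Er_indic (key_meas o)).
rewrite E; split; first exact: integ_sum.
rewrite Er_sum //; apply: eq_bigr => o _.
by have [i1 i2] := Er_indic (key_meas o); rewrite ErZl // i2 mulrC.
Qed.

Lemma law_sum1 : \sum_o law o = 1.
Proof.
have [_] := key_expectation (fun=> 1); rewrite Er_cst /Ex => ->.
by apply: eq_bigr => o _; rewrite mulr1.
Qed.

Lemma key_pred_measurable (Q : pred O) : measurable [set t | Q (key t)].
Proof.
have [i _] := key_expectation (fun o => (Q o)%:R).
have := integ_measurable i measurableT (measurable_set1 (1 : R)).
rewrite setTI; congr measurable; apply/seteqP; split => t /=.
  by case: (Q _) => //= /eqP; rewrite eq_sym oner_eq0.
by move=> ->.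
Qed.

Lemma law_pred (Q : pred O) : \sum_(o | Q o) law o = fine (P [set t | Q (key t)]).
Proof.
have [_ <-] := Er_indic (key_pred_measurable Q).
have [_ ->] := key_expectation (fun o => (Q o)%:R); rewrite /Ex big_mkcond.
by apply: eq_bigr => o _; case: (Q o); rewrite ?mulr1 ?mulr0.
Qed.

End FiniteImage.

End RealExpectation.

(** * Truncation and rounding of a real number *)

Section Rounding.
Context {R : realType} (tau h : R) (L : nat).
Hypothesis h_gt0 : 0 < h.
Hypothesis tau_ge0 : 0 <= tau.
Hypothesis tauL : tau <= L%:R * h.

(* A sign and a multiple of [h]; values beyond [tau] are sent to [0]. *)
Definition cell (x : R) : bool * 'I_L.+1 :=
  (x < 0, inord (if `|x| <= tau then Num.truncn (`|x| / h) else 0)).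

Definition cell_value (c : bool * 'I_L.+1) : R :=
  (if c.1 then -1 else 1) * ((c.2 : nat)%:R * h).

Let round (x : R) := cell_value (cell x).

Let trunc_itv (x : R) : (Num.truncn (`|x| / h))%:R * h <= `|x| < (Num.truncn (`|x| / h)).+1%:R * h.
Proof.
have : 0 <= `|x| / h by rewrite divr_ge0 // ltW.
by move=> /truncn_itv; rewrite ler_pdivlMr // ltr_pdivrMr.
Qed.

Let trunc_le (x : R) : `|x| <= tau -> (Num.truncn (`|x| / h) < L.+1)%N.
Proof.
move=> xt; rewrite ltnS -(ler_nat R) -(ler_pM2r h_gt0).
by have /andP[k _] := trunc_itv x; apply: le_trans k _; apply: le_trans xt _.
Qed.

Lemma cell_value_in (x : R) : `|x| <= tau ->
  round x = (if x < 0 then -1 else 1) * ((Num.truncn (`|x| / h))%:R * h).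
Proof. by move=> xt; rewrite /round /cell /cell_value xt inordK ?trunc_le. Qed.

Lemma cell_value_out (x : R) : tau < `|x| -> round x = 0.
Proof. by move=> xt; rewrite /round /cell /cell_value leNgt xt inordK // mul0r mulr0. Qed.

Let norm_sign (b : bool) (y : R) : `|(if b then -1 else 1) * y| = `|y|.
Proof. by case: b; rewrite ?mul1r // mulN1r normrN. Qed.

(** Rounding is towards 0, so it increases no absolute moment. *)
Lemma cell_value_le (x : R) : `|cell_value (cell x)| <= `|x|.
Proof.
rewrite -/(round x); have [xt|xt] := leP `|x| tau; last by rewrite cell_value_out // normr0.
rewrite cell_value_in // norm_sign ger0_norm; last by rewrite mulr_ge0 // ltW.
by have /andP[] := trunc_itv x.
Qed.

Lemma cell_value_bdd (x : R) : `|cell_value (cell x)| <= tau.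
Proof.
have [xt|xt] := leP `|x| tau; first by apply: le_trans (cell_value_le x) xt.
by rewrite -/(round x) cell_value_out // normr0.
Qed.

Lemma cell_value_close (x : R) : `|x| <= tau -> `|x - cell_value (cell x)| <= h.
Proof.
move=> xt; rewrite -/(round x) cell_value_in //.
have /andP[k1 k2] := trunc_itv x; rewrite -natr1 mulrDl mul1r in k2.
case: (ltP x 0) k1 k2 => x0.
  rewrite (ltr0_norm x0); move: (_ * h) => y k1 k2; rewrite mulN1r ler_norml; lra.
rewrite (ger0_norm x0) mul1r; move: (_ * h) => y k1 k2; rewrite ler_norml; lra.
Qed.

Lemma cell_value_lattice c : exists m : int, cell_value c = m%:~R * h.
Proof.
exists (if c.1 then - (c.2 : nat)%:Z else (c.2 : nat)%:Z); rewrite /cell_value.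
by case: c.1; rewrite ?mul1r // mulN1r mulrNz mulNr.
Qed.

(** Describes a cell by comparisons alone, which makes it visibly measurable. *)
Lemma cellE (x : R) c : (cell x == c) = ((x < 0) == c.1) &&
  ((`|x| <= tau) && ((c.2 : nat)%:R * h <= `|x|) && (`|x| < (c.2.+1)%:R * h)
   || ~~ (`|x| <= tau) && (c.2 == 0 :> nat)).
Proof.
case: c => b m; rewrite /cell xpair_eqE /=; congr (_ && _).
have [xt|xt] /= := boolP (`|x| <= tau).
  rewrite orbF -(inj_eq val_inj) /= inordK ?trunc_le //.
  apply/eqP/andP => [<-|[k1 k2]]; first by apply/andP; exact: trunc_itv.
  apply/eqP; rewrite eqn_leq -ltnS -(ltr_nat R) -[X in _ && X]ltnS -(ltr_nat R (m : nat)).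
  rewrite -(ltr_pM2r h_gt0) -[X in _ && X](ltr_pM2r h_gt0).
  by have /andP[k3 k4] := trunc_itv x; rewrite (le_lt_trans k3 k2) (le_lt_trans k1 k4).
by rewrite -(inj_eq val_inj) /= inordK // eq_sym.
Qed.

Lemma measurable_cell c : measurable [set x : R | cell x == c].
Proof.
have -> : [set x : R | cell x == c] = (fun x => cell x == c) @^-1` [set true].
  by apply/seteqP; split => x /=.
have mn : measurable_fun [set: R] (fun x : R => `|x|) by exact: normr_measurable.
have mt : measurable_fun [set: R] (fun x : R => `|x| <= tau).
  exact: measurable_fun_ler.
rewrite -[X in measurable X]setTI; apply: (_ : measurable_fun setT _) => //.
rewrite (_ : (fun x => _) = (fun x : R => ((x < 0) == c.1) &&
  ((`|x| <= tau) && ((c.2 : nat)%:R * h <= `|x|) && (`|x| < (c.2.+1)%:R * h)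
   || ~~ (`|x| <= tau) && (c.2 == 0 :> nat)))); last by apply/funext => x; rewrite cellE.
apply: measurable_and.
  have m0 : measurable_fun [set: R] (fun x : R => x < 0) by exact: measurable_fun_ltr.
  case: c.1.
    by rewrite (_ : (fun x => _) = (fun x : R => x < 0)) //; apply/funext => x; rewrite eqb_id.
  rewrite (_ : (fun x => _) = (fun x : R => ~~ (x < 0))); first exact: measurable_neg.
  by apply/funext => x; case: (x < 0).
apply: measurable_or; last by apply: measurable_and => //; exact: measurable_neg.
apply: measurable_and; first by apply: measurable_and => //; exact: measurable_fun_ler.
exact: measurable_fun_ltr.
Qed.

End Rounding.

(** * The rounded field inherits the dependency graph *)

Section Discretisation.
Context {dsp : measure_display} {T : measurableType dsp} {R : realType}.
Variables (P : probability T R) (I : finType) (e : rel I) (X : I -> {RV P >-> R}).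
Variables (sg tau h : R) (L : nat).
Hypothesis h_gt0 : 0 < h.
Hypothesis tau_lattice : tau = L%:R * h.
Let tauL : tau <= L%:R * h. Proof. by rewrite tau_lattice. Qed.

Let O : finType := {ffun I -> bool * 'I_L.+1}.

Definition key (t : T) : O := [ffun i => cell tau h L (X i t / sg)].
Definition rounded (i : I) (o : O) : R := cell_value h (o i).

Let c0 : bool * 'I_L.+1 := (false, ord0).

(** Coordinates off [A] are reset to a fixed cell, which gives a canonical representative of what
    [A] sees of [o]; expectations are partitioned over these finitely many representatives. *)
Definition restrict (A : {set I}) (o : O) : O := [ffun i => if i \in A then o i else c0].

Let measurable_scaled_cell c : measurable [set x : R | cell tau h L (x / sg) == c].
Proof.
have m : measurable_fun [set: R] (fun x : R => x / sg) by exact: mulrr_measurable.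
have := m measurableT _ (measurable_cell h_gt0 tauL c).
by rewrite setTI.
Qed.

(** Independence is assumed for generated sigma-algebras; membership of these events is what
    transfers it to the finite space. *)
Lemma restrict_sigma (A : {set I}) (a : O) :
  sigma_family X A [set t | restrict A (key t) == a].
Proof.
pose G := \bigcup_(i in [set` A]) preimage_set_system setT (X i) measurable.
pose F i := [set t : T | restrict A (key t) i == a i].
have -> : [set t | restrict A (key t) == a] = \bigcap_(i in [set: I]) F i.
  apply/seteqP; split => t /=; first by move=> /eqP oa i _; rewrite /F /= oa eqxx.
  by move=> H; apply/eqP/ffunP => i; apply/eqP; exact: (H i Logic.I).
rewrite /sigma_family.
have : @measurable _ (g_sigma_algebraType G) (\bigcap_(i in [set: I]) F i).
  apply: fin_bigcap_measurable => // i _.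
  have [iA|iA] := boolP (i \in A); last first.
    rewrite /F; under eq_set do rewrite /restrict ffunE (negbTE iA).
    case: (c0 == a i); first by rewrite (_ : [set _ | _] = setT) //; apply/seteqP.
    by rewrite (_ : [set _ | _] = set0) //; apply/seteqP; split.
  apply: sub_gen_smallest; exists i => //=.
  exists [set x : R | cell tau h L (x / sg) == a i]; first exact: measurable_scaled_cell.
  rewrite setTI /F; apply/seteqP; split => t /=; by rewrite /restrict !ffunE iA.
by [].
Qed.

Lemma measurable_key o : measurable [set t | key t == o].
Proof.
have -> : [set t | key t == o] = \bigcap_(i in [set: I]) (X i @^-1` [set x : R | cell tau h L (x / sg) == o i]).
  apply/seteqP; split => t /=; first by move=> /eqP <- i _ /=; rewrite ffunE.
  by move=> H; apply/eqP/ffunP => i; apply/eqP; rewrite ffunE; exact: (H i Logic.I).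
apply: fin_bigcap_measurable => // i _; rewrite -[X in measurable X]setTI.
by apply: measurable_funPT => //; exact: measurable_scaled_cell.
Qed.

Let p := law P key.

Lemma Ex_restrict (A : {set I}) (F : O -> R) : dep rounded A F ->
  Ex p F = \sum_a F a * \sum_(o | restrict A o == a) p o.
Proof.
move=> dF; have FE o : F o = F (restrict A o).
  by apply: dF => i iA; rewrite /rounded ffunE iA.
rewrite /Ex (partition_big (restrict A) xpredT) //=; apply: eq_bigr => a _.
by rewrite mulr_sumr; apply: eq_bigr => o /eqP oa; rewrite FE oa mulrC.
Qed.

Lemma discretised_local_field : dependency_graph e X -> (1 <= max_degree e)%N ->
  tau = ((max_degree e).+1 ^ 4)%:R^-1 ->
  local_field p (closed_nbhd e) (max_degree e).+1 rounded.
Proof.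
move=> [[esym eirr] indep] deg tauE.
have mk := measurable_key.
split=> //.
- exact: law_ge0.
- exact: law_sum1.
- by move=> i; rewrite /closed_nbhd setU11.
- by move=> i j; rewrite /closed_nbhd !inE eq_sym esym.
- move=> i; rewrite /closed_nbhd; apply: leq_trans (leq_card_setU _ _) _.
  by rewrite cards1 add1n ltnS /max_degree (leq_bigmax i).
- move=> A B F G AB dF dG.
  have FE o : F o = F (restrict A o) by apply: dF => i iA; rewrite /rounded ffunE iA.
  have GE o : G o = G (restrict B o) by apply: dG => i iB; rewrite /rounded ffunE iB.
  rewrite (Ex_restrict dF) (Ex_restrict dG) mulr_suml.
  rewrite /Ex (partition_big (restrict A) xpredT) //=; apply: eq_bigr => a _.
  rewrite -mulrA (partition_big (restrict B) xpredT) //= mulrCA mulr_sumr mulr_sumr.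
  apply: eq_bigr => b _.
  transitivity (\sum_(o | (restrict A o == a) && (restrict B o == b)) p o * (F a * G b)).
    by apply: eq_bigr => o /andP[/eqP oa /eqP ob]; rewrite FE GE oa ob.
  rewrite -mulr_suml !law_pred //.
  have -> : [set t | (restrict A (key t) == a) && (restrict B (key t) == b)] =
      [set t | restrict A (key t) == a] `&` [set t | restrict B (key t) == b].
    by apply/seteqP; split => t /= => [/andP[]|[-> ->]].
  have disj : [disjoint A & B]%B.
    rewrite disjoint_subset; apply/fintype.subsetP => i iA; rewrite inE; apply/negP => iB.
    by have := AB i i iA iB; rewrite /closed_nbhd setU11.
  have nadj i j : i \in A -> j \in B -> ~~ e i j.
    move=> iA jB; have := AB i j iA jB; rewrite /closed_nbhd !inE negb_or.
    by case/andP.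
  rewrite (indep A B disj nadj _ _ (@restrict_sigma A a) (@restrict_sigma B b)).
  rewrite fineM ?fin_num_measure //; first 1 last.
  + exact: (key_pred_measurable P mk (fun o => restrict A o == a)).
  + exact: (key_pred_measurable P mk (fun o => restrict B o == b)).
  by ring.
(* The bound is required at every point, also at those of probability 0. It holds because the
   largest index gives exactly [L h = tau]. *)
- move=> i o; rewrite -tauE tau_lattice /rounded /cell_value.
  have : ((o i).2 : nat)%:R * h <= L%:R * h by rewrite ler_pM2r // ler_nat -ltnS.
  move=> k; case: (o i).1; rewrite ?mul1r ?mulN1r ?normrN ger0_norm //;
  by rewrite mulr_ge0 // ltW.
Qed.

End Discretisation.

(** * Moments of the variables divided by [sigma] *)

Section MomentTransfer.
Context {dsp : measure_display} {T : measurableType dsp} {R : realType}.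
Variables (P : probability T R) (I : finType) (e : rel I) (X : I -> {RV P >-> R}).
Hypothesis centred : forall i, ('E_P[X i] = 0)%E.
Hypothesis sigma2_bounds : (0 < sigma2 e X < +oo)%E.
Hypothesis gamma_fin : (gamma e X < +oo)%E.
Let nb := closed_nbhd e.
Let sg := sigma e X.
Let x i t : R := X i t / sg.
Let g := fine (gamma e X).

Lemma sigma_gt0 : 0 < sg.
Proof.
rewrite /sg /sigma sqrtr_gt0; apply: fine_gt0; exact: sigma2_bounds.
Qed.

Let measurable_x i : measurable_fun [set: T] (x i).
Proof. by apply: measurable_funM => //; exact: measurable_cst. Qed.

Let cube_ge0 i t : 0 <= `|x i t| ^+ 3.
Proof. by rewrite exprn_ge0. Qed.

Let measurable_cube i : measurable_fun [set: T] (fun t => `|x i t| ^+ 3).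
Proof. by apply: measurable_funX; exact: measurableT_comp. Qed.

Let gamma_term_ge0 i : (0 <= 'E_P[fun t => (`|x i t| ^+ 3)%R])%E.
Proof. by apply: expectation_ge0 => t; exact: cube_ge0. Qed.

Let gamma_term_fin i : ('E_P[fun t => (`|x i t| ^+ 3)%R] < +oo)%E.
Proof.
apply: le_lt_trans gamma_fin; rewrite /gamma (bigD1 i) //=.
by apply: leeDl; apply: sume_ge0 => j _; exact: gamma_term_ge0.
Qed.

Lemma integ_cube i : integ P (fun t => `|x i t| ^+ 3).
Proof.
apply/integrableP; split; first exact/measurable_EFinP/measurable_cube.
apply: le_lt_trans (gamma_term_fin i); rewrite unlock.
by under eq_integral => t _ do rewrite /= ger0_norm ?cube_ge0 //.
Qed.

Lemma gammaE : g = \sum_i Er P (fun t => `|x i t| ^+ 3).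
Proof.
rewrite /g; have -> : gamma e X = (\sum_i Er P (fun t => `|x i t| ^+ 3))%:E.
  rewrite -sumEFin; apply: eq_bigr => i _; rewrite -fine_expectation fineK //.
  by rewrite ge0_fin_numE.
by [].
Qed.

Lemma g_nonneg : 0 <= g.
Proof.
rewrite gammaE; apply: sumr_ge0 => i _; rewrite -[leLHS](Er_cst P 0).
by apply: le_Er => //; [exact: integ_cst | exact: integ_cube].
Qed.

Let le_cube (a : R) : 0 <= a -> a <= 1 + a ^+ 3 /\ a ^+ 2 <= 1 + a ^+ 3.
Proof.
move=> a0; rewrite !exprS expr0 mulr1.
have [a1|a1] := leP a 1; first by split; [have : 0 <= a * (a * a) by rewrite !mulr_ge0|
  have : 0 <= a * (a * a) by rewrite !mulr_ge0]; nra.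
have a2 : 0 <= a * a - 1 by have := sqr_ge0 (a - 1); rewrite expr2; lra.
have h1 := mulr_ge0 a0 a2; have h2 : 0 <= a * a * (a - 1) by rewrite !mulr_ge0 // subr_ge0 ltW.
by split; lra.
Qed.

Lemma integ_x i : integ P (x i).
Proof.
apply: (integ_le (measurable_x i) (integD (integ_cst P 1) (integ_cube i))) => t.
by case: (le_cube (normr_ge0 (x i t))).
Qed.

Lemma Er_x i : Er P (x i) = 0.
Proof.
have := centred i; move=> /(congr1 fine); rewrite fine_expectation /= => E.
have : Er P (fun t => sg * x i t) = 0.
  rewrite -[RHS]E; congr Er; apply/funext => t; rewrite /x mulrC divfK //.
  by rewrite gt_eqF // sigma_gt0.
rewrite ErZl; last exact: integ_x.
by move/eqP; rewrite mulf_eq0 gt_eqF ?sigma_gt0 //= => /eqP.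
Qed.

Lemma integ_xx i j : integ P (fun t => x i t * x j t).
Proof.
apply: (integ_le _ (integD (integD (integ_cst P 1) (integ_cube i)) (integ_cube j))).
  exact: measurable_funM.
move=> t; rewrite normrM.
have := normr_ge0 (x i t); have := normr_ge0 (x j t).
move: `|x i t| `|x j t| => a b' b0 a0.
have [_ h1] := le_cube a0; have [_ h2] := le_cube b0.
have := sqr_ge0 (a - b'); have := exprn_ge0 3 a0; have := exprn_ge0 3 b0; lra.
Qed.

Lemma Er_xx : \sum_i \sum_(j in nb i) Er P (fun t => x i t * x j t) = 1.
Proof.
have s0 := sigma_gt0.
have I0 i : integ P (fun t => \sum_(j in nb i) x i t * x j t).
  by apply: integ_sum => j _; exact: integ_xx.
have E i : (fun t => X i t * localsum e X i t) =
    (fun t => sg ^+ 2 * \sum_(j in nb i) x i t * x j t).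
  apply/funext => t; rewrite /localsum !mulr_sumr; apply: eq_bigr => j _.
  by rewrite /x; field; rewrite gt_eqF.
have : sigma2 e X = (sg ^+ 2 * \sum_i \sum_(j in nb i) Er P (fun t => x i t * x j t))%:E.
  rewrite /sigma2 mulr_sumr -sumEFin; apply: eq_bigr => i _.
  rewrite E -Er_sum; last by move=> j _; exact: integ_xx.
  rewrite -ErZl // -fine_expectation fineK //.
  rewrite unlock; apply: integrable_fin_num => //; exact: integZl.
move=> /(congr1 fine) /=.
have -> : fine (sigma2 e X) = sg ^+ 2.
  rewrite /sg /sigma sqr_sqrtr //; apply: fine_ge0; apply: ltW.
  by case/andP: sigma2_bounds.
move=> /eqP; rewrite eq_sym -subr_eq0 -{2}[sg ^+ 2]mulr1 -mulrBr mulf_eq0.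
by rewrite sqrf_eq0 gt_eqF //= subr_eq0 => /eqP.
Qed.

End MomentTransfer.

(** * Moments of the rounded field and comparison of the two statistics *)

Section Comparison.
Context {dsp : measure_display} {T : measurableType dsp} {R : realType}.
Variables (P : probability T R) (I : finType) (e : rel I) (X : I -> {RV P >-> R}).
Hypothesis dg : dependency_graph e X.
Hypothesis centred : forall i, ('E_P[X i] = 0)%E.
Hypothesis deg : (1 <= max_degree e)%N.
Hypothesis sigma2_bounds : (0 < sigma2 e X < +oo)%E.
Hypothesis gamma_fin : (gamma e X < +oo)%E.
Variables (tau h : R) (L : nat).
Let D := (max_degree e).+1.
Hypothesis h_gt0 : 0 < h.
Hypothesis tau_lattice : tau = L%:R * h.
Hypothesis tauE : tau = (D ^ 4)%:R^-1.

Let nb := closed_nbhd e.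
Let sg := sigma e X.
Let x i t : R := X i t / sg.
Let g := fine (gamma e X).
Let n : R := #|I|%:R.
Let ky : T -> {ffun I -> bool * 'I_L.+1} := key X sg tau h L.
Let p := law P ky.
Let xi : I -> {ffun I -> bool * 'I_L.+1} -> R := rounded h (L := L).

Let D1 : 1 <= D%:R :> R. Proof. by rewrite ler1n. Qed.
Let D0 : 0 < D%:R :> R. Proof. by rewrite ltr0n. Qed.
Let n0 : 0 <= n. Proof. exact: ler0n. Qed.

Let tau_gt0 : 0 < tau.
Proof. by rewrite tauE invr_gt0 natrX exprn_gt0. Qed.

Let tau_le1 : tau <= 1.
Proof. by rewrite tauE invf_le1 ?natrX ?exprn_gt0 // exprn_ege1. Qed.

Let tauV : tau^-1 = D%:R ^+ 4.
Proof. by rewrite tauE invrK natrX. Qed.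

Let tauL : tau <= L%:R * h. Proof. by rewrite tau_lattice. Qed.

Lemma rounded_local_field : local_field p nb D xi.
Proof. exact: (discretised_local_field sg h_gt0 tau_lattice dg deg tauE). Qed.

Let mk : forall o, measurable [set t | ky t == o] := measurable_key X sg h_gt0 tau_lattice.

Let transfer G := key_expectation P mk G.

Let xi_key i t : xi i (ky t) = cell_value h (cell tau h L (x i t)).
Proof. by rewrite /xi /rounded /ky /key ffunE. Qed.

Let xi_le i t : `|xi i (ky t)| <= `|x i t|.
Proof. by rewrite xi_key; exact: cell_value_le. Qed.

Let xi_close i t : `|x i t| <= tau -> `|x i t - xi i (ky t)| <= h.
Proof. by rewrite xi_key; exact: cell_value_close. Qed.

Let xi_out i t : tau < `|x i t| -> xi i (ky t) = 0.
Proof. by rewrite xi_key; exact: cell_value_out. Qed.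

Let xi_bdd i t : `|xi i (ky t)| <= tau.
Proof. by rewrite xi_key; exact: (cell_value_bdd h_gt0 (ltW tau_gt0) tauL). Qed.

Let cube_i i : integ P (fun t => `|x i t| ^+ 3) := integ_cube gamma_fin i.

Lemma rounded_third : \sum_i Ex p (fun o => `|xi i o| ^+ 3) <= g.
Proof.
rewrite /g (gammaE gamma_fin); apply: ler_sum => i _.
have [i1 <-] := transfer (fun o => `|xi i o| ^+ 3).
apply: (le_Er i1 (cube_i i)) => t; rewrite lerXn2r ?nnegrE //; exact: xi_le.
Qed.

(** From [a^2 <= 2 a^3 / (3 l) + l^2 / 3]. The level [l] stays free because it is used twice:
    optimised for the rate, and at another value to exclude [g = 0]. *)
Lemma rounded_second (l : R) : 0 < l ->
  \sum_i Ex p (fun o => xi i o ^+ 2) <= 2 / 3 * (g / l) + n * l ^+ 2 / 3.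
Proof.
move=> l0; have p0 : forall o, 0 <= p o := law_ge0 P ky.
apply: le_trans (_ : \sum_i (2 / 3 * (Ex p (fun o => `|xi i o| ^+ 3) / l) + l ^+ 2 / 3) <= _).
  apply: ler_sum => i _.
  rewrite -[X in _ + X](Ex_cst (law_sum1 P mk)) -ExZr -ExZl -ExD; apply: le_Ex => // o.
  rewrite -real_normK ?num_real //; move: (normr_ge0 (xi i o)); move: `|_| => a a0.
  rewrite -subr_ge0; have -> : 2 / 3 * (a ^+ 3 / l) + l ^+ 2 / 3 - a ^+ 2 =
    (a - l) ^+ 2 * (2 * a + l) / (3 * l) by field; rewrite gt_eqF.
  apply: divr_ge0; last by rewrite mulr_ge0 // ltW.
  by apply: mulr_ge0; [exact: sqr_ge0 | rewrite addr_ge0 ?mulr_ge0 // ltW].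
rewrite big_split /=; apply: lerD; last first.
  by rewrite sumr_const -[leLHS]mulr_natl mulrA.
rewrite -mulr_sumr -mulr_suml; apply: ler_wpM2l => //.
by apply: ler_wpM2r; [rewrite invr_ge0 ltW | exact: rounded_third].
Qed.

(** As [E x_i = 0], only the rounding error contributes: at most [h] when [|x_i| <= tau], and
    otherwise [|x_i| <= |x_i|^3 / tau^2] with [tau^-2 = D^8]. *)
Lemma rounded_first : \sum_i `|Ex p (xi i)| <= n * h + D%:R ^+ 8 * g.
Proof.
apply: le_trans (_ : \sum_i (h + D%:R ^+ 8 * Er P (fun t => `|x i t| ^+ 3)) <= _); last first.
  by rewrite big_split /= -mulr_sumr -(gammaE gamma_fin) sumr_const -[h *+ _]mulr_natl.
apply: ler_sum => i _; have [i1 <-] := transfer (xi i).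
have ix := integ_x gamma_fin i.
have -> : Er P (fun t => xi i (ky t)) = Er P (fun t => xi i (ky t) - x i t).
  by rewrite (ErB i1 ix) (Er_x centred sigma2_bounds gamma_fin i) subr0.
apply: le_trans (norm_Er (integB i1 ix)) _.
have ic := integZl (D%:R ^+ 8) (cube_i i).
have -> : h + D%:R ^+ 8 * Er P (fun t => `|x i t| ^+ 3) =
    Er P (fun t => h + D%:R ^+ 8 * `|x i t| ^+ 3).
  by rewrite (ErD (integ_cst P h) ic) Er_cst (ErZl _ (cube_i i)).
apply: (le_Er (integ_norm (integB i1 ix)) (integD (integ_cst P h) ic)) => t.
rewrite -/(x i t); have c0 : 0 <= `|x i t| ^+ 3 by rewrite exprn_ge0.
have d0 : 0 <= D%:R ^+ 8 * `|x i t| ^+ 3 by rewrite mulr_ge0 // exprn_ge0 // ltW.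
have [xt|xt] := leP `|x i t| tau.
  by rewrite distrC; apply: le_trans (xi_close xt) _; rewrite lerDl.
rewrite xi_out // sub0r normrN; apply: le_trans (_ : D%:R ^+ 8 * `|x i t| ^+ 3 <= _).
  2: by rewrite lerDr ltW.
have -> : D%:R ^+ 8 = (tau ^+ 2)^-1 by rewrite -exprVn tauV -exprM.
rewrite [leRHS]mulrC ler_pdivlMr ?exprn_gt0 // [leRHS]exprS ler_wpM2l //.
by apply: lerXn2r; rewrite ?nnegrE ?(ltW tau_gt0) ?(ltW xt).
Qed.

(** A pair of values within [tau] costs at most [2 h]. Otherwise the larger one exceeds [tau], and
    the lost product is at most its cube divided by [tau], with [1 / tau = D^4]. Summation over
    neighbours supplies the fifth power of [D]. *)
Lemma rounded_quad : `|Ex p (fquad nb xi) - 1| <= 2 * (n * D%:R * h) + 2 * (D%:R ^+ 5 * g).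
Proof.
have lf := rounded_local_field.
have i2 i j := transfer (fun o => xi i o * xi j o).
have ic a := integZl (D%:R ^+ 4) (cube_i a).
have ih a := integD (integ_cst P h) (ic a).
have -> : Ex p (fquad nb xi) = \sum_i \sum_(j in nb i) Er P (fun t => xi i (ky t) * xi j (ky t)).
  rewrite /fquad /nquad Ex_sum; apply: eq_bigr => i _.
  rewrite (eq_Ex _ (G := fun o => \sum_(j in nb i) xi i o * xi j o)); last first.
    by move=> o; rewrite /nsum mulr_sumr.
  by rewrite Ex_sum; apply: eq_bigr => j _; case: (i2 i j).
rewrite -[X in `|_ - X|](Er_xx sigma2_bounds gamma_fin) -sumrB.
apply: le_trans (ler_norm_sum _ _ _) _.
pose c i := Er P (fun t => `|x i t| ^+ 3).
pose k i := h + D%:R ^+ 4 * c i.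
have c0 i : 0 <= c i.
  rewrite -[leLHS](Er_cst P 0); apply: (le_Er (integ_cst P 0) (cube_i i)) => t.
  by rewrite exprn_ge0.
have k0 i : 0 <= k i by rewrite addr_ge0 ?(ltW h_gt0) // mulr_ge0 // exprn_ge0 // ltW.
apply: le_trans (_ : \sum_i \sum_(j in nb i) (k i + k j) <= _).
  apply: ler_sum => i _; rewrite -sumrB; apply: le_trans (ler_norm_sum _ _ _) _.
  apply: ler_sum => j _; have [i2ij _] := i2 i j.
  have ixx := integ_xx gamma_fin i j.
  rewrite -ErB //; apply: le_trans (norm_Er (integB i2ij ixx)) _.
  apply: le_trans (_ : Er P (fun t => h + D%:R ^+ 4 * `|x i t| ^+ 3
      + (h + D%:R ^+ 4 * `|x j t| ^+ 3)) <= _); last first.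
    rewrite (ErD (ih i) (ih j)) !(ErD (integ_cst P h) (ic _)) !Er_cst.
    by rewrite !(ErZl _ (cube_i _)).
  apply: (le_Er (integ_norm (integB i2ij ixx)) (integD (ih i) (ih j))) => t.
  rewrite -/(x i t) -/(x j t) distrC.
  have ci : 0 <= D%:R ^+ 4 * `|x i t| ^+ 3 by rewrite mulr_ge0 ?exprn_ge0 // ltW.
  have cj : 0 <= D%:R ^+ 4 * `|x j t| ^+ 3 by rewrite mulr_ge0 ?exprn_ge0 // ltW.
  have big_case (a b' : R) : 0 <= b' -> b' <= a -> tau < a -> a * b' <= D%:R ^+ 4 * a ^+ 3.
    move=> b0 ba ta; rewrite -tauV [leRHS]mulrC ler_pdivlMr //.
    have a0 : 0 <= a by apply: le_trans ba.
    apply: le_trans (_ : a * a * a <= _); last by rewrite !exprS expr0 mulr1 mulrA.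
    by apply: ler_pM => //; rewrite ?mulr_ge0 ?(ltW tau_gt0) ?(ltW ta) // ler_wpM2l.
  have [f1 f2] : D%:R ^+ 4 * `|x i t| ^+ 3 <= h + D%:R ^+ 4 * `|x i t| ^+ 3 + (h + D%:R ^+ 4 * `|x j t| ^+ 3)
      /\ D%:R ^+ 4 * `|x j t| ^+ 3 <= h + D%:R ^+ 4 * `|x i t| ^+ 3 + (h + D%:R ^+ 4 * `|x j t| ^+ 3).
    have := h_gt0; move: ci cj.
    by move: (_ * `|x i t| ^+ 3) (_ * `|x j t| ^+ 3) => ? ? ? ? ?; split; lra.
  case: (leP `|x i t| tau) => [xt|xt]; case: (leP `|x j t| tau) => [yt|yt].
  - have -> : x i t * x j t - xi i (ky t) * xi j (ky t) =
       x i t * (x j t - xi j (ky t)) + (x i t - xi i (ky t)) * xi j (ky t) by ring.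
    apply: le_trans (ler_normD _ _) _; rewrite (normrM (x i t)) (normrM (x i t - _)).
    have h1 : `|x i t| * `|x j t - xi j (ky t)| <= 1 * h.
      by apply: ler_pM => //; [exact: le_trans xt tau_le1 | exact: xi_close].
    have h2 : `|x i t - xi i (ky t)| * `|xi j (ky t)| <= h * 1.
      by apply: ler_pM => //; [exact: xi_close | exact: le_trans (xi_bdd j t) tau_le1].
    apply: le_trans (lerD h1 h2) _; rewrite mul1r mulr1; apply: lerD; exact: ler_wpDr.
  - rewrite (xi_out yt) mulr0 subr0 normrM mulrC.
    exact: le_trans (big_case _ _ (normr_ge0 (x i t)) (le_trans xt (ltW yt)) yt) f2.
  - rewrite (xi_out xt) mul0r subr0 normrM.
    exact: le_trans (big_case _ _ (normr_ge0 (x j t)) (le_trans yt (ltW xt)) xt) f1.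
  - rewrite (xi_out xt) mul0r subr0 normrM.
    have [le_ji|/ltW le_ij] := leP `|x j t| `|x i t|.
      exact: le_trans (big_case _ _ (normr_ge0 (x j t)) le_ji xt) f1.
    rewrite mulrC; exact: le_trans (big_case _ _ (normr_ge0 (x i t)) le_ij yt) f2.
under eq_bigr do rewrite big_split.
rewrite big_split /=.
apply: le_trans (lerD (sum_nb_cst_le (lf_sym lf) (lf_card lf) k0) (sum_nb_le (lf_sym lf) (lf_card lf) k0)) _.
rewrite /k big_split /= -mulr_sumr -(gammaE gamma_fin) -/g sumr_const -[h *+ _]mulr_natl -/n.
by rewrite le_eqVlt; apply/orP; left; apply/eqP; ring.
Qed.

Lemma card_vertices_gt0 : (0 < #|I|)%N.
Proof.
rewrite lt0n; apply/negP => /eqP I0; move: deg; rewrite /max_degree big_pred0 // => i.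
by have := max_card (pred1 i); rewrite card1 I0.
Qed.

Let n_gt0 : 0 < n. Proof. by rewrite ltr0n card_vertices_gt0. Qed.

Let total_sum t : Defs.total X t = sg * \sum_i x i t.
Proof.
rewrite /Defs.total mulr_sumr; apply: eq_bigr => i _.
by rewrite /x mulrC divfK // gt_eqF // (sigma_gt0 sigma2_bounds).
Qed.

Let local_sum i t : localsum e X i t = sg * nsum nb (x^~ t) i.
Proof.
rewrite /localsum /nsum mulr_sumr; apply: eq_bigr => j _.
by rewrite /x mulrC divfK // gt_eqF // (sigma_gt0 sigma2_bounds).
Qed.

(** The squared normaliser divided by [sigma^2], before the positive part is taken. *)
Let V t : R := nquad nb (x^~ t) - (\sum_i x i t) * (\sum_i nsum nb (x^~ t) i) / n.

Let normalizerE t : normalizer e X t = Num.sqrt (Num.max (sg ^+ 2 * V t) 0).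
Proof.
rewrite /normalizer; congr (Num.sqrt (Num.max _ _)).
rewrite sumrB /V mulrBr; congr (_ - _).
  rewrite /nquad mulr_sumr; apply: eq_bigr => i _; rewrite local_sum.
  have -> : X i t = sg * x i t.
    by rewrite /x mulrC divfK // gt_eqF // (sigma_gt0 sigma2_bounds).
  by ring.
rewrite sumr_const /Xbar /Ybar -/(Defs.total X t) total_sum -[LHS]mulr_natl -/n.
have -> : \sum_i localsum e X i t = sg * \sum_i nsum nb (x^~ t) i.
  by rewrite mulr_sumr; apply: eq_bigr => i _; rewrite local_sum.
by field; rewrite gt_eqF.
Qed.

Let selfnormalizedE t : 4^-1 <= V t <= 4 ->
  selfnormalized e X t = (\sum_i x i t) * invroot (V t).
Proof.
move=> /andP[v1 v4]; have s0 := sigma_gt0 sigma2_bounds.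
have v0 : 0 < V t by apply: lt_le_trans v1; rewrite invr_gt0.
have NE : normalizer e X t = sg * Num.sqrt (V t).
  rewrite normalizerE max_l; last by rewrite mulr_ge0 ?sqr_ge0 // ltW.
  by rewrite sqrtrM ?sqr_ge0 // sqrtr_sqr (gtr0_norm s0).
have r0 : 0 < Num.sqrt (V t) by rewrite sqrtr_gt0.
rewrite /selfnormalized NE mulf_eq0 !gt_eqF //= total_sum.
rewrite /invroot (_ : clip (V t) = V t); last by rewrite /clip max_l // min_l.
by rewrite -mulf_div divff ?gt_eqF // mul1r.
Qed.

Let dev t : R := (fquad nb xi (ky t) - 1) ^+ 2.
Let centring t : R := (1 + fsum xi (ky t) ^+ 2) * `|etasum nb xi (ky t)|.

Lemma selfnormalized_close (r : R) t : r <= 8^-1 -> 8 * n ^+ 2 * D%:R * h <= r ->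
  (forall i, `|x i t| <= tau) -> `|fquad nb xi (ky t) - 1| <= 2^-1 -> centring t <= n * r ->
  `|selfnormalized e X t - ratio nb xi (ky t)| <= 7 * r.
Proof.
move=> r8 hr xt Q1 cn; have lf := rounded_local_field.
have x1 i : `|x i t| <= 1 by apply: le_trans (xt i) tau_le1.
have y1 i : `|xi i (ky t)| <= 1 by apply: le_trans (xi_bdd i t) tau_le1.
have xy i : `|x i t - xi i (ky t)| <= h by apply: xi_close.
have [V1 V2] := discretised_statistic (lf_card lf) h_gt0 x1 y1 xy card_vertices_gt0
  (ltn0Sn _) r8 hr Q1 cn.
by rewrite selfnormalizedE.
Qed.

(** A pointwise majorant of the indicator of the bad event, so that the union bound and Markov's
    inequality become one integration. Its parts reach 1 when some [|x_i|] exceeds [tau] (as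
    [tau^-3 = D^12]), when [Q] is more than 1/2 away from 1, and when the centring term exceeds
    [n r]. *)
Let errbound (r : R) t : R :=
  \sum_i D%:R ^+ 12 * `|x i t| ^+ 3 + 4 * dev t + centring t / (n * r).

Let term_ge0 i t : 0 <= D%:R ^+ 12 * `|x i t| ^+ 3.
Proof. by rewrite mulr_ge0 // exprn_ge0 // ltW. Qed.

Let errbound_cases (r : R) t : 0 < r -> r <= 8^-1 -> 8 * n ^+ 2 * D%:R * h <= r ->
  1 <= errbound r t \/ 0 <= errbound r t /\
    `|selfnormalized e X t - ratio nb xi (ky t)| <= 7 * r.
Proof.
move=> r0 r8 hr.
have e1 : 0 <= \sum_i D%:R ^+ 12 * `|x i t| ^+ 3 by apply: sumr_ge0.
have e2 : 0 <= 4 * dev t by rewrite mulr_ge0 ?sqr_ge0.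
have nr : 0 < n * r by rewrite mulr_gt0.
have e3 : 0 <= centring t / (n * r).
  apply: divr_ge0; last exact: ltW.
  by apply: mulr_ge0 => //; apply: addr_ge0 => //; exact: sqr_ge0.
have [xt|] := boolP [forall i, `|x i t| <= tau]; last first.
  rewrite negb_forall => /existsP[i]; rewrite -ltNge => xt; left.
  rewrite /errbound -addrA; apply: ler_wpDr; first exact: addr_ge0.
  rewrite (bigD1 i) //=; apply: ler_wpDr; first by apply: sumr_ge0.
  rewrite (_ : 12%N = (4 * 3)%N) // exprM -tauV exprVn mulrC ler_pdivlMr ?exprn_gt0 // mul1r.
  by apply: lerXn2r; rewrite ?nnegrE ?(ltW tau_gt0) ?(ltW xt).
have [Q1|Q1] := leP `|fquad nb xi (ky t) - 1| 2^-1; last first.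
  left; rewrite /errbound addrAC; apply: ler_wpDl; first exact: addr_ge0.
  rewrite /dev -real_normK ?num_real //.
  have : (2^-1 : R) ^+ 2 <= `|fquad nb xi (ky t) - 1| ^+ 2.
    by apply: lerXn2r; rewrite ?nnegrE ?invr_ge0 ?(ltW Q1).
  by move: (`|_| ^+ 2) => a; rewrite exprVn; lra.
have [cn|cn] := leP (centring t) (n * r); last first.
  left; rewrite /errbound; apply: ler_wpDl; first exact: addr_ge0.
  by rewrite ler_pdivlMr // mul1r ltW.
right; split; first by rewrite /errbound addr_ge0 // addr_ge0.
apply: selfnormalized_close => // i; exact: (forallP xt i).
Qed.

Lemma measurable_selfnormalized z : measurable [set t | selfnormalized e X t <= z].
Proof.
have mX i : measurable_fun [set: T] (X i) by [].
have mS : measurable_fun [set: T] (Defs.total X) by exact: measurable_sum.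
have mL i : measurable_fun [set: T] (localsum e X i).
  rewrite (_ : localsum e X i = fun t => \sum_j (if j \in closed_nbhd e i then X j t else 0)).
    by apply: measurable_sum => j; case: (j \in closed_nbhd e i).
  by apply/funext => t; rewrite /localsum big_mkcond.
have mXb : measurable_fun [set: T] (Xbar X) by exact: measurable_funM.
have mYb : measurable_fun [set: T] (Ybar e X).
  by apply: measurable_funM => //; exact: measurable_sum.
have mN2 : measurable_fun [set: T] (fun t => Num.max (\sum_i (X i t * localsum e X i t - Xbar X t * Ybar e X t)) 0).
  apply: measurable_maxr => //; apply: measurable_sum => i.
  by apply: measurable_funB; exact: measurable_funM.
have mN : measurable_fun [set: T] (normalizer e X).
  apply: (measurableT_comp _ mN2); apply: continuous_measurable_fun; exact: sqrt_continuous.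
(* The division is cleared: under a positive normaliser [total] is compared with [z * normalizer];
   under a zero one the statistic is 0 by convention and the event reads [0 <= z]. *)
have -> : [set t | selfnormalized e X t <= z] =
  (fun t => (0 < normalizer e X t) && (Defs.total X t <= z * normalizer e X t)
     || (~~ (0 < normalizer e X t) && (0 <= z))) @^-1` [set true].
  apply/seteqP; split => t /=; rewrite /selfnormalized;
    have := sqrtr_ge0 (Num.max (\sum_i (X i t * localsum e X i t - Xbar X t * Ybar e X t)) 0);
    rewrite -/(normalizer e X t) le_eqVlt => /orP[/eqP <-|N0];
    rewrite ?eqxx ?ltxx /= ?(gt_eqF N0) ?N0 ?orbF /= ?ler_pdivrMr //.
rewrite -[X in measurable X]setTI; apply: (_ : measurable_fun setT _) => //.
have m0 : measurable_fun [set: T] (fun t => 0 < normalizer e X t) by exact: measurable_fun_ltr.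
apply: measurable_or; apply: measurable_and => //; last exact: measurable_neg.
by apply: measurable_fun_ler => //; exact: measurable_funM.
Qed.

Let comparison_error (r : R) : R := D%:R ^+ 12 * g
  + 4 * Ex p (fun o => (fquad nb xi o - 1) ^+ 2)
  + Ex p (fun o => (1 + fsum xi o ^+ 2) * `|etasum nb xi o|) / (n * r).

Let Er_errbound r : integ P (errbound r) /\ Er P (errbound r) = comparison_error r.
Proof.
have [i1 E1] := transfer (fun o => (fquad nb xi o - 1) ^+ 2).
have [i2 E2] := transfer (fun o => (1 + fsum xi o ^+ 2) * `|etasum nb xi o|).
have ic i := integZl (D%:R ^+ 12) (cube_i i).
have isum : integ P (fun t => \sum_i D%:R ^+ 12 * `|x i t| ^+ 3) by apply: integ_sum => i _.
have i1' := integZl 4 i1; have i2' := integZl (n * r)^-1 i2.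
have -> : errbound r = fun t => \sum_i D%:R ^+ 12 * `|x i t| ^+ 3 + 4 * dev t + (n * r)^-1 * centring t.
  by apply/funext => t; rewrite /errbound [_ / (n * r)]mulrC.
split; first exact: integD (integD isum i1') i2'.
rewrite (ErD (integD isum i1') i2') (ErD isum i1') (ErZl _ i1) (ErZl _ i2) E1 E2.
rewrite /comparison_error [_ / (n * r)]mulrC; congr (_ + _ + _).
rewrite Er_sum // /g (gammaE gamma_fin) mulr_sumr; apply: eq_bigr => i _.
exact: (ErZl _ (cube_i i)).
Qed.

Lemma selfnormalized_prob_le r z : 0 < r -> r <= 8^-1 -> 8 * n ^+ 2 * D%:R * h <= r ->
  fine (P [set t | selfnormalized e X t <= z])
  <= comparison_error r + Ex p (fun o => (ratio nb xi o <= z + 7 * r)%R%:R).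
Proof.
move=> r0 r8 hr; have [ie <-] := Er_errbound r.
have [i1 <-] := transfer (fun o => (ratio nb xi o <= z + 7 * r)%R%:R).
have [i2 <-] := Er_indic P (measurable_selfnormalized z).
rewrite -ErD //; apply: (le_Er i2 (integD ie i1)) => t.
have [e1|[e0 close]] := errbound_cases t r0 r8 hr.
  by apply: ler_wpDr => //; apply: le_trans e1; rewrite -[leRHS]/(1%:R) ler_nat leq_b1.
apply: ler_wpDl => //; rewrite ler_nat; case: leP => //= wz.
rewrite (_ : (_ <= _) = true) //; move: close; rewrite ler_norml => /andP[? ?]; lra.
Qed.

Lemma selfnormalized_prob_ge r z : 0 < r -> r <= 8^-1 -> 8 * n ^+ 2 * D%:R * h <= r ->
  Ex p (fun o => (ratio nb xi o <= z - 7 * r)%R%:R)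
  <= comparison_error r + fine (P [set t | selfnormalized e X t <= z]).
Proof.
move=> r0 r8 hr; have [ie <-] := Er_errbound r.
have [i1 <-] := transfer (fun o => (ratio nb xi o <= z - 7 * r)%R%:R).
have [i2 <-] := Er_indic P (measurable_selfnormalized z).
rewrite -ErD //; apply: (le_Er i1 (integD ie i2)) => t.
have [e1|[e0 close]] := errbound_cases t r0 r8 hr.
  by apply: ler_wpDr => //; apply: le_trans e1; rewrite -[leRHS]/(1%:R) ler_nat leq_b1.
apply: ler_wpDl => //; rewrite ler_nat; case: leP => //= wz.
rewrite (_ : (_ <= _) = true) //; move: close; rewrite ler_norml => /andP[? ?]; lra.
Qed.

End Comparison.

(** * The rate *)

(** Expresses the fractional powers through cube roots, so that the rates become polynomial in [c],
    [s] and [r]. *)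
Lemma powR_roots (R : realType) (n g : R) : 0 < n -> 0 <= g ->
  let c := n `^ 3^-1 in let s := g `^ 3^-1 in
  [/\ c ^+ 3 = n, s ^+ 3 = g, g `^ (2 / 3) = s ^+ 2 & (n `^ (- 2^-1)) ^+ 2 * n = 1].
Proof.
move=> n0 g0 c s.
have cube (a : R) : 0 <= a -> (a `^ 3^-1) ^+ 3 = a.
  by move=> a0; rewrite -powR_mulrn ?powR_ge0 // -powRrM mulVf // powRr1.
split; [exact/cube/ltW | exact: cube | |].
  by rewrite /s -powR_mulrn ?powR_ge0 // -powRrM; congr (_ `^ _); rewrite mulrC.
rewrite -powR_mulrn ?powR_ge0 // -powRrM mulNr mulVf // -[X in _ * X]powRr1 ?(ltW n0) //.
by rewrite -powRD ?addNr ?powRr0 // (gt_eqF n0) implybT.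
Qed.

(** Reduces the square of [1 + b] coming from the centring term to the first power allowed by the
    rate. The core is [b^2 r <= s^3 (1 + b)]: since [r^2 c^3 = 1], the square of its left side is
    [s^6 b]. *)
Lemma second_moment_rate (R : realFieldType) (c s r : R) : 0 < c -> 0 < s ->
  r ^+ 2 * c ^+ 3 = 1 -> 0 < r ->
  (1 + c * s ^+ 2) ^+ 2 * r <= 2 * (r + s ^+ 3) * (1 + c * s ^+ 2).
Proof.
move=> c0 s0 rc r0; set b := c * s ^+ 2.
have b0 : 0 <= b by rewrite mulr_ge0 ?sqr_ge0 // ltW.
have s3 : 0 <= s ^+ 3 by rewrite exprn_ge0 // ltW.
have key : b ^+ 2 * r <= s ^+ 3 * (1 + b).
  have q1 : b ^+ 2 * r \is Num.nneg by rewrite nnegrE; apply: mulr_ge0; [exact: sqr_ge0 | exact: ltW].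
  have q2 : s ^+ 3 * (1 + b) \is Num.nneg by rewrite nnegrE; apply: mulr_ge0 => //; apply: addr_ge0.
  rewrite -(ler_pXn2r (n := 2) _ q1 q2) //.
  rewrite (_ : (b ^+ 2 * r) ^+ 2 = (s ^+ 3) ^+ 2 * b * (r ^+ 2 * c ^+ 3)); last by rewrite /b; ring.
  rewrite rc mulr1 (exprMn _ (s ^+ 3) (1 + b)); apply: ler_wpM2l; first exact: sqr_ge0.
  by have := sqr_ge0 b; lra.
have := sqr_ge0 (1 - b) => b1; have rb : 0 <= r * b by rewrite mulr_ge0 // ltW.
have r1 : 0 <= r * (1 - b) ^+ 2 by rewrite mulr_ge0 // ltW.
move: key; move: (s ^+ 3) s3 b0 rb r1 => G G0; move: b b1 => b b1 b0 rb r1 key.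
nra.
Qed.

Section Rate.
Context {dsp : measure_display} {T : measurableType dsp} {R : realType}.
Variables (P : probability T R) (I : finType) (e : rel I) (X : I -> {RV P >-> R}).
Hypothesis dg : dependency_graph e X.
Hypothesis centred : forall i, ('E_P[X i] = 0)%E.
Hypothesis deg : (1 <= max_degree e)%N.
Hypothesis sigma2_bounds : (0 < sigma2 e X < +oo)%E.
Hypothesis gamma_fin : (gamma e X < +oo)%E.

Let D := (max_degree e).+1.
Let g := fine (gamma e X).
Let n : R := #|I|%:R.
Let r := n `^ (- 2^-1).
Let c := n `^ 3^-1.
Let s := g `^ 3^-1.
Let b := c * s ^+ 2.

Let n_gt0 : 0 < n. Proof. by rewrite ltr0n (card_vertices_gt0 deg). Qed.
Let n_ge1 : 1 <= n. Proof. by rewrite ler1n (card_vertices_gt0 deg). Qed.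
Let g0 : 0 <= g. Proof. exact: g_nonneg. Qed.
Let r_gt0 : 0 < r. Proof. by rewrite powR_gt0. Qed.
Let c_gt0 : 0 < c. Proof. by rewrite powR_gt0. Qed.
Let D1 : 1 <= D%:R :> R. Proof. by rewrite ler1n. Qed.
Let D0 : 0 < D%:R :> R. Proof. by rewrite ltr0n. Qed.

(** Gives [|E Q - 1| <= 1/4] and keeps the sum of absolute means below 1/2, as [moment_bounds]
    requires. *)
Hypothesis small : D%:R ^+ 8 * (r + g) <= 8^-1.

(** The mesh has to divide [tau] exactly and be at most [r / (8 n^2 D)]; dividing [tau] by a large
    integer achieves both. *)
Let mesh : exists (h : R) (L : nat),
  [/\ 0 < h, (D ^ 4)%:R^-1 = L%:R * h & 8 * n ^+ 2 * D%:R * h <= r].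
Proof.
pose tau : R := (D ^ 4)%:R^-1; pose a := 8 * n ^+ 2 * D%:R * tau / r.
have tau0 : 0 < tau by rewrite invr_gt0 natrX exprn_gt0.
have a0 : 0 < a by rewrite divr_gt0 // !mulr_gt0 // exprn_gt0.
pose L := Num.Def.archi_bound a; have aL : a < L%:R := archi_boundP (ltW a0).
have L0 : 0 < L%:R :> R := lt_trans a0 aL.
exists (tau / L%:R), L; split; first exact: divr_gt0.
  by rewrite mulrC divfK // gt_eqF.
by rewrite mulrA ler_pdivrMr // [leRHS]mulrC -ler_pdivrMr // ltW.
Qed.

Let pow_le k : (k <= 8)%N -> D%:R ^+ k * (r + g) <= 8^-1.
Proof.
move=> k8; apply: le_trans small; rewrite ler_wpM2r ?ler_weXn2l //.
by rewrite addr_ge0 // ltW.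
Qed.

Section FixedMesh.
Variables (h : R) (L : nat).
Hypothesis h_gt0 : 0 < h.
Hypothesis tau_lattice : (D ^ 4)%:R^-1 = L%:R * h.
Hypothesis hr : 8 * n ^+ 2 * D%:R * h <= r.

Let p := law P (key X (sigma e X) (D ^ 4)%:R^-1 h L).
Let xi := rounded (I := I) h (L := L).
Let nb := closed_nbhd e.
Let err := D%:R ^+ 8 * (r + g).

Let lf : local_field p nb D xi.
Proof. exact: (rounded_local_field dg deg h_gt0 tau_lattice). Qed.

Let nDh : 8 * (n * D%:R * h) <= r.
Proof.
apply: le_trans hr; rewrite (_ : 8 * (n * D%:R * h) = 8 * n * D%:R * h); last by ring.
rewrite ler_pM2r // ler_pM2r // ler_pM2l //.
by rewrite expr2 ler_peMr // ltW.
Qed.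

Let nh : n * h <= r.
Proof.
apply: le_trans nDh; apply: le_trans (_ : n * D%:R * h <= _).
  by rewrite ler_pM2r // ler_peMr // ltW.
by rewrite ler_peMl ?ler1n // !mulr_ge0 // ltW.
Qed.

Let first_le : \sum_i `|Ex p (xi i)| <= err.
Proof.
apply: le_trans (rounded_first centred sigma2_bounds gamma_fin h_gt0 tau_lattice erefl) _.
rewrite /err mulrDr lerD2r; apply: le_trans nh _.
by rewrite ler_peMl ?exprn_ege1 // ltW.
Qed.

Let quad_le : `|Ex p (fquad nb xi) - 1| <= 2 * (D%:R ^+ 5 * (r + g)).
Proof.
apply: le_trans (rounded_quad dg deg sigma2_bounds gamma_fin h_gt0 tau_lattice erefl) _.
rewrite -mulrDr ler_pM2l // mulrDr lerD2r.
apply: le_trans (_ : r <= _); last by rewrite ler_peMl ?exprn_ege1 // ltW.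
have := nDh; have := r_gt0; rewrite -/n -/D; lra.
Qed.

(** The third-moment parameter is [r + g], positive even before [g > 0] is known. The second-moment
    bound stays free since [g > 0] is itself deduced with an auxiliary one. *)
Let bounds b' : \sum_i Ex p (fun w => xi i w ^+ 2) <= b' ->
  moment_bounds p nb xi (r + g) b' err.
Proof.
move=> hb; split => //.
- apply: le_trans (rounded_third gamma_fin h_gt0 tau_lattice) _.
  by rewrite lerDr ltW.
- by apply: le_trans small _; lra.
apply: le_trans quad_le _.
by have := @pow_le 5 isT; lra.
Qed.

Let quad_lower b' : \sum_i Ex p (fun w => xi i w ^+ 2) <= b' -> 3 / 4 <= D%:R * b'.
Proof.
move=> /bounds mb; have := mb_quad mb; rewrite ler_norml => /andP[q1 _].
apply: le_trans (_ : Ex p (fquad nb xi) <= _); first lra.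
apply: le_trans (E_abs_fabs lf mb); rewrite /fquad /nquad Ex_sum; apply: ler_sum => i _.
apply: le_Ex => [w|w]; first exact: (lf_ge0 lf).
by apply: le_trans (ler_norm _) _; rewrite normrM ler_wpM2l // norm_nsum_le.
Qed.

(** If [g = 0], the level [l = 1 / (n D)] bounds the second moments so strongly that
    [D b' = 1 / (3 n D)], against [D b' >= 3/4]. *)
Let g_gt0 : 0 < g.
Proof.
rewrite lt_neqAle g0 andbT eq_sym; apply/eqP => gE.
have l0 : 0 < (n * D%:R)^-1 by rewrite invr_gt0 mulr_gt0.
have := quad_lower (rounded_second gamma_fin h_gt0 tau_lattice l0).
rewrite -/g -/n gE mul0r mulr0 add0r.
have -> : D%:R * (n * (n * D%:R)^-1 ^+ 2 / 3) = (n * D%:R)^-1 / 3.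
  by field; rewrite !gt_eqF.
have : (n * D%:R)^-1 <= 1 by rewrite invf_le1 ?mulr_gt0 // mulr_ege1.
lra.
Qed.

Let s_gt0 : 0 < s. Proof. by rewrite powR_gt0. Qed.

Let second_le : \sum_i Ex p (fun w => xi i w ^+ 2) <= b.
Proof.
have [c3 s3 _ _] := powR_roots n_gt0 g0.
(* The level [s / c = (g / n)^(1/3)] minimises the bound. *)
apply: le_trans (rounded_second gamma_fin h_gt0 tau_lattice (divr_gt0 s_gt0 c_gt0)) _.
have E (c' s' g' n' : R) : 0 < c' -> 0 < s' -> c' ^+ 3 = n' -> s' ^+ 3 = g' ->
    2 / 3 * (g' / (s' / c')) + n' * (s' / c') ^+ 2 / 3 = c' * s' ^+ 2.
  by move=> ? ? <- <-; field; rewrite !gt_eqF.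
by rewrite /b (E c s g n).
Qed.

Let mb := bounds second_le.

Let G0 : 0 < r + g. Proof. exact: addr_gt0. Qed.

Let b_ge0 : 0 <= b. Proof. by rewrite mulr_ge0 ?sqr_ge0 // ltW. Qed.

Let B := D%:R ^+ 15 * b * (r + g).

Let quad_sq : (Ex p (fquad nb xi) - 1) ^+ 2 <= D%:R ^+ 8 * (r + g).
Proof.
rewrite -real_normK ?num_real // expr2.
apply: le_trans (_ : 1 * (2 * (D%:R ^+ 5 * (r + g))) <= _).
  by apply: ler_pM => //; apply: le_trans (mb_quad mb) _; lra.
rewrite mul1r (_ : 8 = 3 + 5)%N // exprD -mulrA ler_wpM2r //.
  by rewrite mulr_ge0 ?exprn_ge0 // ltW.
apply: le_trans (_ : D%:R <= _); first by rewrite ler_nat.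
by rewrite -[leLHS]expr1 ler_weXn2l.
Qed.

Let pow_le_B k : (k <= 14)%N -> D%:R ^+ k * (r + g) <= 2 * B.
Proof.
move=> k14; apply: le_trans (_ : D%:R ^+ 14 * (r + g) <= _).
  by rewrite ler_pM2r // ler_weXn2l.
have -> : 2 * B = 2 * (D%:R * b) * (D%:R ^+ 14 * (r + g)) by rewrite /B; ring.
apply: ler_peMl; first by rewrite mulr_ge0 ?exprn_ge0 // ltW.
by have := quad_lower second_le; lra.
Qed.

Let pow_b_le_B k : (k <= 15)%N -> D%:R ^+ k * b * (r + g) <= B.
Proof. by move=> k15; rewrite /B ler_pM2r // ler_wpM2r // ler_weXn2l. Qed.

Let ratio_rate y : `|Ex p (fun w => (ratio nb xi w <= y)%R%:R) - Phi y|
  <= (stein_cst + 4) * (400 * 1000) * (7 * B).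
Proof.
have c0 : 0 <= stein_cst :> R by apply: le_trans (stein_bounded 0 0).
have := stein_bound lf mb h_gt0 (fun i w => cell_value_lattice h (w i)) G0
  (C := stein_cst + 4) (f := stein y) (Phi := @Phi R) (y := y).
move=> H; apply: le_trans (H _ _ _ _) _.
- by move=> x; apply: le_trans (stein_bounded y x) _; rewrite lerDl.
- move=> x x'; apply: le_trans (stein_lip y x x') _; rewrite ler_wpM2r //; lra.
- move=> x; apply: le_trans (steinD_bounded y x) _; lra.
- move=> x t a ta; exact: stein_expansion.
apply: ler_wpM2l.
  by apply: mulr_ge0; [exact: addr_ge0 | apply: mulr_ge0; exact: ler0n].
(* The four terms of [stein_bound] are at most [2 B], [B], [2 B] and [2 B]. *)
have := quad_sq; have := @pow_le_B 5 isT; have := @pow_le_B 8 isT.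
have := @pow_b_le_B 6 isT; rewrite /err mulrAC; lra.
Qed.

Let error_rate : D%:R ^+ 12 * g + 4 * Ex p (fun o => (fquad nb xi o - 1) ^+ 2)
  + Ex p (fun o => (1 + fsum xi o ^+ 2) * `|etasum nb xi o|) / (n * r) + 7 * r <= 104 * B.
Proof.
have [c3 s3 _ rn] := powR_roots n_gt0 g0.
have d1 := E_fquad_dev lf mb.
have d2 : Ex p (fun o => (1 + fsum xi o ^+ 2) * `|etasum nb xi o|) / (n * r) <= 72 * B.
  (* The choice [r = n^(-1/2)] means [r^2 n = 1]: the threshold for the centring term then yields a
     factor of the same size as the shift of the level. *)
  have -> : (n * r)^-1 = r.
    by rewrite -[LHS]mul1r -rn -/r; field; rewrite !gt_eqF.
  apply: le_trans (ler_wpM2r (ltW r_gt0) (E_centring lf mb)) _.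
  have rc : r ^+ 2 * c ^+ 3 = 1 by rewrite c3.
  have := second_moment_rate c_gt0 s_gt0 rc r_gt0; rewrite [s ^+ 3]s3 -/b => hb.
  have d3 : 0 <= 12 * D%:R ^+ 3 :> R by rewrite mulr_ge0 ?exprn_ge0 // ltW.
  rewrite -[leLHS]mulrA; apply: le_trans (ler_wpM2l d3 hb) _.
  have := @pow_le_B 3 isT; have := @pow_b_le_B 3 isT; lra.
(* In units of [B]: truncation 2, deviation of [Q] [4 (2 + 2)], centring 72, shift [7 * 2]; together
   104. *)
have := quad_sq; have := @pow_le_B 5 isT; have := @pow_le_B 8 isT; have := @pow_le_B 12 isT.
have d12 : D%:R ^+ 12 * g <= D%:R ^+ 12 * (r + g).
  by rewrite ler_wpM2l ?exprn_ge0 ?lerDr // ltW.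
have := @pow_le_B 0 isT; rewrite expr0 mul1r; have := g0; lra.
Qed.

(** Off the bad event the two statistics differ by at most [7 r], so the distribution function is
    squeezed between those of the discrete ratio at [z - 7 r] and [z + 7 r]; the Lipschitz bound for
    [Phi] returns to [z]. *)
Lemma cdf_rate z : `|fine (P [set t | selfnormalized e X t <= z]) - Phi z|
  <= (104 + (stein_cst + 4) * (400 * 1000) * 7) * B.
Proof.
have r8 : r <= 8^-1.
  by have := @pow_le 0 isT; rewrite expr0 mul1r; have := g0; lra.
have hle := selfnormalized_prob_le dg deg sigma2_bounds gamma_fin h_gt0 tau_lattice erefl z r_gt0 r8 hr.
have hge := selfnormalized_prob_ge dg deg sigma2_bounds gamma_fin h_gt0 tau_lattice erefl z r_gt0 r8 hr.
have tot := error_rate.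
have up := ratio_rate (z + 7 * r); have dn := ratio_rate (z - 7 * r).
have r7 : 0 <= 7 * r by rewrite mulr_ge0 // ltW.
have lip1 : Phi (z + 7 * r) - Phi z <= 7 * r.
  by apply: le_trans (Phi_lip _) _; [rewrite lerDl | rewrite addrAC subrr add0r].
have lip2 : Phi z - Phi (z - 7 * r) <= 7 * r.
  by apply: le_trans (Phi_lip _) _; [rewrite gerBl | rewrite opprB addrC subrK].
rewrite [leRHS]mulrDl -[X in _ <= _ + X]mulrA; move: up dn lip1 lip2 tot hle hge; cbv beta.
rewrite -/D -/g -/n -/nb -/p -/xi.
move: (Ex p _) => q1; move: (Ex p _) => q2; move: (_ + 4 * _ + _) => er.
move: (_ * (7 * B)) => k; move: (fine _) (Phi z) (Phi (z + _)) (Phi (z - _)) => pr ph ph1 ph2.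
rewrite !ler_norml => /andP[u1 u2] /andP[v1 v2] l1 l2 tot h1 h2.
apply/andP; split; lra.
Qed.

End FixedMesh.

Lemma cdf_rate_small z : `|fine (P [set t | selfnormalized e X t <= z]) - Phi z|
  <= (104 + (stein_cst + 4) * (400 * 1000) * 7) * (D%:R ^+ 15 * b * (r + g)).
Proof. by have [h [L [h0 tl hr]]] := mesh; exact: cdf_rate h0 tl hr z. Qed.

End Rate.

Theorem theorem3p2 (R : realType) :
  exists C : R, 0 < C /\
  forall (dsp : measure_display) (T : measurableType dsp)
    (P : probability T R) (I : finType) (e : rel I) (X : I -> {RV P >-> R}),
    dependency_graph e X ->
    (forall i : I, ('E_P[X i] = 0)%E) ->
    (1 <= max_degree e)%N ->
    (0 < sigma2 e X < +oo)%E ->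
    (gamma e X < +oo)%E ->
    let n : R := #|I|%:R in
    let d : R := (max_degree e)%:R in
    let g : R := fine (gamma e X) in
    (ereal_sup [set `|P [set w | (selfnormalized e X w <= z)%R]
                      - std_normal_cdf z| | z in [set: R]]
     <= (C * d ^+ 9 * (1 + d ^+ 6 * (n `^ 3^-1) * (g `^ (2 / 3)))
         * (n `^ (- 2^-1) + g))%R%:E)%E.
Proof.
pose K : R := 104 + (stein_cst + 4) * (400 * 1000) * 7.
have c0 : 0 <= stein_cst :> R by apply: le_trans (stein_bounded 0 0).
have K0 : 0 < K.
  apply: ltr_wpDr; last by rewrite ltr0n.
  apply: mulr_ge0; last exact: ler0n.
  by apply: mulr_ge0; [exact: addr_ge0 | apply: mulr_ge0; exact: ler0n].
(* As [D <= 2 d], the factor [2^15] converts [D^15] when [D^8 (r + g) <= 1/8]. Otherwise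
   [1 < 8 D^8 (r + g) <= 8 * 2^8 d^9 (r + g)], which accounts for [2^11]. *)
exists (2 ^+ 11 + K * 2 ^+ 15); split.
  by rewrite addr_gt0 ?mulr_gt0 // exprn_gt0.
move=> dsp T P I e X dg centred deg sigma2_bounds gamma_fin; cbv zeta.
set n : R := #|I|%:R; set d : R := (max_degree e)%:R; set g := fine _.
have n0 : 0 < n by rewrite ltr0n (card_vertices_gt0 deg).
have g0 : 0 <= g by exact: g_nonneg.
have d1 : 1 <= d by rewrite ler1n.
have d0 : 0 <= d by exact: le_trans d1.
have [c3 s3 s2 rn] := powR_roots n0 g0.
rewrite s2 -[X in 1 + X]mulrA; set b := n `^ 3^-1 * _; set r := n `^ (- 2^-1).
have r0 : 0 < r by rewrite powR_gt0.
have G0 : 0 < r + g by apply: ltr_wpDr.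
have b0 : 0 <= b by rewrite mulr_ge0 ?powR_ge0 ?sqr_ge0.
apply: ge_ereal_sup => _ [z _ <-].
rewrite -PhiE -[P _]fineK; last first.
  by apply: fin_num_measure; exact: measurable_selfnormalized.
rewrite -EFinB abse_EFin lee_fin; set pr := fine _.
have D2d : (max_degree e).+1%:R <= 2 * d by rewrite -natrM ler_nat mul2n -addnn -addn1 leq_add2l.
have Dk k : (max_degree e).+1%:R ^+ k <= 2 ^+ k * d ^+ k.
  by rewrite -exprMn lerXn2r ?nnegrE ?ler0n // mulr_ge0.
have db0 : 0 <= d ^+ 6 * b by rewrite mulr_ge0 // exprn_ge0.
have d9 : 0 <= d ^+ 9 * (r + g) by rewrite mulr_ge0 ?exprn_ge0 // ltW.
have two k : 0 <= (2 ^+ k : R) by rewrite exprn_ge0.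
rewrite (_ : (2 ^+ 11 + K * 2 ^+ 15) * d ^+ 9 * (1 + d ^+ 6 * b) * (r + g) =
  2 ^+ 11 * (d ^+ 9 * (r + g)) + (2 ^+ 11 * (d ^+ 6 * b) + K * 2 ^+ 15) * (d ^+ 9 * (r + g))
  + K * (2 ^+ 15 * d ^+ 15 * b * (r + g))); last by ring.
have [small|big] := leP ((max_degree e).+1%:R ^+ 8 * (r + g)) 8^-1.
  apply: le_trans (cdf_rate_small dg centred deg sigma2_bounds gamma_fin small z) _.
  apply: ler_wpDl.
    apply: addr_ge0; apply: mulr_ge0 => //; apply: addr_ge0; apply: mulr_ge0 => //; exact: ltW.
  rewrite ler_pM2l // ler_pM2r // ler_wpM2r //.
apply: le_trans (_ : 1 <= _).
  have p0 : 0 <= pr by exact: fine_ge0.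
  have p1 : pr <= 1.
    have := probability_le1 P (measurable_selfnormalized e X z); rewrite -lee_fin.
    by rewrite /pr fineK // fin_num_measure //; exact: measurable_selfnormalized.
  by have := Phi_ge0 z; have := Phi_le1 z; rewrite ler_norml; lra.
rewrite -addrA; apply: ler_wpDr.
  apply: addr_ge0; apply: mulr_ge0 => //; first by apply: addr_ge0; apply: mulr_ge0 => //; exact: ltW.
    exact: ltW.
  apply: mulr_ge0; last exact: ltW.
  by apply: mulr_ge0 => //; apply: mulr_ge0 => //; exact: exprn_ge0.
apply: le_trans (_ : 8 * ((max_degree e).+1%:R ^+ 8 * (r + g)) <= _); first by move: big; lra.
rewrite (_ : 2 ^+ 11 = 8 * 2 ^+ 8 :> R); last by ring.
rewrite -[leRHS]mulrA ler_pM2l // mulrA ler_pM2r //; apply: le_trans (Dk 8) _.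
by rewrite ler_wpM2l // ler_weXn2l.
Qed.
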